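(* Let $d\in\{2,3\}$, let $\Omega\subset\mathbb R^d$ be an open, bounded, convex polytopal domain and let $\mathbf f\in\mathbf L^\infty(\Omega)$. Let $(\mathbf y,p)\in\mathbf H_0^1(\Omega)\times L^2(\Omega)/\mathbb R$ be the solution of the Stokes problem $$a(\mathbf y,\mathbf v)+b(\mathbf v,p)=(\mathbf f,\mathbf v)_{\mathbf L^2(\Omega)}\ \ \forall\,\mathbf v\in\mathbf H_0^1(\Omega),\qquad b(\mathbf y,q)=0\ \ \forall\,q\in L^2(\Omega)/\mathbb R,$$ and, for $\mathscr T\in\mathbb T$, let $(\mathbf y_{\mathscr T},p_{\mathscr T})\in\mathbf V(\mathscr T)\times Q(\mathscr T)$ be its numerical approximation, i.e. the solution of $$a(\mathbf y_{\mathscr T},\mathbf v_{\mathscr T})+b(\mathbf v_{\mathscr T},p_{\mathscr T})=(\mathbf f,\mathbf v_{\mathscr T})_{\mathbf L^2(\Omega)}\ \ \forall\,\mathbf v_{\mathscr T}\in\mathbf V(\mathscr T),\qquad b(\mathbf y_{\mathscr T},q_{\mathscr T})=0\ \ \forall\,q_{\mathscr T}\in Q(\mathscr T).$$ Then, for every $T\in\mathscr T$, the local error indicator $$\mathcal E_{\infty,T}=h_T^2\|\mathbf f+\Delta\mathbf y_{\mathscr T}-\nabla p_{\mathscr T}\|_{\mathbf L^\infty(T)}+\tfrac{h_T}2\|[\![\nabla\mathbf y_{\mathscr T}\cdot\boldsymbol\nu]\!]\|_{\mathbf L^\infty(\partial T\setminus\partial\Omega)}+h_T\|\mathrm{div}\,\mathbf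 y_{\mathscr T}\|_{L^\infty(T)}$$ satisfies $$\mathcal E_{\infty,T}\le C\left(\|\mathbf y-\mathbf y_{\mathscr T}\|_{\mathbf L^\infty(\mathcal N_T)}+h_T\|p-p_{\mathscr T}\|_{L^\infty(\mathcal N_T)}+\mathrm{osc}_\infty(\mathbf f;\mathcal N_T)\right),$$ where the constant $C>0$ is independent of the continuous and discrete solutions, of the size of the elements of $\mathscr T$ and of $\#\mathscr T$.
   Context: Bold spaces are $d$-fold products; $a(\mathbf w,\mathbf v)=\int_\Omega\nabla\mathbf w:\nabla\mathbf v$, $b(\mathbf v,q)=-\int_\Omega q\,\mathrm{div}\,\mathbf v$; $L^2(\Omega)/\mathbb R$ is $L^2(\Omega)$ modulo constants, identified with the functions of zero mean. $\mathbb T$ is a family of conforming, shape regular simplicial meshes $\mathscr T=\{T\}$ of $\bar\Omega$ that are refinements of an initial mesh $\mathscr T_0$; $h_T=\mathrm{diam}(T)$. Sides are $(d-1)$-dimensional interior interelement boundaries; $\mathcal N_T$ is the union (also regarded as the set) of the elements $T'\in\mathscr T$ such that $T$ and $T'$ have an interior side in common (so $T\subset\mathcal N_T$). On an interior side $S$ shared by $T^\pm$, $[\![\mathbf V\cdot\boldsymbol\nu]\!]=\mathbf V|_{T^+}\cdot\boldsymbol\nu^++\mathbf V|_{T^-}\cdot\boldsymbol\nu^-$, with $\boldsymbol\nu^\pm$ the unit normals on $S$ pointing towards $T^\pm$. Taylor–Hood spaces: $Q(\mathscr T)=\{q\in C(\bar\Omega):q|_T\in\mathbb P_1(T)\ \forall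 T\in\mathscr T\}\cap L^2(\Omega)/\mathbb R$, $\mathbf V(\mathscr T)=\{\mathbf v\in\mathbf C(\bar\Omega):\mathbf v|_T\in\mathbb P_2(T)^d\ \forall T\in\mathscr T\}\cap\mathbf H_0^1(\Omega)$. Oscillation: for $\mathscr M\subset\mathscr T$, $\mathrm{osc}_\infty(\mathbf f;\mathscr M)=\max_{T\in\mathscr M}h_T^2\|\mathbf f-\Pi_{\mathscr T}(\mathbf f)\|_{\mathbf L^\infty(T)}$, where $\Pi_{\mathscr T}$ is the $L^2$-orthogonal projection onto piecewise linear functions over $\mathscr T$. *)

(* Defs.v *)
From HB Require Import structures.
From mathcomp Require Import all_boot all_order all_algebra finmap.
From mathcomp Require Import all_classical all_reals all_analysis.
From mathcomp Require Import -(notations) mpoly.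
Import Order.TTheory GRing.Theory Num.Theory.
Import numFieldNormedType.Exports.

Set Implicit Arguments.
Unset Strict Implicit.
Unset Printing Implicit Defensive.

Local Open Scope classical_set_scope.
Local Open Scope ring_scope.

Section row_measurable.
Context {R : realType} (n : nat).

Let coord (i : 'I_n) (x : 'rV[R]_n) : R := x ord0 i.

Let row_set0 : g_sigma_preimage coord set0.
Proof. exact: sigma_algebra0. Qed.

Let row_setC A : g_sigma_preimage coord A -> g_sigma_preimage coord (~` A).
Proof. exact: sigma_algebraC. Qed.

Let row_bigcup (F : _^nat) : (forall i, g_sigma_preimage coord (F i)) ->
  g_sigma_preimage coord (\bigcup_i (F i)).
Proof. exact: sigma_algebra_bigcup. Qed.

(* The sigma-algebra generated by the coordinates, that is, the Borel one. *)
HB.instance Definition _ := @isMeasurable.Build default_measure_display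
  'rV[R]_n (g_sigma_preimage coord) row_set0 row_setC row_bigcup.

Lemma measurable_coord (i : 'I_n) :
  measurable_fun [set: 'rV[R]_n] (fun x : 'rV[R]_n => x ord0 i).
Proof.
move=> _ Y mY; rewrite setTI; apply: sub_sigma_algebra => /=.
rewrite -bigcup_seq/=; exists i => /=; first by rewrite mem_index_enum.
by exists Y => //; rewrite setTI.
Qed.

Lemma measurable_fun_row d (T : measurableType d) (f : T -> 'rV[R]_n) :
  (forall i, measurable_fun [set: T] (fun t => f t ord0 i)) ->
  measurable_fun [set: T] f.
Proof.
move=> mf _ A; rewrite setTI /measurable/=.
have h : g_sigma_preimage coord `<=` [set B | measurable (f @^-1` B)].
  apply: smallest_sub.
    split.
    - by rewrite /= preimage_set0.
    - by move=> B mB /=; rewrite setTD preimage_setC; exact: measurableC.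
    - by move=> F mF /=; rewrite preimage_bigcup; apply: bigcup_measurable => k _; exact: mF.
  rewrite -bigcup_seq => B [i _ [C mC <-]] /=.
  rewrite setTI.
  have := mf i measurableT C mC; rewrite setTI; exact.
exact: h.
Qed.

End row_measurable.

(* Attaches the scalar [p.2] in front of the vector [p.1]. *)
Definition row_cons {R : realType} {n : nat} (p : 'rV[R]_n * R) : 'rV[R]_n.+1 :=
  \row_(i < n.+1) oapp (p.1 ord0) p.2 (unlift ord0 i).

Lemma measurable_row_cons {R : realType} {n : nat} :
  measurable_fun [set: 'rV[R]_n * R] (@row_cons R n).
Proof.
apply: measurable_fun_row => i; rewrite /row_cons.
case: (unliftP ord0 i) => [j|] ->.
  apply: (eq_measurable_fun (fun p : 'rV[R]_n * R => p.1 ord0 j)).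
    by move=> p _; rewrite mxE liftK.
  exact: (measurableT_comp (measurable_coord j) measurable_fst).
apply: (eq_measurable_fun (fun p : 'rV[R]_n * R => p.2)).
  by move=> p _; rewrite mxE unlift_none.
exact: measurable_snd.
Qed.

(* Lebesgue measure on R^n: image under [row_cons] of iterated products of the
   one-dimensional measure; for n = 0 it is the unit mass at the only point. *)
Fixpoint leb_rV {R : realType} (n : nat) : {measure set 'rV[R]_n -> \bar R} :=
  match n with
  | 0 => dirac (0 : 'rV[R]_0)
  | n.+1 => measure_function_pushforward__canonical__measure_function_Measure
     (product_measure1 (leb_rV n) lebesgue_measure) measurable_row_cons
  end.

Section euclidean_space.
Context {R : realType} {d : nat}.
Implicit Types (x y : 'rV[R]_d) (D : set 'rV[R]_d).

Definition dotp x y : R := \sum_(i < d) x ord0 i * y ord0 i.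

(* The library norm of ['rV[R]_d] is the maximum norm. *)
Definition enorm x : R := Num.sqrt (dotp x x).

Definition diam D : R := sup [set enorm (z.1 - z.2) | z in D `*` D].

Definition inball_diam D : R :=
  sup [set 2 * r | r in [set r : R | 0 <= r /\
    exists c, [set x | enorm (x - c) <= r] `<=` D]].

Definition conv_hull (A : {fset 'rV[R]_d}) : set 'rV[R]_d :=
  [set x | exists w : 'rV[R]_d -> R,
    [/\ forall v, v \in A -> 0 <= w v,
        \sum_(v <- A) w v = 1 &
        x = \sum_(v <- A) w v *: v]].

Definition affinely_independent (A : {fset 'rV[R]_d}) : Prop :=
  forall w : 'rV[R]_d -> R,
    \sum_(v <- A) w v = 0 -> \sum_(v <- A) w v *: v = 0 ->
    forall v, v \in A -> w v = 0.

(* [polynomial_on k D g] : g coincides on D with a polynomial of total degree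
   at most k; recall that [msize] is the degree plus one. *)
Definition polynomial_on (k : nat) D (g : 'rV[R]_d -> R) : Prop :=
  exists P : mpoly.mpoly d R, (mpoly.msize P <= k.+1)%N /\
    forall x, D x -> g x = mpoly.meval (fun i => x ord0 i) P.

Definition pderiv (i : 'I_d) (g : 'rV[R]_d -> R) : 'rV[R]_d -> R :=
  fun x => 'D_(delta_mx ord0 i) g x.

Fixpoint Ck (k : nat) (g : 'rV[R]_d -> R) : Prop :=
  match k with
  | 0 => continuous g
  | k.+1 => continuous g /\ forall i : 'I_d,
      (forall x, derivable g x (delta_mx ord0 i)) /\ Ck k (pderiv i g)
  end.

Definition Linf_norm D (g : 'rV[R]_d -> R) : \bar R :=
  'N[leb_rV d]_+oo[EFin \o (g \_ D)]%E.

(* For a vector field, the L^oo norm of its pointwise Euclidean length. *)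
Definition Linf_normv D (g : 'I_d -> 'rV[R]_d -> R) : \bar R :=
  Linf_norm D (fun x => enorm (\row_i g i x)).

End euclidean_space.

Section function_spaces.
Context {R : realType} {d : nat}.
Variable Omega : set 'rV[R]_d.
Local Notation field := ('I_d -> 'rV[R]_d -> R).

Definition test_function (phi : 'rV[R]_d -> R) : Prop :=
  [/\ forall k, Ck k phi,
      compact (closure [set x | phi x != 0]) &
      closure [set x | phi x != 0] `<=` Omega].

Definition L2 : set ('rV[R]_d -> R) := [set g : 'rV[R]_d -> R |
  measurable_fun Omega g /\ (\int[leb_rV d]_(x in Omega) (g x ^+ 2)%:E < +oo)%E].

(* Representatives of L^2 modulo constants with zero mean. *)
Definition L2_0 : set ('rV[R]_d -> R) := [set q : 'rV[R]_d -> R |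
  L2 q /\ \int[leb_rV d]_(x in Omega) q x = 0].

Definition Linf : set ('rV[R]_d -> R) := [set g : 'rV[R]_d -> R |
  measurable_fun Omega g /\ (Linf_norm Omega g < +oo)%E].

Definition is_wderiv (i : 'I_d) (v g : 'rV[R]_d -> R) : Prop :=
  forall phi, test_function phi ->
    \int[leb_rV d]_(x in Omega) (v x * pderiv i phi x) =
    - \int[leb_rV d]_(x in Omega) (g x * phi x).

(* A representative of the i-th weak derivative, unique almost everywhere and
   meaningful for v in H1. *)
Definition wderiv (i : 'I_d) (v : 'rV[R]_d -> R) : 'rV[R]_d -> R :=
  get [set g : 'rV[R]_d -> R | L2 g /\ is_wderiv i v g].

Definition H1 : set ('rV[R]_d -> R) := [set v : 'rV[R]_d -> R | L2 v /\
  forall i, exists g, L2 g /\ is_wderiv i v g].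

(* The closure of the test functions in the norm of H1. *)
Definition H10 : set ('rV[R]_d -> R) := [set v : 'rV[R]_d -> R | H1 v /\
  exists phi : nat -> 'rV[R]_d -> R, (forall n, test_function (phi n)) /\
    (fun n => \int[leb_rV d]_(x in Omega)
       ((v x - phi n x) ^+ 2
        + \sum_(i < d) (wderiv i v x - pderiv i (phi n) x) ^+ 2)%:E)%E
      @ \oo --> 0%E].

Definition H10v : set field := [set v | forall i, H10 (v i)].

Definition form_a (w v : field) : R :=
  \int[leb_rV d]_(x in Omega)
    (\sum_(i < d) \sum_(j < d) wderiv j (w i) x * wderiv j (v i) x).

Definition form_b (v : field) (q : 'rV[R]_d -> R) : R :=
  - \int[leb_rV d]_(x in Omega) (q x * \sum_(i < d) wderiv i (v i) x).

Definition L2_dot (f v : field) : R :=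
  \int[leb_rV d]_(x in Omega) (\sum_(i < d) f i x * v i x).

(* The Stokes problem posed on velocity space V and pressure space Q. *)
Definition stokes_solution (V : set field) (Q : set ('rV[R]_d -> R))
    (f y : field) (p : 'rV[R]_d -> R) : Prop :=
  [/\ V y, Q p,
      forall v, V v -> form_a y v + form_b v p = L2_dot f v &
      forall q, Q q -> form_b y q = 0].

End function_spaces.

(* A simplex is given by its finite set of vertices, its faces are the subsets,
   and a mesh is a finite set of d-simplices. *)
Section meshes.
Context {R : realType} {d : nat}.
Local Notation simplex := {fset 'rV[R]_d}.
Local Notation mesh := {fset {fset 'rV[R]_d}}.
Implicit Types (T S : simplex) (M : mesh).

Definition is_simplex T : Prop := #|` T| = d.+1 /\ affinely_independent T.

Definition conforming_mesh (Omega : set 'rV[R]_d) M : Prop :=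
  [/\ forall T, T \in M -> is_simplex T,
      \bigcup_(T in [set T | T \in M]) conv_hull T = closure Omega &
      forall T T', T \in M -> T' \in M ->
        conv_hull T `&` conv_hull T' = conv_hull (T `&` T')%fset].

Definition refines M M0 : Prop := forall T, T \in M ->
  exists2 T0, T0 \in M0 & conv_hull T `<=` conv_hull T0.

Definition mesh_size T : R := diam (conv_hull T).

Definition shape_regular (TT : set mesh) : Prop :=
  exists sigma : R, forall M T, TT M -> T \in M ->
    mesh_size T <= sigma * inball_diam (conv_hull T).

Definition share_side T T' : bool := #|` (T `&` T')%fset| == d.

(* The elements of the patch of T; T itself always belongs to it. *)
Definition elem_patch M T : mesh :=
  [fset T' in M | (T' == T) || share_side T T']%fset.

Definition patch_dom M T : set 'rV[R]_d :=
  \bigcup_(T' in [set T' | T' \in elem_patch M T]) conv_hull T'.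

Definition taylor_hood_Q (Omega : set 'rV[R]_d) M : set ('rV[R]_d -> R) :=
  [set q : 'rV[R]_d -> R | [/\ {within closure Omega, continuous q},
    forall T, T \in M -> polynomial_on 1 (conv_hull T) q &
    L2_0 Omega q]].

Definition taylor_hood_V (Omega : set 'rV[R]_d) M :
    set ('I_d -> 'rV[R]_d -> R) :=
  [set v | [/\ forall i, {within closure Omega, continuous (v i)},
    forall T, T \in M -> forall i, polynomial_on 2 (conv_hull T) (v i) &
    H10v Omega v]].

(* Piecewise linear functions need not be continuous, and elements overlap on
   their boundaries, so the polynomials are prescribed in the interiors. *)
Definition pw_linear (Omega : set 'rV[R]_d) M : set ('rV[R]_d -> R) :=
  [set g : 'rV[R]_d -> R | L2 Omega g /\ forall T, T \in M ->
    polynomial_on 1 (interior (conv_hull T)) g].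

(* A representative of the L^2-projection, unique almost everywhere. *)
Definition L2_proj (Omega : set 'rV[R]_d) M (g : 'rV[R]_d -> R) :
    'rV[R]_d -> R :=
  get [set g' | pw_linear Omega M g' /\ forall w, pw_linear Omega M w ->
    \int[leb_rV d]_(x in Omega) ((g x - g' x) * w x) = 0].

(* osc(f; M') for a subset M' of the mesh M. *)
Definition osc (Omega : set 'rV[R]_d) M (f : 'I_d -> 'rV[R]_d -> R) M' :
    \bar R :=
  \big[maxe/0%E]_(T <- M') ((mesh_size T ^+ 2)%:E *
    Linf_normv (conv_hull T) (fun i x => f i x - L2_proj Omega M (f i) x)%R)%E.

(* The unit normal on the side with vertices S pointing towards T. *)
Definition side_normal S T : 'rV[R]_d := get [set nu |
  [/\ enorm nu = 1,
      forall x y, conv_hull S x -> conv_hull S y -> dotp nu (x - y) = 0 &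
      forall x y, conv_hull T x -> conv_hull S y -> 0 <= dotp nu (x - y)]].

(* The value at x of the restriction of g to T, as a limit from inside T. *)
Definition trace T (g : 'rV[R]_d -> R) (x : 'rV[R]_d) : R :=
  lim (g z @[z --> within (interior (conv_hull T)) (nbhs x)]).

(* The jump of the normal component of V across the side shared by T, T'. *)
Definition normal_jump T T' (V : 'I_d -> 'rV[R]_d -> R) (x : 'rV[R]_d) : R :=
  \sum_(j < d) (trace T (V j) x * side_normal (T `&` T')%fset T ord0 j
              + trace T' (V j) x * side_normal (T `&` T')%fset T' ord0 j).

Definition ref_simplex (n : nat) : set 'rV[R]_n :=
  [set t | (forall i, 0 <= t ord0 i) /\ \sum_(i < n) t ord0 i <= 1].

(* The affine parametrization of the side S by the reference simplex, for the
   enumeration of the vertices underlying the finite set S. *)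
Definition side_param S (t : 'rV[R]_d.-1) : 'rV[R]_d :=
  S`_0 + \sum_(i < d.-1) t ord0 i *: (S`_i.+1 - S`_0).

(* The L^oo norm on S for the surface measure, which is, up to a constant
   factor, the image of Lebesgue measure under [side_param S]. *)
Definition Linf_norm_side S (g : 'rV[R]_d -> R) : \bar R :=
  'N[leb_rV d.-1]_+oo[EFin \o ((g \o side_param S) \_ (@ref_simplex d.-1))]%E.

Definition laplacian (g : 'rV[R]_d -> R) : 'rV[R]_d -> R :=
  fun x => \sum_(j < d) pderiv j (pderiv j g) x.

(* Up to a null set, the boundary of T minus that of Omega is the union of the
   sides that T shares with other elements of M. *)
Definition jump_norm M T (y : 'I_d -> 'rV[R]_d -> R) : \bar R :=
  \big[maxe/0%E]_(T' <- M | share_side T T')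
    Linf_norm_side (T `&` T')%fset (fun x =>
      enorm (\row_i normal_jump T T' (fun j => pderiv j (y i)) x)).

(* The derivatives of y and p are classical and taken in the interior of T,
   whose boundary is a null set. *)
Definition error_indicator M (f y : 'I_d -> 'rV[R]_d -> R) (p : 'rV[R]_d -> R) T :
    \bar R :=
  ((mesh_size T ^+ 2)%:E * Linf_normv (conv_hull T)
      (fun i x => f i x + laplacian (y i) x - pderiv i p x)%R
   + (mesh_size T / 2)%:E * jump_norm M T y
   + (mesh_size T)%:E * Linf_norm (conv_hull T)
      (fun x => \sum_(i < d) pderiv i (y i) x)%R)%E.

End meshes.

(* Main.v *)
Require Import Defs.
From HB Require Import structures.
From mathcomp Require Import all_boot all_order all_algebra finmap.
From mathcomp Require Import all_classical all_reals all_analysis.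
From mathcomp Require Import measurable_realfun ess_sup_inf.
From mathcomp Require Import -(notations) mpoly.
From mathcomp Require Import ring lra.
Import Order.TTheory GRing.Theory Num.Theory.
Import numFieldNormedType.Exports.

Set Implicit Arguments.
Unset Strict Implicit.
Unset Printing Implicit Defensive.

Local Open Scope classical_set_scope.
Local Open Scope ring_scope.

(* Testing the momentum equation with a smooth bump [phi] and moving all the
   derivatives to [phi], one sees that the integral of
   [yM * laplacian phi + pM * pderiv i phi + f * phi] is controlled by the sizes
   of [y - yM] and [p - pM] on the support.  Inside an element, [yM] and [pM] are
   polynomials, and for [phi] even about [c] this integral is, up to oscillation,
   the residual at [c] times the mass of [phi]; the divergence is treated alike.
   For [c] on a side, with [lam] the signed distance to its hyperplane, oddness
   leaves, besides element residuals, half the normal jump at [c] times the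
   integral of [`|lam| * laplacian phi]; an averaging argument yields a [phi] for
   which the latter is bounded below.  An affine function is controlled by its
   values at finitely many points well inside a simplex, around which bumps of
   radius comparable to the mesh size fit, by shape regularity. *)

(** * Lebesgue measure on row vectors *)

(** Green's formula on the two halves of a cube would produce the normal jump as a surface integral
    of the bump over the side. Only volume integrals are used instead: the polynomials of the two
    elements are glued by means of [sgn], a factor odd about [c], and the jump then multiplies the
    integral of [|lam|] against the Laplacian of the bump. Formally this is twice the surface
    integral; its lower bound comes from averaging over translations along the normal, which turns
    [|lam|] into a quadratic function. Near a side, [f] is replaced on each half by the constant
    that makes the element residual vanish at [c]. The error made is the element residual plus
    oscillation, so the element bound is proved first. With bumps of radius [r], the residual is
    controlled by [E / r ^+ 2 + eps / r + o] for errors [E], [eps], [o] of velocity, pressure and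
    source; jump and divergence gain a factor [r]. As [r] is a fixed fraction of the mesh size, the
    weights of the indicator cancel the powers of [r], and the constant depends only on [d] and on
    shape regularity. *)

Section cubes.
Context {R : realType}.

(** Closed balls of the maximum norm, given by coordinates so that [row_cons] splits them as
    products. *)
Definition cube {n} (c : 'rV[R]_n) (r : R) : set 'rV[R]_n :=
  [set x | forall i, `|x ord0 i - c ord0 i| <= r].

Definition row_tail {n} (x : 'rV[R]_n.+1) : 'rV[R]_n :=
  \row_j x ord0 (lift ord0 j).

Lemma row_cons0 n (p : 'rV[R]_n * R) : row_cons p ord0 ord0 = p.2.
Proof. by rewrite /row_cons mxE unlift_none. Qed.

Lemma row_consS n (p : 'rV[R]_n * R) i : row_cons p ord0 (lift ord0 i) = p.1 ord0 i.
Proof. by rewrite /row_cons mxE liftK. Qed.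

Lemma measurable_cube n (c : 'rV[R]_n) r : measurable (cube c r).
Proof.
have -> : cube c r = \big[setI/setT]_(i < n)
    [set x : 'rV[R]_n | `|x ord0 i - c ord0 i| <= r].
  apply/seteqP; split => [x cx|x].
    by rewrite -bigcap_seq => i _; exact: cx.
  by rewrite -bigcap_seq => cx i; apply: cx; rewrite /= mem_index_enum.
apply: bigsetI_measurable => i _.
have m : measurable_fun setT (fun x : 'rV[R]_n => `|x ord0 i - c ord0 i|).
  apply: measurableT_comp => //; apply: measurable_funB => //.
  exact: measurable_coord.
have := m measurableT `]-oo, r]%classic (measurable_itv _); rewrite setTI.
by congr measurable; apply/seteqP; split => x/=; rewrite in_itv.
Qed.

Lemma leb_rVS n (A : set 'rV[R]_n.+1) :
  leb_rV n.+1 A = product_measure1 (leb_rV n) lebesgue_measure (row_cons @^-1` A).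
Proof. by []. Qed.

Lemma leb_cube n (c : 'rV[R]_n) r : 0 <= r -> leb_rV n (cube c r) = ((2 * r) ^+ n)%:E.
Proof.
move=> r0; elim: n c => [|n ih] c.
  by rewrite expr0 /= diracE mem_set// => -[].
rewrite leb_rVS (_ : _ @^-1` _ = cube (row_tail c) r `*`
   `[c ord0 ord0 - r, c ord0 ord0 + r]%classic); last first.
  apply/seteqP; split => -[x t]/=.
    move=> h; split => [i|].
      by have := h (lift ord0 i); rewrite row_consS mxE.
    by have := h ord0; rewrite row_cons0/= in_itv/= ler_distl.
  move=> [h1 h2] i; case: (unliftP ord0 i) => [j|] ->.
    by rewrite row_consS; have := h1 j; rewrite mxE.
  by rewrite row_cons0/=; move: h2; rewrite in_itv/= ler_distl.
rewrite product_measure1E//; last exact: measurable_cube.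
rewrite ih; transitivity (((2 * r) ^+ n)%:E * (2 * r)%:E)%E; last first.
  by rewrite -EFinM exprSr.
congr (_ * _)%E; apply: (eq_trans (lebesgue_measure_itv _)); rewrite /= lte_fin.
case: ifPn => [_|]; first by rewrite -EFinD; congr EFin; ring.
rewrite -leNgt => h; congr EFin; lra.
Qed.

Lemma leb_rV_sigma_finite n : sigma_finite setT (leb_rV n : set 'rV[R]_n -> \bar R).
Proof.
exists (fun k => cube 0 k%:R).
  apply/seteqP; split => // x _.
  exists (Num.truncn (\sum_(i < n) `|x ord0 i|)).+1 => //= i.
  rewrite mxE subr0; apply: le_trans (ltW (truncnS_gt _)).
  by rewrite (bigD1 i)//= lerDl sumr_ge0.
move=> k; split; first exact: measurable_cube.
by rewrite leb_cube// ltry.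
Qed.

End cubes.

(* Packs a measure with a proof of sigma-finiteness; the measure [leb_rV n] is
   given as a structure, to which no canonical instance can be attached. *)
Section sigma_finite_copy.
Context d (T : measurableType d) {R : realType}.
Context (m : {measure set T -> \bar R}) (sf : sigma_finite setT m).

Definition sigma_finite_copy of sigma_finite setT m : set T -> \bar R := m.

HB.instance Definition _ :=
  measure_function.Measure.copy (sigma_finite_copy sf) m.

HB.instance Definition _ :=
  Measure_isSigmaFinite.Build _ _ _ (sigma_finite_copy sf) sf.

Lemma sigma_finite_copyE : sigma_finite_copy sf = m :> {measure set T -> \bar R}.
Proof.
have eta (m' : {measure set T -> \bar R}) :
  measure_function.Measure.Pack (measure_function.Measure.class m') = m' by case: m'.
exact: (eta m).
Qed.

End sigma_finite_copy.

Section pushforward_product.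
Local Open Scope ereal_scope.
Context d1 d2 d3 (T1 : measurableType d1) (T2 : measurableType d2)
  (Y : measurableType d3) {R : realType}.
Context (m1 : {measure set T1 -> \bar R}) (sf1 : sigma_finite setT m1).
Context (m2 : {sigma_finite_measure set T2 -> \bar R}).
Context (phi : T1 * T2 -> Y) (mphi : measurable_fun setT phi).
Implicit Types F : Y -> \bar R.

Lemma ge0_integral_pushforward_product F :
  measurable_fun setT F -> (forall y, 0 <= F y) ->
  \int[pushforward (m1 \x m2) phi]_y F y = \int[m1]_x \int[m2]_t F (phi (x, t)).
Proof.
move=> mF F0; rewrite ge0_integral_pushforward//= preimage_setT.
have mFp : measurable_fun setT (F \o phi) by exact: measurableT_comp.
(* [m1] is replaced by its copy, whose structure carries the sigma-finiteness that Tonelli's theorem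
   asks for. *)
rewrite -(sigma_finite_copyE sf1) (fubini_tonelli1 (F \o phi)); [by []|by []|by move=> x; exact: F0].
Qed.

Lemma ge0_integral_pushforward_product_swap F :
  measurable_fun setT F -> (forall y, 0 <= F y) ->
  \int[pushforward (m1 \x m2) phi]_y F y = \int[m2]_t \int[m1]_x F (phi (x, t)).
Proof.
move=> mF F0; rewrite ge0_integral_pushforward//= preimage_setT.
have mFp : measurable_fun setT (F \o phi) by exact: measurableT_comp.
rewrite -(sigma_finite_copyE sf1) (fubini_tonelli2 (F \o phi)); [by []|by []|by move=> x; exact: F0].
Qed.

Let integrable_comp F : measurable_fun setT F ->
  (pushforward (m1 \x m2) phi).-integrable setT F ->
  (m1 \x m2).-integrable setT (F \o phi).
Proof.
move=> mF /integrableP[_ h]; apply/integrableP; split; first exact: measurableT_comp.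
move: h; rewrite ge0_integral_pushforward//= ?preimage_setT//.
exact: measurableT_comp.
Qed.

Lemma integral_pushforward_product F :
  (pushforward (m1 \x m2) phi).-integrable setT F ->
  \int[pushforward (m1 \x m2) phi]_y F y = \int[m1]_x \int[m2]_t F (phi (x, t)).
Proof.
move=> iF; have mF := measurable_int _ iF.
have i := integrable_comp mF iF.
rewrite (integral_pushforward mphi mF)//= preimage_setT.
move: i; rewrite -(sigma_finite_copyE sf1) => i.
exact: (esym (integral12_prod_meas1 i)).
Qed.

Lemma integral_pushforward_product_swap F :
  (pushforward (m1 \x m2) phi).-integrable setT F ->
  \int[pushforward (m1 \x m2) phi]_y F y = \int[m2]_t \int[m1]_x F (phi (x, t)).
Proof.
move=> iF; have mF := measurable_int _ iF.
have i := integrable_comp mF iF.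
rewrite (integral_pushforward mphi mF)//= preimage_setT.
move: i; rewrite -(sigma_finite_copyE sf1) => i.
exact: (esym (integral21_prod_meas1 i)).
Qed.

(** The comparison of slice integrals in [exists_shift] goes through [le_integral], which asks for
    this. The absolute value of a slice integral is at most the slice integral of the absolute
    value, and Tonelli bounds the latter. *)
Lemma integrable_pushforward_product_swap F :
  (pushforward (m1 \x m2) phi).-integrable setT F ->
  m2.-integrable setT (fun t => \int[m1]_x F (phi (x, t))).
Proof.
move=> iF; have := integrable_comp (measurable_int _ iF) iF.
rewrite -(sigma_finite_copyE sf1) => i.
have mG := measurable_fubini_G i.
apply/integrableP; split; first exact: mG.
have mf := measurable_int _ i.
have h := (integrable21ltyP (sigma_finite_copy sf1) m2 mf).1 i.
apply: le_lt_trans h.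
apply: ge0_le_integral => //.
- exact: measurableT_comp.
- have mabs : measurable_fun setT (abse \o (F \o phi)) by exact: measurableT_comp.
  exact: (@measurable_fun_fubini_tonelli_G _ _ _ _ _ (sigma_finite_copy sf1) _ mabs (fun=> abse_ge0 _)).
- move=> t _; apply: le_abse_integral => //.
  exact: (measurableT_comp mf (pair2_measurable _)).
Qed.

End pushforward_product.

Section integral_leb_rV.
Local Open Scope ereal_scope.
Context {R : realType} {n : nat}.
Implicit Types F : 'rV[R]_n.+1 -> \bar R.

Lemma ge0_integral_leb_rVS F : measurable_fun setT F -> (forall y, 0 <= F y) ->
  \int[leb_rV n.+1]_y F y =
  \int[leb_rV n]_x \int[lebesgue_measure]_t F (row_cons (x, t)).
Proof. exact: (ge0_integral_pushforward_product (leb_rV_sigma_finite n) lebesgue_measure measurable_row_cons). Qed.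

Lemma ge0_integral_leb_rVS_swap F : measurable_fun setT F -> (forall y, 0 <= F y) ->
  \int[leb_rV n.+1]_y F y =
  \int[lebesgue_measure]_t \int[leb_rV n]_x F (row_cons (x, t)).
Proof. exact: (ge0_integral_pushforward_product_swap (leb_rV_sigma_finite n) lebesgue_measure measurable_row_cons). Qed.

Lemma integral_leb_rVS F : (leb_rV n.+1).-integrable setT F ->
  \int[leb_rV n.+1]_y F y =
  \int[leb_rV n]_x \int[lebesgue_measure]_t F (row_cons (x, t)).
Proof.
by move=> iF; exact: (@integral_pushforward_product _ _ _ _ _ _ R _ (leb_rV_sigma_finite n) lebesgue_measure _ measurable_row_cons F iF). Qed.

Lemma integral_leb_rVS_swap F : (leb_rV n.+1).-integrable setT F ->
  \int[leb_rV n.+1]_y F y =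
  \int[lebesgue_measure]_t \int[leb_rV n]_x F (row_cons (x, t)).
Proof. by move=> iF; exact: (@integral_pushforward_product_swap _ _ _ _ _ _ R _ (leb_rV_sigma_finite n) lebesgue_measure _ measurable_row_cons F iF). Qed.

Lemma integrable_leb_rVS_swap F : (leb_rV n.+1).-integrable setT F ->
  lebesgue_measure.-integrable setT (fun t => \int[leb_rV n]_x F (row_cons (x, t))).
Proof. by move=> iF; exact: (@integrable_pushforward_product_swap _ _ _ _ _ _ R _ (leb_rV_sigma_finite n) lebesgue_measure _ measurable_row_cons F iF). Qed.

End integral_leb_rV.

(** * Borel structure of the space of row vectors *)

Section rV_borel.
Context {R : realType} {n : nat}.
Implicit Types (A : set 'rV[R]_n) (x c : 'rV[R]_n).

Lemma nbhs_cube x A : nbhs x A -> exists2 r, 0 < r & cube x r `<=` A.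
Proof.
move=> /nbhs_ballP[e /= e0 xeA]; exists (e / 2); first by rewrite divr_gt0.
move=> y xy; apply: xeA; split => // i j; rewrite (ord1 i) -ball_normE/= distrC.
by apply: le_lt_trans (xy j) _; rewrite ltr_pdivrMr// ltr_pMr// ltr1n.
Qed.

Lemma cube_nbhs x r : 0 < r -> nbhs x (cube x r).
Proof.
move=> r0; apply/nbhs_ballP; exists r => //= y [_ xy] i.
by have := xy ord0 i; rewrite -ball_normE/= distrC => /ltW.
Qed.

Lemma compact_cube x r : compact (cube x r).
Proof.
have -> : cube x r = [set v | forall i, `[x ord0 i - r, x ord0 i + r]%classic (v ord0 i)].
  by apply/seteqP; split => y xy i; have := xy i; rewrite /= in_itv/= ler_distl.
by apply: (@rV_compact _ _ (fun i => `[x ord0 i - r, x ord0 i + r]%classic)) => i; exact: segment_compact.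
Qed.

Lemma closed_cube x r : closed (cube x r).
Proof. by apply: compact_closed; [exact: norm_hausdorff|exact: compact_cube]. Qed.

Let rat_cube (p : 'rV[rat]_n * nat) : set 'rV[R]_n :=
  cube (map_mx ratr p.1) p.2.+1%:R^-1.

(** Cubes with rational centre and radius [1 / (k + 1)] form a countable base, and a countable union
    is what the measurability of open sets requires. *)
Lemma open_rat_cubes A : open A ->
  A = \bigcup_p (if `[< rat_cube p `<=` A >] then rat_cube p else set0).
Proof.
move=> oA; apply/seteqP; split => [x Ax|x [p _]]; last first.
  by case: asboolP => // + px; exact.
have [r r0 xrA] := nbhs_cube (open_nbhs_nbhs (conj oA Ax)).
(* The rational centre will lie within [1 / (k + 1)] of [x], so its cube stays within twice that
   distance of [x], hence within [r]. *)
have [k kr] : exists k, k.+1%:R^-1 < r / 2.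
  exists (Num.truncn (2 / r)); rewrite invf_plt ?posrE ?divr_gt0//.
  by rewrite invf_div; exact: truncnS_gt.
have /choice [q hq] : forall i, exists q : rat, `|x ord0 i - ratr q| <= k.+1%:R^-1.
  move=> i; have [|q] := @rat_in_itvoo R (x ord0 i - k.+1%:R^-1) (x ord0 i).
    by rewrite ltrBlDr ltrDl invr_gt0.
  rewrite in_itv/= => /andP[h1 h2]; exists q; rewrite ger0_norm; last by rewrite subr_ge0 ltW.
  by rewrite lerBlDr addrC -lerBlDr ltW.
exists (\row_i q i, k) => //; case: asboolP => [_ i|]; first by rewrite !mxE.
move=> []; apply: subset_trans xrA => y yq i.
have := yq i; have := hq i; rewrite !mxE /= => h1 h2.
rewrite -(subrK (ratr (q i)) (y ord0 i)) -addrA.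
apply: le_trans (ler_normD _ _) _; rewrite [leRHS](splitr r) lerD//.
  exact: le_trans h2 (ltW kr).
by rewrite distrC; exact: le_trans h1 (ltW kr).
Qed.

Lemma open_measurable_rV A : open A -> measurable A.
Proof.
move=> /open_rat_cubes ->; apply: countable_bigcupT_measurable => // p.
by case: ifP => // _; exact: measurable_cube.
Qed.

Lemma continuous_measurable_rV (f : 'rV[R]_n -> R) :
  continuous f -> measurable_fun setT f.
Proof.
move=> cf; apply: (measurability _ (RGenOpens.measurableE R)) => _ [_ [a [b ->] <-]].
rewrite setTI; apply: open_measurable_rV.
by move/continuousP : cf; apply; exact: interval_open.
Qed.

End rV_borel.

(** * Point reflections and odd integrands *)

Section reflection.
Context {R : realType}.

(** By uniqueness of Lebesgue measure it suffices to look at the intervals []a, b]], whose preimages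
    are the intervals [[c - b, c - a[] of the same length. *)
Lemma lebesgue_measure_reflect (c : R) (A : set (measurableTypeR R)) : measurable A ->
  lebesgue_measure ((fun t : measurableTypeR R => c - t) @^-1` A) = lebesgue_measure A.
Proof.
have mc : measurable_fun setT (fun t : measurableTypeR R => c - t : measurableTypeR R).
  exact: measurable_funB.
move=> mA; apply/esym.
apply: (@lebesgue_measure_unique R
  (measure_function_pushforward__canonical__measure_function_Measure lebesgue_measure mc)) => //= _ [[a b]] _ <-.
rewrite /pushforward.
rewrite (_ : _ @^-1` _ = `[c - b, c - a[%classic); last first.
  apply/seteqP; split => t/=; rewrite !in_itv/=; lra.
rewrite !lebesgue_measure_itv/= !lte_fin ltrD2l ltrN2; case: ifP => // _.
rewrite -!EFinD; congr EFin; ring.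
Qed.

Lemma ge0_integral_reflect1 (c : R) (F : R -> \bar R) :
  measurable_fun setT F -> (forall y, 0 <= F y)%E ->
  (\int[lebesgue_measure]_t F (c - t)%R = \int[lebesgue_measure]_t F t)%E.
Proof.
move=> mF F0.
have mc : measurable_fun setT (fun t : measurableTypeR R => c - t : measurableTypeR R).
  exact: measurable_funB.
have := @ge0_integral_pushforward _ _ (measurableTypeR R) (measurableTypeR R) R _ mc lebesgue_measure setT F measurableT mF (fun x _ => F0 x).
rewrite preimage_setT => <-.
by apply: eq_measure_integral => //= A mA _; rewrite /pushforward lebesgue_measure_reflect.
Qed.

Lemma measurable_reflect n (c : 'rV[R]_n) :
  measurable_fun setT (fun x : 'rV[R]_n => c - x).
Proof.
apply: measurable_fun_row => i; under eq_fun do rewrite !mxE.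
by apply: measurable_funB => //; exact: measurable_coord.
Qed.

Lemma row_cons_reflect n (c : 'rV[R]_n.+1) x t :
  row_cons (row_tail c - x, c ord0 ord0 - t) = c - row_cons (x, t).
Proof.
by apply/rowP => i; case: (unliftP ord0 i) => [j|] ->;
  rewrite ?row_consS ?row_cons0 !mxE ?row_consS ?row_cons0 ?liftK ?unlift_none.
Qed.

(** Induction on the dimension, Tonelli splitting off the first coordinate. Besides producing
    cancellations of odd integrands, reflections also stand in for translations: composed with the
    evenness of the bumps they move the centre of a bump. *)
Lemma ge0_integral_reflect n (c : 'rV[R]_n) (F : 'rV[R]_n -> \bar R) :
  measurable_fun setT F -> (forall y, 0 <= F y)%E ->
  (\int[leb_rV n]_x F (c - x)%R = \int[leb_rV n]_x F x)%E.
Proof.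
elim: n c F => [|n ih] c F mF F0.
  by apply: eq_integral => x _; congr F; apply/rowP => -[].
rewrite ge0_integral_leb_rVS//; last first.
  exact: measurableT_comp (measurable_reflect c).
rewrite ge0_integral_leb_rVS//.
pose G x := (\int[lebesgue_measure]_t F (row_cons (x, t)))%E.
have mFp := measurableT_comp mF (@measurable_row_cons R n).
transitivity (\int[leb_rV n]_x G (row_tail c - x)%R)%E.
  apply: eq_integral => x _.
  have mt : measurable_fun setT (fun t : measurableTypeR R => F (row_cons (row_tail c - x, t))).
    exact: (measurableT_comp mFp (pair1_measurable _)).
  rewrite /G; apply: (etrans _ (ge0_integral_reflect1 (c ord0 ord0) mt (fun t => F0 _))).
  by apply: eq_integral => t _; rewrite row_cons_reflect.
apply: ih; last by move=> x; exact: integral_ge0.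
exact: (@measurable_fun_fubini_tonelli_F _ _ _ _ _ lebesgue_measure _ mFp (fun p => F0 _)).
Qed.

(* The positive and negative parts of an odd function are exchanged by the reflection. *)
Lemma integral_odd n (c : 'rV[R]_n) (g : 'rV[R]_n -> R) : measurable_fun setT g ->
  (forall x, g (c - x) = - g x) -> \int[leb_rV n]_x g x = 0.
Proof.
move=> mg og; rewrite /Rintegral integralE.
have -> : (\int[leb_rV n]_x (EFin \o g)^\- x = \int[leb_rV n]_x (EFin \o g)^\+ x)%E.
  have mg' : measurable_fun setT (EFin \o g)^\-%E by apply: measurable_funeneg; exact/measurable_EFinP.
  rewrite -(ge0_integral_reflect c mg')//.
  by apply: eq_integral => x _; rewrite funenegE funeposE/= og opprK.
(* If the common value is infinite, [fine] sends the difference to 0, so integrability is not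
   assumed. *)
by case: (integral _ _ _) => //= r; rewrite subrr.
Qed.

End reflection.

Section affine_null.
Context {R : realType}.

Lemma dotp_row_cons n (b : 'rV[R]_n.+1) x t :
  dotp b (row_cons (x, t)) = b ord0 ord0 * t + dotp (row_tail b) x.
Proof.
rewrite /dotp big_ord_recl row_cons0; congr +%R.
by apply: eq_bigr => i _; rewrite row_consS mxE.
Qed.

Lemma measurable_dotp n (b : 'rV[R]_n) : measurable_fun setT (dotp b).
Proof.
apply: measurable_sum => i; apply: measurable_funM => //; exact: measurable_coord.
Qed.

Lemma measurable_hyperplane n (b : 'rV[R]_n) (c : R) : measurable [set x | dotp b x = c].
Proof.
have := measurable_dotp b measurableT (measurable_set1 c); rewrite setTI.
by congr measurable; apply/seteqP; split.
Qed.

(** Induction on the dimension. If the first entry of [b] vanishes, each slice is a hyperplane one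
    dimension lower; otherwise each line along the first axis meets the set in a single point. Faces
    of simplices and sides are null sets for this reason. *)
Lemma leb_hyperplane n (b : 'rV[R]_n) (c : R) : b != 0 ->
  leb_rV n [set x | dotp b x = c] = 0%E.
Proof.
elim: n b c => [|n ih] b c b0; first by case/eqP : b0; apply/rowP => -[].
have mA := measurable_hyperplane b c; set A := (X in leb_rV _ X).
have m1A : measurable_fun setT (EFin \o (\1_A : 'rV[R]_n.+1 -> R)).
  by apply/measurable_EFinP; exact: measurable_indic.
rewrite -[X in leb_rV _ X]setIT -integral_indic//.
have [bt0|bt0] := eqVneq (b ord0 ord0) 0.
- rewrite ge0_integral_leb_rVS_swap//.
  apply: integral0_eq => t _ /=.
  have tb0 : row_tail b != 0.
    apply: contraNN b0 => /eqP/rowP tb; apply/eqP/rowP => i.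
    case: (unliftP ord0 i) => [j|] ->; last by rewrite mxE.
    by have := tb j; rewrite !mxE.
  rewrite -[RHS](ih _ c tb0) -[X in _ = leb_rV _ X]setIT -integral_indic//; last exact: measurable_hyperplane.
  apply: eq_integral => x _; congr EFin; rewrite !indicE; congr (nat_of_bool _)%:R.
  by apply/idP/idP; rewrite !inE /A/= dotp_row_cons bt0 mul0r add0r.
- rewrite ge0_integral_leb_rVS//.
  apply: integral0_eq => x _ /=.
  rewrite -[RHS](lebesgue_measure_set1 ((c - dotp (row_tail b) x) / b ord0 ord0)).
  rewrite -[X in _ = lebesgue_measure X]setIT -integral_indic//.
  apply: eq_integral => t _; congr EFin; rewrite !indicE; congr (nat_of_bool _)%:R.
  apply/idP/idP; rewrite !inE /A/= dotp_row_cons.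
    by move=> <-; rewrite addrK mulrC mulKf.
  by move=> ->; rewrite mulrC divfK// subrK.
Qed.

End affine_null.

Section compact_support.
Context {R : realType} {n : nat}.
Implicit Types (F : 'rV[R]_n -> R) (c : 'rV[R]_n).

Lemma supported_bounded F c b : continuous F -> (forall x, ~ cube c b x -> F x = 0) ->
  exists2 M, 0 <= M & forall x, `|F x| <= M.
Proof.
move=> cF F0.
have : compact (F @` cube c b).
  by apply: continuous_compact (@compact_cube _ _ c b); exact: continuous_subspaceT.
move=> /compact_bounded[M [_ hM]]; exists (`|M| + 1); first by rewrite addr_ge0.
move=> x; have [cx|ncx] := pselect (cube c b x); last by rewrite F0// normr0 addr_ge0.
by apply: (hM (`|M| + 1)); [rewrite ltr_pwDr// ler_norm|exists x].
Qed.

Lemma integrable_supported F c b M : 0 <= b -> measurable_fun setT F ->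
  (forall x, ~ cube c b x -> F x = 0) -> (forall x, `|F x| <= M) ->
  (leb_rV n).-integrable setT (EFin \o F).
Proof.
move=> b0 mF F0 FM.
have mc : measurable (cube c b) by exact: measurable_cube.
have -> : EFin \o F = (EFin \o F) \_ (cube c b).
  apply/funext => x; rewrite patchE; case: ifPn => //; rewrite notin_setE => /F0/=.
  by move=> ->.
apply/(integrable_mkcond _ mc); apply: measurable_bounded_integrable => //.
- by rewrite leb_cube// ltry.
- exact: measurable_funTS.
- exists M; split; first exact: num_real.
  by move=> y My x _; exact: le_trans (FM x) (ltW My).
Qed.

Lemma norm_Rintegral_supported F c b M : 0 <= b -> measurable_fun setT F ->
  (forall x, ~ cube c b x -> F x = 0) -> (forall x, `|F x| <= M) ->
  `|\int[leb_rV n]_x F x| <= M * (2 * b) ^+ n.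
Proof.
move=> b0 mF F0 FM.
have mc : measurable (cube c b) by exact: measurable_cube.
have M0 : 0 <= M by apply: le_trans (FM 0).
have iF := integrable_supported b0 mF F0 FM.
apply: (le_trans (le_normr_Rintegral measurableT iF)).
have -> : M * (2 * b) ^+ n = \int[leb_rV n]_(x in cube c b) M.
  by rewrite Rintegral_cst// leb_cube.
rewrite [leRHS]Rintegral_mkcond; apply: le_Rintegral => //.
- exact: integrable_norm.
- apply: (@integrable_supported _ c b M b0).
  + by apply/(measurable_restrictT _ mc).
  + by move=> x ncx; rewrite patchE memNset.
  + by move=> x; rewrite patchE; case: ifP => _; rewrite ?normr0// ger0_norm.
- move=> x _; rewrite patchE; case: ifPn => // xc.
  by rewrite F0 ?normr0// => cx; move: xc; rewrite mem_set.
Qed.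

End compact_support.

(** * Partial derivatives of compactly supported functions have zero integral *)

Section integral_pderiv.
Context {R : realType}.

Lemma FTC_supported (g : R -> R) (b : R) : 0 <= b ->
  (forall t, derivable g t 1) -> continuous (derive1 g) ->
  (forall t, b < `|t| -> g t = 0) ->
  (\int[lebesgue_measure]_t ((derive1 g) t)%:E = 0)%E.
Proof.
move=> b0 dg cg g0.
have g'0 t : b < `|t| -> derive1 g t = 0.
  move=> bt; rewrite derive1E (@near_eq_derive _ _ _ g (cst 0)) ?derive_cst//.
  have : \forall u \near t, b < `|u|.
    have : `|u| @[u --> t] --> `|t| by exact: norm_continuous.
    by move/cvgr_gt; apply.
  by apply: filterS => u /g0.
(* The margin 1 puts the endpoints where [g] is known to vanish, which is for [|t|] strictly above
   [b], and keeps the interval nondegenerate when [b = 0]. *)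
have ab : - (b + 1) < b + 1 by lra.
rewrite (_ : integral _ _ _ = \int[lebesgue_measure]_(t in `[(- (b + 1))%R, (b + 1)%R]) (derive1 g t)%:E)%E; last first.
  rewrite [RHS]integral_mkcond; apply: eq_integral => t _; rewrite patchE.
  case: ifPn => //; rewrite notin_setE/= in_itv/= -ler_norml => /negP; rewrite -ltNge => h.
  by rewrite g'0//; apply: lt_trans h; rewrite ltrDl.
rewrite (continuous_FTC2 ab (F := g)).
- by rewrite !g0 ?subee// ?normrN ger0_norm; lra.
- exact: continuous_subspaceT.
- have cgt t : {for t, continuous g}.
    by apply: differentiable_continuous; apply/derivable1_diffP.
  split => //; [by apply: cvg_at_right_filter; exact: cgt|by apply: cvg_at_left_filter; exact: cgt].
- by [].
Qed.

Lemma continuous_row_cons1 n (t : R) : continuous (fun x : 'rV[R]_n => row_cons (x, t)).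
Proof.
move=> x A /nbhs_cube[r r0 rA]; apply: (filterS _ (cube_nbhs x r0)) => y xy.
apply: rA => i; case: (unliftP ord0 i) => [j|] ->.
  by rewrite !row_consS; exact: xy.
by rewrite !row_cons0 subrr normr0 ltW.
Qed.

Lemma continuous_row_cons2 n (x : 'rV[R]_n) : continuous (fun t : R => row_cons (x, t)).
Proof.
move=> t A /nbhs_cube[r r0 rA].
have : \forall u \near t, `|t - u| < r by apply/nbhs_ballP; exists r.
apply: filterS => u tu; apply: rA => i; case: (unliftP ord0 i) => [j|] ->.
  by rewrite !row_consS subrr normr0 ltW.
by rewrite !row_cons0/= distrC ltW.
Qed.

Lemma row_cons_delta0 n (x : 'rV[R]_n) (t h : R) :
  h *: delta_mx ord0 ord0 + row_cons (x, t) = row_cons (x, h *: 1 + t).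
Proof.
apply/rowP => i; rewrite !mxE; case: (unliftP ord0 i) => [j|] ->/=; rewrite ?eqxx.
  by rewrite mulr0 add0r.
by [].
Qed.

Lemma row_cons_deltaS n (x : 'rV[R]_n) (t h : R) j :
  h *: delta_mx ord0 (lift ord0 j) + row_cons (x, t) = row_cons (h *: delta_mx ord0 j + x, t).
Proof.
apply/rowP => i; rewrite !mxE; case: (unliftP ord0 i) => [k|] ->/=.
  by rewrite !mxE (inj_eq lift_inj).
by rewrite mulr0 add0r.
Qed.

(** Difference quotients only see the increments along a line, so calculus in one variable transfers
    to slices, coordinates and products without any chain rule in several variables. *)
Lemma same_increments (V V' W : normedModType R) (f : V -> W) (g : V' -> W) a v a' v' :
  (forall h : R, f (h *: v + a) = g (h *: v' + a')) ->
  'D_v f a = 'D_v' g a' /\ (derivable f a v -> derivable g a' v').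
Proof.
move=> fg; rewrite /derivable /derive.
have e : (fun h : R => h^-1 *: ((f \o shift a) (h *: v) - f a)) =
         (fun h : R => h^-1 *: ((g \o shift a') (h *: v') - g a')).
  apply/funext => h; rewrite /= fg; congr (_ *: (_ - _)).
  by have := fg 0; rewrite !scale0r !add0r.
by rewrite e.
Qed.

Lemma derive_row_cons0 n (F : 'rV[R]_n.+1 -> R) x t :
  'D_1 (fun u => F (row_cons (x, u))) t = pderiv ord0 F (row_cons (x, t)).
Proof. by apply: (proj1 (same_increments _)) => h; rewrite row_cons_delta0. Qed.

Lemma derivable_row_cons0 n (F : 'rV[R]_n.+1 -> R) x t :
  derivable F (row_cons (x, t)) (delta_mx ord0 ord0) ->
  derivable (fun u => F (row_cons (x, u))) t 1.
Proof. by apply: (proj2 (same_increments _)) => h; rewrite row_cons_delta0. Qed.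

Lemma pderiv_row_consS n (F : 'rV[R]_n.+1 -> R) x t j :
  pderiv j (fun y => F (row_cons (y, t))) x = pderiv (lift ord0 j) F (row_cons (x, t)).
Proof. by apply: (proj1 (same_increments _)) => h; rewrite row_cons_deltaS. Qed.

Lemma derivable_row_consS n (F : 'rV[R]_n.+1 -> R) x t j :
  derivable F (row_cons (x, t)) (delta_mx ord0 (lift ord0 j)) ->
  derivable (fun y => F (row_cons (y, t))) x (delta_mx ord0 j).
Proof. by apply: (proj2 (same_increments _)) => h; rewrite row_cons_deltaS. Qed.

Lemma pderiv_supported n (i : 'I_n) (F : 'rV[R]_n -> R) c b :
  (forall x, ~ cube c b x -> F x = 0) ->
  forall x, ~ cube c b x -> pderiv i F x = 0.
Proof.
move=> F0 x ncx; rewrite /pderiv (@near_eq_derive _ _ _ F (cst 0)) ?derive_cst//.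
have : nbhs x (~` cube c b).
  by apply: open_nbhs_nbhs; split => //; apply: closed_openC; exact: closed_cube.
by apply: filterS => y /F0.
Qed.

(** Fubini is used in the order that suits [i]: for the first coordinate, the fundamental theorem of
    calculus on each line; for another one, the induction hypothesis on each slice. *)
Lemma integral_pderiv n (i : 'I_n) (F : 'rV[R]_n -> R) (b : R) : 0 <= b ->
  (forall x, derivable F x (delta_mx ord0 i)) -> continuous (pderiv i F) ->
  (forall x, ~ cube 0 b x -> F x = 0) ->
  (\int[leb_rV n]_x (pderiv i F x)%:E = 0)%E.
Proof.
move=> b0; elim: n i F => [[]//|n ih] i F dF cF F0.
have F'0 := pderiv_supported i F0.
have [M _ FM] := supported_bounded cF F'0.
have iF := integrable_supported b0 (continuous_measurable_rV cF) F'0 FM.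
case: (unliftP ord0 i) => [j|] iE; subst i.
- rewrite (integral_leb_rVS_swap iF); apply: integral0_eq => t _.
  under eq_integral do rewrite /= -pderiv_row_consS.
  apply: ih => [x||x ncx].
  + exact: derivable_row_consS.
  + rewrite (_ : pderiv j _ = fun y => pderiv (lift ord0 j) F (row_cons (y, t))); last first.
      by apply/funext => y; exact: pderiv_row_consS.
    by move=> x; apply: continuous_comp; [exact: continuous_row_cons1|exact: cF].
  + apply: F0 => h; apply: ncx => k; have := h (lift ord0 k).
    by rewrite row_consS !mxE.
- rewrite (integral_leb_rVS iF); apply: integral0_eq => x _.
  under eq_integral do rewrite /= -derive_row_cons0 -derive1E.
  apply: (FTC_supported b0) => [t||t bt].
  + exact: derivable_row_cons0.
  + rewrite (_ : derive1 _ = fun u => pderiv ord0 F (row_cons (x, u))); last first.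
      by apply/funext => u; rewrite derive1E derive_row_cons0.
    by move=> t; apply: continuous_comp; [exact: continuous_row_cons2|exact: cF].
  + apply: F0 => /(_ ord0); rewrite row_cons0 !mxE subr0/=; apply/negP.
    by rewrite -ltNge.
Qed.

End integral_pderiv.

(** * Smooth bump functions *)

Section nderiv.
Context {R : realType}.
Implicit Types (f g : R -> R) (P : {poly R}).

Fixpoint nderiv (n : nat) f : Prop :=
  match n with
  | 0 => True
  | n.+1 => (forall x, derivable f x 1) /\ nderiv n (derive1 f)
  end.

Definition smooth f := forall n, nderiv n f.

Lemma nderivW n f : nderiv n.+1 f -> nderiv n f.
Proof. by elim: n f => [//|n ih] f [df /ih]. Qed.

Lemma nderivD n f g : nderiv n f -> nderiv n g -> nderiv n (fun t => f t + g t).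
Proof.
elim: n f g => [//|n ih] f g [df nf] [dg ng]; split=> [x|].
  exact: derivableD.
rewrite (_ : derive1 _ = fun t => derive1 f t + derive1 g t); first exact: ih.
by apply/funext => t; rewrite !derive1E deriveD.
Qed.

Lemma nderivM n f g : nderiv n f -> nderiv n g -> nderiv n (fun t => f t * g t).
Proof.
elim: n f g => [//|n ih] f g [df nf] [dg ng]; split=> [x|].
  exact: derivableM.
have nf' : nderiv n f by apply: nderivW.
have ng' : nderiv n g by apply: nderivW.
rewrite (_ : derive1 _ = fun t => f t * derive1 g t + derive1 f t * g t).
  by apply: nderivD; exact: ih.
by apply/funext => t; rewrite !derive1E deriveM// [X in _ + X]mulrC.
Qed.

Lemma smoothM f g : smooth f -> smooth g -> smooth (fun t => f t * g t).
Proof. by move=> sf sg n; exact: nderivM. Qed.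

Lemma is_derive_affine (a b x : R) : is_derive x 1 (fun t => a * t + b) a.
Proof.
have -> : (fun t => a * t + b) = (a \*: @id R) + cst b.
  by apply/funext => t; rewrite !fctE.
apply: is_derive_eq; by rewrite /GRing.scale /= mulr1 addr0.
Qed.

Lemma is_derive_comp_affine f (a b x : R) : derivable f (a * x + b) 1 ->
  is_derive x 1 (fun t => f (a * t + b)) (a * derive1 f (a * x + b)).
Proof.
move=> df; have ha := is_derive_affine a b x.
have hf : is_derive (a * x + b) 1 f (derive1 f (a * x + b)).
  by rewrite derive1E; exact: DeriveDef.
have := @is_derive1_comp _ f (fun t => a * t + b) x _ _ hf ha; rewrite /comp => h.
by apply: (is_derive_eq h); rewrite mulrC.
Qed.

Lemma nderiv_comp_affine n f (k a b : R) : nderiv n f ->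
  nderiv n (fun t => k * f (a * t + b)).
Proof.
elim: n f k => [//|n ih] f k [df nf].
have h (x : R) : is_derive x (1 : R) (fun t => k * f (a * t + b)) (k * (a * derive1 f (a * x + b))).
  have := is_derive_comp_affine (df (a * x + b)) => h.
  exact: (is_deriveZ k h).
split=> [x|]; first by case: (h x).
rewrite (_ : derive1 _ = fun t => (k * a) * derive1 f (a * t + b)); first exact: ih.
by apply/funext => t; rewrite derive1E (@derive_val _ _ _ _ _ _ _ (h t)) mulrA.
Qed.

Lemma smooth_comp_affine f (a b : R) : smooth f -> smooth (fun t => f (a * t + b)).
Proof.
move=> sf n; have := nderiv_comp_affine 1 a b (sf n).
by congr nderiv; apply/funext => t; rewrite mul1r.
Qed.

Lemma smooth_derive1n f k : smooth f -> smooth (derive1n k f).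
Proof. by elim: k => [//|k ih] sf n; exact: (proj2 (ih sf n.+1)). Qed.

Lemma smooth_derivable f x : smooth f -> derivable f x 1.
Proof. by move=> /(_ 1%N)[]. Qed.

Lemma smooth_continuous f : smooth f -> continuous f.
Proof.
move=> sf x; apply: differentiable_continuous; apply/derivable1_diffP.
exact: smooth_derivable.
Qed.

Lemma derive1n_comp_affine f k (a b t : R) : smooth f ->
  derive1n k (fun t => f (a * t + b)) t = a ^+ k * derive1n k f (a * t + b).
Proof.
move=> sf; elim: k t => [|k ih] t; first by rewrite expr0 mul1r.
rewrite !derive1nS (_ : derive1n k _ = fun t => a ^+ k * derive1n k f (a * t + b)); last first.
  by apply/funext => u; exact: ih.
have sk := smooth_derive1n k sf.
have h := is_derive_comp_affine (@smooth_derivable _ (a * t + b) sk).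
rewrite derive1E (@derive_val _ _ _ _ _ _ _ (is_deriveZ (a ^+ k) h)).
by rewrite /GRing.scale/= mulrA exprSr.
Qed.

(* The class of these functions is stable under derivation, which is how the
   smoothness of [exp (- 1 / t)] at the origin is established. *)
Definition flat P (s : R) : R := if 0 < s then P.[s^-1] * expR (- s^-1) else 0.

Lemma horner_expR_bound P : exists2 C, 0 <= C & forall u, 0 <= u -> `|P.[u]| <= C * expR u.
Proof.
have mono k u : 0 <= u -> u ^+ k <= k`!%:R * expR u.
  move=> u0; case: k => [|k].
    by rewrite expr0 fact0 mul1r; apply: le_trans (expR_ge1Dx u); rewrite lerDl.
  have := expR_ge1Dxn k u0; rewrite -ler_pdivrMl ?ltr0n ?fact_gt0// => h.
  by rewrite mulrC; apply: le_trans h; rewrite lerDr.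
exists (\sum_(i < size P) `|P`_i| * i`!%:R).
  by apply: sumr_ge0 => i _; rewrite mulr_ge0.
move=> u u0; rewrite horner_coef; apply: le_trans (ler_norm_sum _ _ _) _.
rewrite mulr_suml; apply: ler_sum => i _.
rewrite normrM -mulrA; apply: ler_wpM2l => //.
by rewrite ger0_norm ?exprn_ge0// mono.
Qed.

(** The exponential dominates every polynomial in [1 / s]; the bound is applied to ['X * P] in order
    to gain the factor [|s|]. *)
Lemma flat_le P : exists2 C, 0 <= C & forall s, `|flat P s| <= C * `|s|.
Proof.
have [C C0 hC] := horner_expR_bound ('X * P); exists C => // s.
rewrite /flat; case: ifPn => [s0|_]; last by rewrite normr0 mulr_ge0.
have si0 : 0 < s^-1 by rewrite invr_gt0.
have := hC _ (ltW si0); rewrite !hornerE normrM (gtr0_norm si0) => h.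
rewrite normrM (gtr0_norm s0) expRN (gtr0_norm (_ : 0 < (expR s^-1)^-1)) ?invr_gt0 ?expR_gt0//.
by rewrite ler_pdivrMr ?expR_gt0// -mulrA (mulrC s) mulrA -ler_pdivrMr// mulrC.
Qed.

Lemma is_derive_flat_pos P (s : R) : 0 < s ->
  is_derive s (1 : R) (flat P) (flat ('X^2 * (P - P^`())) s).
Proof.
move=> s0; rewrite {2}/flat s0.
have sn0 : (@id R) s != 0 by rewrite gt_eqF.
have hV := is_deriveV sn0 (is_derive_id s (1 : R)).
have h1 := @is_derive1_comp _ (horner P) _ s _ _ (is_derive_poly P s^-1) hV.
have h2 := @is_derive1_comp _ expR _ s _ _ (is_derive_expR (- s^-1)) (is_deriveN hV).
have := is_deriveM h1 h2 => h3.
apply: (@near_eq_is_derive _ _ _ ((horner P \o (fun y : R => (id y)^-1)) *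
         (expR \o (- (fun y : R => (id y)^-1))))).
  near=> t; rewrite /flat ifT//.
  by near: t; exact: lt_nbhsr.
apply: (is_derive_eq h3).
have s1 : s != 0 by [].
by rewrite /= !fctE /comp /GRing.scale/= hornerM hornerXn hornerD hornerN; field.
Unshelve. all: by end_near. Qed.

(** The difference quotient at 0 is itself flat, with polynomial ['X * P], and [flat_le] makes it
    tend to 0. *)
Lemma is_derive_flat0 P : is_derive (0 : R) (1 : R) (flat P) 0.
Proof.
have [C C0 hC] := flat_le ('X * P).
have q : (fun h : R => h^-1 *: (flat P (h *: 1 + 0) - flat P 0)) @ 0^' --> (0 : R).
  apply/cvgrPdist_le => e e0; near=> h.
  have h0 : h != 0 by near: h; exact: nbhs_dnbhs_neq.
  rewrite sub0r normrN.
  have -> : h^-1 *: (flat P (h *: 1 + 0) - flat P 0) = flat ('X * P) h.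
    rewrite /flat ltxx subr0 addr0 /GRing.scale /= mulr1.
    by case: ifP => _; rewrite ?mulr0// hornerM hornerX mulrA.
  apply: (le_trans (hC h)).
  have : `|h| <= e / (C + 1).
    by near: h; apply: dnbhs0_le; rewrite divr_gt0// ltr_wpDl.
  rewrite ler_pdivlMr ?ltr_wpDl// => he; apply: le_trans he.
  by rewrite mulrC ler_wpM2l// lerDl.
apply: DeriveDef; first by apply/cvg_ex; exists 0.
exact: cvg_lim q.
Unshelve. all: by end_near. Qed.

Lemma is_derive_flat P (s : R) :
  is_derive s (1 : R) (flat P) (flat ('X^2 * (P - P^`())) s).
Proof.
have [s0|s0|->] := ltrgtP s 0.
- rewrite {2}/flat ltNge (ltW s0)/=.
  apply: (@near_eq_is_derive _ _ _ (cst 0)).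
  near=> t; rewrite /flat ifF//; apply/negbTE; rewrite -leNgt ltW//.
  by near: t; exact: lt_nbhsl.
- exact: is_derive_flat_pos.
- by rewrite {2}/flat ltxx; exact: is_derive_flat0.
Unshelve. all: by end_near. Qed.

Lemma smooth_flat P : smooth (flat P).
Proof.
move=> n; elim: n P => [//|n ih] P; split=> [x|].
  by case: (is_derive_flat P x).
rewrite (_ : derive1 _ = flat ('X^2 * (P - P^`()))); first exact: ih.
by apply/funext => t; rewrite derive1E (@derive_val _ _ _ _ _ _ _ (is_derive_flat P t)).
Qed.

End nderiv.

Section prodfun.
Context {R : realType} {n : nat}.
Implicit Types (f : 'I_n -> R -> R) (k : 'I_n -> nat) (x : 'rV[R]_n).

(** The exponents [k] record the order of derivation in each variable. A partial derivative only
    increments one of them, so the class is stable under [pderiv], which yields [Ck] of every order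
    by induction. *)
Definition prodfun f k x : R := \prod_(i < n) derive1n (k i) (f i) (x ord0 i).

Lemma delta_shiftE (h : R) j x i :
  (h *: delta_mx ord0 j + x) ord0 i = if i == j then h + x ord0 i else x ord0 i.
Proof. by rewrite !mxE eqxx/=; case: eqP => _; rewrite ?mulr1// mulr0 add0r. Qed.

Lemma is_derive_prodfun f k j x : (forall i, smooth (f i)) ->
  is_derive x (delta_mx ord0 j) (prodfun f k)
    (prodfun f (fun i => ((i == j) + k i)%N) x).
Proof.
move=> sf.
pose K := \prod_(i < n | i != j) derive1n (k i) (f i) (x ord0 i).
pose g (t : R) := K * derive1n (k j) (f j) t.
have gE h : g (h *: 1 + x ord0 j) = prodfun f k (h *: delta_mx ord0 j + x).
  rewrite /prodfun (bigD1 j)//= delta_shiftE eqxx /g mulrC /GRing.scale/= mulr1.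
  congr (_ * _); apply: eq_bigr => i ij.
  by rewrite delta_shiftE (negbTE ij).
have dj : derivable (derive1n (k j) (f j)) (x ord0 j) 1.
  by apply: smooth_derivable; exact: smooth_derive1n.
have hg : is_derive (x ord0 j) (1 : R) g (K * derive1n (k j).+1 (f j) (x ord0 j)).
  have h : is_derive (x ord0 j) (1 : R) (derive1n (k j) (f j)) (derive1n (k j).+1 (f j) (x ord0 j)).
    by rewrite derive1nS derive1E; exact: DeriveDef.
  exact: (is_deriveZ K h).
have [e1 e2] := same_increments gE.
apply: DeriveDef; first by apply: e2; case: hg.
rewrite -e1 (@derive_val _ _ _ _ _ _ _ hg) /prodfun (bigD1 j)//= eqxx mulrC.
by congr (_ * _); apply: eq_bigr => i /negbTE ->.
Qed.

Lemma continuous_prodfun f k : (forall i, smooth (f i)) -> continuous (prodfun f k).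
Proof.
move=> sf; apply: continuous_big; first exact: mul_continuous.
move=> i _ x; apply: (@continuous_comp _ _ _ (fun x : 'rV[R]_n => x ord0 i)).
  exact: coord_continuous.
by apply: smooth_continuous; exact: smooth_derive1n.
Qed.

Lemma pderiv_prodfun f k j : (forall i, smooth (f i)) ->
  pderiv j (prodfun f k) = prodfun f (fun i => ((i == j) + k i)%N).
Proof.
move=> sf; apply/funext => x.
exact: (@derive_val _ _ _ _ _ _ _ (is_derive_prodfun k j x sf)).
Qed.

Lemma Ck_prodfun m f k : (forall i, smooth (f i)) -> Ck m (prodfun f k).
Proof.
move=> sf; elim: m k => [|m ih] k /=; first exact: continuous_prodfun.
split; first exact: continuous_prodfun.
move=> j; split => [x|]; first by case: (is_derive_prodfun k j x sf).
by rewrite pderiv_prodfun.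
Qed.

End prodfun.

Section Ck_theory.
Context {R : realType} {n : nat}.
Implicit Types (f g : 'rV[R]_n -> R).

Lemma Ck_continuous k f : Ck k f -> continuous f.
Proof. by case: k => [//|k] []. Qed.

Lemma Ck_derivable k f i x : Ck k.+1 f -> derivable f x (delta_mx ord0 i).
Proof. by case=> _ /(_ i)[]. Qed.

Lemma Ck_pderiv k f i : Ck k.+1 f -> Ck k (pderiv i f).
Proof. by case=> _ /(_ i)[]. Qed.

Lemma CkW k f : Ck k.+1 f -> Ck k f.
Proof.
elim: k f => [|k ih] f; first by case.
move=> [cf hf]; split => // i; split; first by case: (hf i).
by apply: ih; case: (hf i).
Qed.

Lemma pderivD i f g x : derivable f x (delta_mx ord0 i) ->
  derivable g x (delta_mx ord0 i) ->
  pderiv i (fun y => f y + g y) x = pderiv i f x + pderiv i g x.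
Proof. by move=> df dg; rewrite /pderiv deriveD. Qed.

Lemma pderivM i f g x : derivable f x (delta_mx ord0 i) ->
  derivable g x (delta_mx ord0 i) ->
  pderiv i (fun y => f y * g y) x = f x * pderiv i g x + g x * pderiv i f x.
Proof. by move=> df dg; rewrite /pderiv deriveM. Qed.

Lemma CkD k f g : Ck k f -> Ck k g -> Ck k (fun x => f x + g x).
Proof.
elim: k f g => [|k ih] f g; first by move=> /= cf cg x; exact: (cvgD (cf x) (cg x)).
move=> [cf hf] [cg hg]; split; first by move=> x; exact: (cvgD (cf x) (cg x)).
move=> i; have [df kf] := hf i; have [dg kg] := hg i; split => [x|].
  exact: derivableD.
rewrite (_ : pderiv i _ = fun x => pderiv i f x + pderiv i g x); first exact: ih.
by apply/funext => x; exact: pderivD.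
Qed.

Lemma Ck0 k : Ck k (fun _ : 'rV[R]_n => 0 : R).
Proof.
have d0 i : pderiv i (fun _ : 'rV[R]_n => 0 : R) = fun=> 0.
  by apply/funext => x; exact: derive_cst.
elim: k => [|k ih]; first by move=> /= x; exact: (@cst_continuous _ _ (0 : R)).
split; first by move=> x; exact: (@cst_continuous _ _ (0 : R)).
by move=> i; split; [move=> x; exact: derivable_cst|rewrite d0].
Qed.

Lemma test_function_supp (Omega K : set 'rV[R]_n) f : (forall k, Ck k f) ->
  compact K -> K `<=` Omega -> (forall x, ~ K x -> f x = 0) -> test_function Omega f.
Proof.
move=> Cf cK KO f0.
have clK : closed K by apply: compact_closed => //; exact: norm_hausdorff.
have sK : closure [set x | f x != 0] `<=` K.
  rewrite closureE => x; apply; split => // y /= fy.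
  by apply: contrapT => /f0 fy0; rewrite fy0 eqxx in fy.
split => //; last exact: subset_trans KO.
by apply: subclosed_compact cK sK; exact: closed_closure.
Qed.

Lemma test_function_eq0 Omega f x : test_function Omega f -> ~ Omega x -> f x = 0.
Proof.
move=> [_ _ sO] nx; apply/eqP/negPn/negP => fx; apply: nx; apply: sO.
by apply: subset_closure.
Qed.

Lemma test_function0 Omega : test_function Omega (fun _ : 'rV[R]_n => 0 : R).
Proof.
apply: (@test_function_supp _ set0) => //; first by move=> k; exact: Ck0.
exact: compact0.
Qed.

Lemma test_function_pderiv Omega f i : test_function Omega f ->
  test_function Omega (pderiv i f).
Proof.
move=> [Cf Kf sf]; apply: (@test_function_supp _ (closure [set x | f x != 0])) => //.
  by move=> k; apply: Ck_pderiv; exact: Cf.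
move=> x nx; rewrite /pderiv (@near_eq_derive _ _ _ f (cst 0)) ?derive_cst//.
have : nbhs x (~` closure [set x | f x != 0]).
  by apply: open_nbhs_nbhs; split => //; apply: closed_openC; exact: closed_closure.
apply: filterS => y ny.
by apply/eqP/negPn/negP => fx; apply: ny; exact: subset_closure.
Qed.

Lemma test_function_bounded Omega f : test_function Omega f ->
  exists2 M, 0 <= M & forall x, `|f x| <= M.
Proof.
move=> [Cf Kf sf].
have : compact (f @` (closure [set x | f x != 0])).
  by apply: continuous_compact Kf; apply: continuous_subspaceT; exact: Ck_continuous (Cf 0%N).
move=> /compact_bounded[M [_ hM]]; exists (`|M| + 1); first by rewrite addr_ge0.
move=> x; have [->|fx] := eqVneq (f x) 0; first by rewrite normr0 addr_ge0.
apply: (hM (`|M| + 1)); first by rewrite ltr_pwDr// ler_norm.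
by exists x => //; exact: subset_closure.
Qed.

End Ck_theory.

Section bump1.
Context {R : realType}.

(** For [al > 0] this is smooth and positive exactly on []a, b[]. Two uses: [eta] is the fixed
    profile of the bumps, and for [al] tending to infinity the function tends to the indicator of
    []a, b[]. *)
Definition bump1 (al a b t : R) : R := flat 1 (al * (t - a)) * flat 1 (al * (b - t)).

Lemma flat1_ge0 (s : R) : 0 <= flat 1 s.
Proof. by rewrite /flat; case: ifP => // _; rewrite hornerC mul1r expR_ge0. Qed.

Lemma flat1_le1 (s : R) : flat 1 s <= 1.
Proof.
rewrite /flat; case: ifP => // s0; rewrite hornerC mul1r expRN invf_le1 ?expR_gt0//.
by rewrite -expR0 ler_expR invr_ge0 ltW.
Qed.

Lemma smooth_bump1 al a b : smooth (bump1 al a b).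
Proof.
have -> : bump1 al a b = fun t =>
    flat 1 (al * t + - (al * a)) * flat 1 ((- al) * t + al * b).
  apply/funext => t; rewrite /bump1; congr (flat 1 _ * flat 1 _); ring.
by apply: smoothM; apply: smooth_comp_affine; exact: smooth_flat.
Qed.

Lemma bump1_ge0 al a b t : 0 <= bump1 al a b t.
Proof. by rewrite mulr_ge0 ?flat1_ge0. Qed.

Lemma bump1_le1 al a b t : bump1 al a b t <= 1.
Proof. by rewrite mulr_ile1 ?flat1_ge0 ?flat1_le1. Qed.

Lemma bump1_eq0 al a b t : 0 <= al -> (t <= a) || (b <= t) -> bump1 al a b t = 0.
Proof.
move=> al0 /orP[ta|bt]; rewrite /bump1 /flat.
  by rewrite ltNge mulr_ge0_le0 ?subr_le0//= mul0r.
by rewrite [X in _ * (if X then _ else _)]ltNge mulr_ge0_le0 ?subr_le0//= mulr0.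
Qed.

Definition eta : R -> R := bump1 1 (- 1) 1.

Lemma smooth_eta : smooth eta. Proof. exact: smooth_bump1. Qed.

Lemma eta_even t : eta (- t) = eta t.
Proof. by rewrite /eta /bump1 mulrC; congr (flat 1 _ * flat 1 _); ring. Qed.

Lemma derive1n_eta_parity k t : derive1n k eta (- t) = (- 1) ^+ k * derive1n k eta t.
Proof.
have := @derive1n_comp_affine R eta k (- 1) 0 t smooth_eta.
have -> : (fun t => eta (- 1 * t + 0)) = eta.
  by apply/funext => u; rewrite mulN1r addr0 eta_even.
by rewrite mulN1r addr0 => ->; rewrite mulrA -exprMn mulrNN mulr1 expr1n mul1r.
Qed.

Lemma eta_eq0 t : 1 <= `|t| -> eta t = 0.
Proof.
rewrite ler_normr => /orP[h|h]; apply: bump1_eq0 => //; first by rewrite h orbT.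
by rewrite lerNr h.
Qed.

Lemma derive1n_eta_eq0 k t : 1 < `|t| -> derive1n k eta t = 0.
Proof.
elim: k t => [|k ih] t t1; first by rewrite /derive1n/= eta_eq0// ltW.
rewrite derive1nS derive1E (@near_eq_derive _ _ _ _ (cst 0)) ?derive_cst//.
have : `|u| @[u --> t] --> `|t| by exact: norm_continuous.
by move/cvgr_gt => /(_ _ t1); apply: filterS => u /ih.
Qed.

Lemma derive1n_eta_bounded k : exists2 C, 0 <= C & forall t, `|derive1n k eta t| <= C.
Proof.
have : compact (derive1n k eta @` `[- 1, 1]%classic).
  apply: continuous_compact; last exact: segment_compact.
  apply: continuous_subspaceT; apply: smooth_continuous.
  by apply: smooth_derive1n; exact: smooth_eta.
move=> /compact_bounded[M [_ hM]]; exists (`|M| + 1); first by rewrite addr_ge0.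
move=> t; have [t1|t1] := leP `|t| 1; last by rewrite derive1n_eta_eq0// normr0 addr_ge0.
apply: (hM (`|M| + 1)); first by rewrite ltr_pwDr// ler_norm.
by exists t => //=; rewrite in_itv/= -ler_norml.
Qed.

(** Both arguments [1 + t] and [1 - t] are at least [1 / 2], where [exp (- 1 / s)] is at least
    [exp (- 2)]. This number enters all the constants below, as a lower bound for the mass of
    bumps. *)
Lemma eta_ge t : `|t| <= 2^-1 -> expR (- 2) ^+ 2 <= eta t.
Proof.
have h s : 2^-1 <= s -> expR (- 2) <= flat 1 (s : R).
  move=> hs; have s0 : 0 < s by apply: lt_le_trans hs; rewrite invr_gt0.
  rewrite /flat s0 hornerC mul1r ler_expR lerN2 -[leRHS]invrK lef_pV2 ?posrE ?invr_gt0//.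
rewrite ler_norml => /andP[t1 t2]; rewrite expr2 /eta /bump1.
by apply: ler_pM; rewrite ?expR_ge0//; apply: h; rewrite mul1r; lra.
Qed.

Lemma eta_bound : exists2 C : R, 1 <= C & forall k t, (k <= 2)%N -> `|derive1n k eta t| <= C.
Proof.
have [C0 p0 h0] := derive1n_eta_bounded 0.
have [C1 p1 h1] := derive1n_eta_bounded 1.
have [C2 p2 h2] := derive1n_eta_bounded 2.
exists (1 + C0 + C1 + C2); first lra.
move=> [|[|[|//]]] t _.
- by apply: le_trans (h0 t) _; lra.
- by apply: le_trans (h1 t) _; lra.
- by apply: le_trans (h2 t) _; lra.
Qed.

End bump1.

Section cube_bump.
Context {R : realType} {n : nat}.
Implicit Types (c x v : 'rV[R]_n) (r : R).

Let factor c r (i : 'I_n) (t : R) : R := eta (r^-1 * t + - (r^-1 * c ord0 i)).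

Let smooth_factor c r i : smooth (factor c r i).
Proof. by apply: smooth_comp_affine; exact: smooth_eta. Qed.

(** Mixed derivatives of the product bump of centre [c] and radius [r], gathered in one family so
    that support, size and parity are proved for all orders at once. *)
Definition dbump c r (k : 'I_n -> nat) : 'rV[R]_n -> R := prodfun (factor c r) k.

Definition cbump c r := dbump c r (fun=> 0%N).

Lemma dbumpE c r k x : dbump c r k x =
  \prod_(i < n) (r^-1 ^+ k i * derive1n (k i) eta (r^-1 * (x ord0 i - c ord0 i))).
Proof.
apply: eq_bigr => i _; rewrite /factor derive1n_comp_affine; last exact: smooth_eta.
by rewrite mulrBr.
Qed.

Lemma Ck_dbump m c r k : Ck m (dbump c r k).
Proof. by apply: Ck_prodfun; exact: smooth_factor. Qed.

Lemma pderiv_dbump c r k j :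
  pderiv j (dbump c r k) = dbump c r (fun i => ((i == j) + k i)%N).
Proof. by apply: pderiv_prodfun; exact: smooth_factor. Qed.

Lemma dbump_eq0 c r k x : 0 < r -> ~ cube c r x -> dbump c r k x = 0.
Proof.
move=> r0 /existsNP[i /negP]; rewrite -ltNge => h.
rewrite dbumpE (bigD1 i)//= derive1n_eta_eq0 ?mulr0 ?mul0r//.
by rewrite normrM gtr0_norm ?invr_gt0// mulrC ltr_pdivlMr ?mul1r.
Qed.

Lemma cbump_ge0 c r x : 0 <= cbump c r x.
Proof. by rewrite /cbump dbumpE; apply: prodr_ge0 => i _; rewrite expr0 mul1r bump1_ge0. Qed.

Lemma cbump_ge c r x : 0 < r -> cube c (r / 2) x -> (expR (- 2) ^+ 2) ^+ n <= cbump c r x.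
Proof.
move=> r0 cx; rewrite /cbump dbumpE.
rewrite -[in leLHS](card_ord n) -prodr_const; apply: ler_prod => i _.
rewrite exprn_ge0 ?expR_ge0//= expr0 mul1r; apply: eta_ge.
by rewrite normrM gtr0_norm ?invr_gt0// mulrC ler_pdivrMr// mulrC cx.
Qed.

Lemma dbump_le c r k C x : 0 < r -> 0 <= C ->
  (forall i t, `|derive1n (k i) eta t| <= C) ->
  `|dbump c r k x| <= r^-1 ^+ (\sum_i k i)%N * C ^+ n.
Proof.
move=> r0 C0 hC; rewrite dbumpE big_split/= normrM; apply: ler_pM => //.
  by rewrite prodrXr ger0_norm// exprn_ge0// invr_ge0 ltW.
rewrite normr_prod -[in leRHS](card_ord n) -prodr_const; apply: ler_prod => i _.
by rewrite normr_ge0 hC.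
Qed.

(** As [eta] is even, the reflection about [c] exchanges the centres [c + v] and [c - v], each
    derivative contributing a sign. *)
Lemma dbump_reflect c r k v x :
  dbump (c + v) r k (c + c - x) = (- 1) ^+ (\sum_i k i)%N * dbump (c - v) r k x.
Proof.
rewrite !dbumpE -prodrXr -big_split/=; apply: eq_bigr => i _.
rewrite (_ : r^-1 * ((c + c - x) ord0 i - _) = - (r^-1 * (x ord0 i - (c - v) ord0 i))); last first.
  by rewrite !mxE; ring.
by rewrite derive1n_eta_parity mulrCA.
Qed.

End cube_bump.

(** * Quadratic functions tested against bumps *)

Section dotp_theory.
Context {R : realType} {n : nat}.
Implicit Types x y z : 'rV[R]_n.

Lemma dotpC x y : dotp x y = dotp y x.
Proof. by apply: eq_bigr => i _; rewrite mulrC. Qed.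

Lemma dotpDr x y z : dotp x (y + z) = dotp x y + dotp x z.
Proof. by rewrite /dotp -big_split/=; apply: eq_bigr => i _; rewrite mxE mulrDr. Qed.

Lemma dotpZr x (a : R) y : dotp x (a *: y) = a * dotp x y.
Proof. by rewrite /dotp mulr_sumr; apply: eq_bigr => i _; rewrite mxE mulrCA. Qed.

Lemma dotpNr x y : dotp x (- y) = - dotp x y.
Proof. by rewrite -scaleN1r dotpZr mulN1r. Qed.

Lemma dotpBr x y z : dotp x (y - z) = dotp x y - dotp x z.
Proof. by rewrite dotpDr dotpNr. Qed.

Lemma dotpDl x y z : dotp (x + y) z = dotp x z + dotp y z.
Proof. by rewrite !(dotpC _ z) dotpDr. Qed.

Lemma dotpZl x (a : R) y : dotp (a *: x) y = a * dotp x y.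
Proof. by rewrite !(dotpC _ y) dotpZr. Qed.

Lemma dotpNl x y : dotp (- x) y = - dotp x y.
Proof. by rewrite !(dotpC _ y) dotpNr. Qed.

Lemma dotp_delta x i : dotp x (delta_mx ord0 i) = x ord0 i.
Proof.
rewrite /dotp (bigD1 i)//= mxE !eqxx mulr1 big1 ?addr0// => j ji.
by rewrite mxE eqxx (negbTE ji) mulr0.
Qed.

Lemma dotp_ge0 x : 0 <= dotp x x.
Proof. by apply: sumr_ge0 => i _; rewrite -expr2 sqr_ge0. Qed.

Lemma dotp_eq0 x : (dotp x x == 0) = (x == 0).
Proof.
rewrite psumr_eq0; last by move=> i _; rewrite -expr2 sqr_ge0.
apply/idP/eqP => [/allP h|->].
  apply/rowP => i; have := h i (mem_index_enum _).
  by rewrite -expr2 sqrf_eq0 mxE => /eqP.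
by apply/allP => i _; apply/implyP => _; rewrite !mxE mulr0.
Qed.

Lemma enorm_ge0 x : 0 <= enorm x.
Proof. exact: sqrtr_ge0. Qed.

Lemma sqr_enorm x : enorm x ^+ 2 = dotp x x.
Proof. by rewrite sqr_sqrtr// dotp_ge0. Qed.

Lemma enorm_eq0 x : (enorm x == 0) = (x == 0).
Proof. by rewrite -dotp_eq0 -sqr_enorm sqrf_eq0. Qed.

Lemma enormZ (a : R) x : enorm (a *: x) = `|a| * enorm x.
Proof.
by rewrite /enorm dotpZl dotpZr mulrA -expr2 sqrtrM ?sqr_ge0// sqrtr_sqr.
Qed.

Lemma enormN x : enorm (- x) = enorm x.
Proof. by rewrite -scaleN1r enormZ normrN normr1 mul1r. Qed.

Lemma coord_le_enorm x i : `|x ord0 i| <= enorm x.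
Proof.
rewrite -(@ler_pXn2r _ 2)// ?nnegrE ?enorm_ge0//.
rewrite sqr_enorm real_normK ?num_real// expr2 /dotp (bigD1 i)//= lerDl.
by apply: sumr_ge0 => j _; rewrite -expr2 sqr_ge0.
Qed.

Lemma enorm_le_sum x : enorm x <= \sum_i `|x ord0 i|.
Proof.
have s0 (P : pred 'I_n) : 0 <= \sum_(i | P i) `|x ord0 i| by exact: sumr_ge0.
rewrite -(@ler_pXn2r _ 2)// ?nnegrE ?enorm_ge0// sqr_enorm expr2 mulr_suml.
apply: ler_sum => i _; rewrite (bigD1 i)//= mulrDr.
have -> : x ord0 i * x ord0 i = `|x ord0 i| * `|x ord0 i|.
  by rewrite -!expr2 real_normK ?num_real.
by rewrite lerDl mulr_ge0.
Qed.

Lemma norm_dotp_cube x y (r : R) : 0 <= r -> enorm x <= 1 ->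
  (forall i, `|y ord0 i| <= r) -> `|dotp x y| <= n%:R * r.
Proof.
move=> r0 x1 yr; apply: le_trans (ler_norm_sum _ _ _) _.
have -> : n%:R * r = \sum_(i < n) r by rewrite sumr_const card_ord mulr_natl.
apply: ler_sum => i _; rewrite normrM -[leRHS]mul1r; apply: ler_pM => //.
exact: le_trans (coord_le_enorm x i) x1.
Qed.

End dotp_theory.

Section polynomials.
Context {R : realType} {n : nat}.
Implicit Types (f g : 'rV[R]_n -> R) (x : 'rV[R]_n).

Lemma CkM k f g : Ck k f -> Ck k g -> Ck k (fun x => f x * g x).
Proof.
elim: k f g => [|k ih] f g; first by move=> /= cf cg x; exact: (cvgM (cf x) (cg x)).
move=> Cf Cg; have [cf hf] := Cf; have [cg hg] := Cg.
split; first by move=> x; exact: (cvgM (cf x) (cg x)).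
move=> i; have [df kf] := hf i; have [dg kg] := hg i; split => [x|].
  exact: derivableM.
rewrite (_ : pderiv i _ = fun x => f x * pderiv i g x + g x * pderiv i f x).
  by apply: CkD; apply: ih => //; exact: CkW.
by apply/funext => x; exact: pderivM.
Qed.

Lemma pderiv_cst i (a : R) x : pderiv i (fun=> a) x = 0.
Proof. exact: derive_cst. Qed.

Lemma Ck_cst k (a : R) : Ck k (fun _ : 'rV[R]_n => a).
Proof.
case: k => [|k]; first exact: (@cst_continuous _ _ a).
split; first exact: (@cst_continuous _ _ a).
move=> i; split; first by move=> x; exact: derivable_cst.
rewrite (_ : pderiv i _ = fun=> 0); first exact: Ck0.
by apply/funext => x; rewrite pderiv_cst.
Qed.

Lemma is_derive_coord i j x :
  is_derive x (delta_mx ord0 j) (fun y : 'rV[R]_n => y ord0 i) (i == j)%:R.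
Proof.
pose g0 (t : R) : R := (i == j)%:R * t + x ord0 i.
pose f0 (y : 'rV[R]_n) : R := y ord0 i.
have e (h : R) : g0 (h *: 1 + 0) = f0 (h *: delta_mx ord0 j + x).
  rewrite /f0 /g0 delta_shiftE addr0 /GRing.scale/= mulr1.
  by case: eqP => _; rewrite ?mul1r// mul0r add0r.
have h : is_derive (0 : R) (1 : R) g0 (i == j)%:R := is_derive_affine (i == j)%:R (x ord0 i) 0.
have [e1 e2] := same_increments e.
by apply: DeriveDef; [apply: e2; case: h|rewrite -e1 (@derive_val _ _ _ _ _ _ _ h)].
Qed.

Lemma pderiv_coord i j x : pderiv j (fun y : 'rV[R]_n => y ord0 i) x = (i == j)%:R.
Proof. exact: (@derive_val _ _ _ _ _ _ _ (is_derive_coord i j x)). Qed.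

Lemma Ck_coord k i : Ck k (fun y : 'rV[R]_n => y ord0 i).
Proof.
case: k => [|k]; first by move=> /= x; exact: coord_continuous.
split; first by move=> x; exact: coord_continuous.
move=> j; split; first by move=> x; case: (is_derive_coord i j x).
rewrite (_ : pderiv j _ = fun=> (i == j)%:R); first exact: Ck_cst.
by apply/funext => x; rewrite pderiv_coord.
Qed.

Lemma Ck_sum k (I : Type) (s : seq I) (F : I -> 'rV[R]_n -> R) :
  (forall i, Ck k (F i)) -> Ck k (fun x => \sum_(i <- s) F i x).
Proof.
move=> CF; elim: s => [|i s ih].
  by under eq_fun do rewrite big_nil; exact: Ck0.
by under eq_fun do rewrite big_cons; exact: CkD.
Qed.

Lemma pderiv_sum i (I : Type) (s : seq I) (F : I -> 'rV[R]_n -> R) x :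
  (forall i, Ck 1 (F i)) ->
  pderiv i (fun x => \sum_(i <- s) F i x) x = \sum_(j <- s) pderiv i (F j) x.
Proof.
move=> CF; elim: s => [|j s ih].
  by under eq_fun do rewrite big_nil; rewrite big_nil pderiv_cst.
under eq_fun do rewrite big_cons; rewrite pderivD; last 2 first.
- by apply: Ck_derivable; exact: CF.
- by apply: (@Ck_derivable _ _ 0); exact: Ck_sum.
by rewrite ih big_cons.
Qed.

Definition affine g := exists a b, forall x, g x = a + dotp b x.

Definition quadratic g := exists a b (A : 'I_n -> 'I_n -> R), forall x,
  g x = a + dotp b x + \sum_i \sum_j A i j * (x ord0 i * x ord0 j).

Lemma Ck_dotp k (b : 'rV[R]_n) : Ck k (dotp b).
Proof. by apply: Ck_sum => i; apply: CkM; [exact: Ck_cst|exact: Ck_coord]. Qed.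

Lemma pderiv_dotp i (b : 'rV[R]_n) x : pderiv i (dotp b) x = b ord0 i.
Proof.
rewrite /dotp pderiv_sum; last by move=> j; apply: CkM; [exact: Ck_cst|exact: Ck_coord].
rewrite -[RHS]dotp_delta /dotp; apply: eq_bigr => j _.
rewrite pderivM; [|exact: derivable_cst|by case: (is_derive_coord j i x)].
by rewrite pderiv_cst mulr0 addr0 pderiv_coord mxE eqxx.
Qed.

Lemma Ck_affine k g : affine g -> Ck k g.
Proof.
move=> [a [b gE]]; rewrite (_ : g = fun x => a + dotp b x); last exact/funext.
by apply: CkD; [exact: Ck_cst|exact: Ck_dotp].
Qed.

Lemma pderiv_affine a b g i x : (forall y, g y = a + dotp b y) -> pderiv i g x = b ord0 i.
Proof.
move=> gE; rewrite (_ : g = fun x => a + dotp b x); last exact/funext.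
rewrite pderivD; last 2 first.
- exact: derivable_cst.
- by apply: (@Ck_derivable _ _ 0); exact: Ck_dotp.
by rewrite pderiv_cst pderiv_dotp add0r.
Qed.

Let Ck_monom k (a : R) i j : Ck k (fun x : 'rV[R]_n => a * (x ord0 i * x ord0 j)).
Proof. by apply: CkM; [exact: Ck_cst|apply: CkM; exact: Ck_coord]. Qed.

Lemma Ck_quadratic k g : quadratic g -> Ck k g.
Proof.
move=> [a [b [A gE]]].
rewrite (_ : g = fun x => (a + dotp b x) + \sum_i \sum_j A i j * (x ord0 i * x ord0 j)); last exact/funext.
apply: CkD; first by apply: CkD; [exact: Ck_cst|exact: Ck_dotp].
by apply: Ck_sum => i; apply: Ck_sum => j; exact: Ck_monom.
Qed.

Lemma pderiv_quadratic a b A g l x :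
  (forall y, g y = a + dotp b y + \sum_i \sum_j A i j * (y ord0 i * y ord0 j)) ->
  pderiv l g x = b ord0 l + \sum_i (A l i + A i l) * x ord0 i.
Proof.
move=> gE.
rewrite (_ : g = fun x => (a + dotp b x) + \sum_i \sum_j A i j * (x ord0 i * x ord0 j)); last exact/funext.
rewrite pderivD; last 2 first.
- by apply: (@Ck_derivable _ _ 0); apply: Ck_affine; exists a, b.
- by apply: (@Ck_derivable _ _ 0); apply: Ck_sum => i; apply: Ck_sum => j; exact: Ck_monom.
rewrite (@pderiv_affine a b)//; congr +%R.
rewrite pderiv_sum; last by move=> i; apply: Ck_sum => j; exact: Ck_monom.
transitivity (\sum_i \sum_j A i j * ((i == l)%:R * x ord0 j + (j == l)%:R * x ord0 i)).
  apply: eq_bigr => i _; rewrite pderiv_sum; last by move=> j; exact: Ck_monom.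
  apply: eq_bigr => j _; have di := is_derive_coord i l x; have dj := is_derive_coord j l x.
  rewrite pderivM; [|exact: derivable_cst|by apply: derivableM; [case: di|case: dj]].
  rewrite pderiv_cst mulr0 addr0 pderivM; [|by case: di|by case: dj].
  by rewrite !pderiv_coord addrC [X in _ * (X + _)]mulrC [X in _ * (_ + X)]mulrC.
under eq_bigr do under eq_bigr do rewrite mulrDr.
under eq_bigr do rewrite big_split/=.
rewrite big_split/= (bigD1 l)//= [X in _ + X + _]big1 ?addr0; last first.
  by move=> i /negbTE il; rewrite big1// => j _; rewrite il mul0r mulr0.
under [RHS]eq_bigr do rewrite mulrDl.
rewrite [RHS]big_split/=; congr +%R.
  by apply: eq_bigr => j _; rewrite eqxx mul1r.
apply: eq_bigr => i _; rewrite (bigD1 l)//= eqxx mul1r big1 ?addr0// => j /negbTE jl.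
by rewrite jl mul0r mulr0.
Qed.

Lemma affine_pderiv_quadratic g l : quadratic g -> affine (pderiv l g).
Proof.
move=> [a [b [A gE]]]; exists (b ord0 l), (\row_i (A l i + A i l)) => x.
by rewrite (pderiv_quadratic _ _ gE); congr +%R; apply: eq_bigr => i _; rewrite mxE.
Qed.

Lemma laplacian_quadratic g : quadratic g -> exists L, forall x, laplacian g x = L.
Proof.
move=> qg; pose L j := affine_pderiv_quadratic j qg.
exists (laplacian g 0) => x; rewrite /laplacian; apply: eq_bigr => j _.
by have [a [b E]] := L j; rewrite !(pderiv_affine _ _ E).
Qed.

(** Of the second order part only the evenness is recorded: this is what decides which integrals
    against symmetric bumps vanish. *)
Lemma taylor_quadratic g c : quadratic g -> exists2 q2 : 'rV[R]_n -> R,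
  forall z, q2 (- z) = q2 z &
  forall z, g (c + z) = g c + dotp (\row_j pderiv j g c) z + q2 z.
Proof.
move=> [a [b [A gE]]].
exists (fun z => \sum_i \sum_j A i j * (z ord0 i * z ord0 j)).
  move=> z; apply: eq_bigr => i _; apply: eq_bigr => j _.
  by rewrite !mxE mulrNN.
move=> z; rewrite !gE dotpDr.
have -> : dotp (\row_j pderiv j g c) z =
    dotp b z + \sum_i \sum_j A i j * (c ord0 i * z ord0 j + z ord0 i * c ord0 j).
  rewrite /dotp; under eq_bigr do rewrite mxE (pderiv_quadratic _ _ gE) mulrDl.
  rewrite big_split/=; congr +%R.
  under [RHS]eq_bigr do under eq_bigr do rewrite mulrDr.
  under [RHS]eq_bigr do rewrite big_split/=.
  rewrite [RHS]big_split/= [X in _ = X + _]exchange_big/= -big_split/=.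
  apply: eq_bigr => i _; rewrite mulr_suml -big_split/=; apply: eq_bigr => j _; ring.
rewrite -!addrA; congr +%R; congr +%R; rewrite addrCA; congr +%R.
rewrite -!big_split/=; apply: eq_bigr => i _; rewrite -!big_split/=.
by apply: eq_bigr => j _; rewrite !mxE; ring.
Qed.

End polynomials.

Lemma Rintegral_sum d (T : measurableType d) (R : realType)
    (mu : {measure set T -> \bar R}) (D : set T) (I : Type) (s : seq I) (F : I -> T -> R) :
  measurable D -> (forall i, mu.-integrable D (EFin \o F i)) ->
  mu.-integrable D (EFin \o (fun x => \sum_(i <- s) F i x)) /\
  \int[mu]_(x in D) (\sum_(i <- s) F i x) = \sum_(i <- s) \int[mu]_(x in D) F i x.
Proof.
move=> mD iF; elim: s => [|i s [ih1 ih2]].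
  under eq_fun do rewrite big_nil.
  split; first exact: (@integrable0 _ _ _ mu D).
  by rewrite big_nil Rintegral_cst// mul0r.
have -> : (fun x => \sum_(j <- i :: s) F j x) = (fun x => F i x + \sum_(j <- s) F j x).
  by apply/funext => x; rewrite big_cons.
split; first exact: (integrableD mD (iF i) ih1).
by rewrite RintegralD// ih2 big_cons.
Qed.

Section integration_by_parts.
Context {R : realType} {n : nat}.
Implicit Types (F g phi : 'rV[R]_n -> R) (c x : 'rV[R]_n).

Lemma integrable_Cc F c b : 0 <= b -> continuous F ->
  (forall x, ~ cube c b x -> F x = 0) -> (leb_rV n).-integrable setT (EFin \o F).
Proof.
move=> b0 cF F0; have [M _ hM] := supported_bounded cF F0.
exact: (integrable_supported b0 (continuous_measurable_rV cF) F0 hM).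
Qed.

Lemma Rintegral_pderiv i F c b : 0 <= b -> Ck 1 F ->
  (forall x, ~ cube c b x -> F x = 0) -> \int[leb_rV n]_x pderiv i F x = 0.
Proof.
(* The support is enclosed in a larger cube centred at the origin, the form that [integral_pderiv]
   expects. *)
move=> b0 CF F0; rewrite /Rintegral (@integral_pderiv _ _ _ F (b + \sum_i `|c ord0 i|)) //.
- by rewrite addr_ge0// sumr_ge0.
- by move=> x; exact: Ck_derivable CF.
- exact: Ck_continuous (Ck_pderiv i CF).
- move=> x nx; apply: F0 => cx; apply: nx => j; rewrite mxE subr0.
  rewrite -(subrK (c ord0 j) (x ord0 j)); apply: le_trans (ler_normD _ _) _.
  by apply: lerD; [exact: cx|rewrite (bigD1 j)//= lerDl sumr_ge0].
Qed.

Lemma integration_by_parts_rV i g phi c b : 0 <= b -> Ck 1 g -> Ck 1 phi ->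
  (forall x, ~ cube c b x -> phi x = 0) ->
  \int[leb_rV n]_x (g x * pderiv i phi x) = - \int[leb_rV n]_x (pderiv i g x * phi x).
Proof.
move=> b0 Cg Cphi phi0.
have gphi0 x : ~ cube c b x -> g x * phi x = 0 by move=> /phi0 ->; rewrite mulr0.
have := Rintegral_pderiv i b0 (CkM Cg Cphi) gphi0.
under eq_Rintegral => x _.
  rewrite (pderivM (@Ck_derivable _ _ 0 g i x Cg) (@Ck_derivable _ _ 0 phi i x Cphi)) [X in _ + X]mulrC.
over.
rewrite RintegralD//; first by move/eqP; rewrite addr_eq0 => /eqP.
- apply: (@integrable_Cc _ c b b0).
    by apply: (@Ck_continuous _ _ 0); apply: CkM; [exact: CkW|exact: Ck_pderiv].
  by move=> x /(pderiv_supported i phi0) ->; rewrite mulr0.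
- apply: (@integrable_Cc _ c b b0).
    by apply: (@Ck_continuous _ _ 0); apply: CkM; [exact: Ck_pderiv|exact: CkW].
  by move=> x /phi0 ->; rewrite mulr0.
Qed.

Lemma laplacian_supported phi c b : (forall x, ~ cube c b x -> phi x = 0) ->
  forall x, ~ cube c b x -> laplacian phi x = 0.
Proof.
move=> phi0 x nx; apply: big1 => i _; apply: (pderiv_supported i _ nx) => y.
exact: pderiv_supported.
Qed.

Lemma Ck_laplacian k phi : Ck k.+2 phi -> Ck k (laplacian phi).
Proof. by move=> C; apply: Ck_sum => i; do 2 apply: Ck_pderiv. Qed.

Lemma green g phi c b : 0 <= b -> Ck 2 g -> Ck 2 phi ->
  (forall x, ~ cube c b x -> phi x = 0) ->
  \int[leb_rV n]_x (g x * laplacian phi x) = \int[leb_rV n]_x (laplacian g x * phi x).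
Proof.
move=> b0 Cg Cphi phi0.
have dphi0 i := pderiv_supported i phi0.
under eq_Rintegral do rewrite mulr_sumr.
under [RHS]eq_Rintegral do rewrite mulr_suml.
have i1 i : (leb_rV n).-integrable setT (EFin \o (fun x => g x * pderiv i (pderiv i phi) x)).
  apply: (@integrable_Cc _ c b b0).
    by apply: (@Ck_continuous _ _ 0); apply: CkM; [do 2 apply: CkW|do 2 apply: Ck_pderiv].
  by move=> x /(pderiv_supported i (dphi0 i)) ->; rewrite mulr0.
have i2 i : (leb_rV n).-integrable setT (EFin \o (fun x => pderiv i (pderiv i g) x * phi x)).
  apply: (@integrable_Cc _ c b b0).
    by apply: (@Ck_continuous _ _ 0); apply: CkM; [do 2 apply: Ck_pderiv|do 2 apply: CkW].
  by move=> x /phi0 ->; rewrite mulr0.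
rewrite (Rintegral_sum _ _ i1).2// (Rintegral_sum _ _ i2).2//.
apply: eq_bigr => i _.
rewrite (integration_by_parts_rV i b0 (CkW Cg) (Ck_pderiv i Cphi) (dphi0 i)).
rewrite (integration_by_parts_rV i b0 (Ck_pderiv i Cg) (CkW Cphi) phi0).
exact: opprK.
Qed.

Lemma Rintegral_reflect c F : measurable_fun setT F ->
  \int[leb_rV n]_x F (c - x) = \int[leb_rV n]_x F x.
Proof.
move=> mF; rewrite /Rintegral [in LHS]integralE [in RHS]integralE; congr (fine (_ - _)).
- have := ge0_integral_reflect c (measurable_funepos ((measurable_EFinP _ _).2 mF)) (funepos_ge0 _).
  by move=> <-; apply: eq_integral => x _; rewrite !funeposE.
- have := ge0_integral_reflect c (measurable_funeneg ((measurable_EFinP _ _).2 mF)) (funeneg_ge0 _).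
  by move=> <-; apply: eq_integral => x _; rewrite !funenegE.
Qed.

End integration_by_parts.

Section abs_primitive.
Context {R : realType}.

(** A primitive in [s] of [|u - s|]; the product of a number with its absolute value gives one
    formula on both sides of [u]. *)
Let F (u s : R) : R := 2^-1 * ((s - u) * `|s - u|).

Let is_derive_normM (t : R) : is_derive t (1 : R) (fun t : R => t * `|t|) (2 * `|t|).
Proof.
have [t0|t0|->] := ltrgtP t 0.
- apply: (@near_eq_is_derive _ _ _ (- (@id R * @id R))).
    near=> s; rewrite !fctE /= ler0_norm ?mulrN// ltW//.
    by near: s; exact: lt_nbhsl.
  apply: is_derive_eq; rewrite /GRing.scale/= ltr0_norm//; ring.
- apply: (@near_eq_is_derive _ _ _ (@id R * @id R)).
    near=> s; rewrite !fctE /= ger0_norm// ltW//.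
    by near: s; exact: lt_nbhsr.
  apply: is_derive_eq; rewrite /GRing.scale/= gtr0_norm//; ring.
- rewrite normr0 mulr0.
  have q : (fun h : R => h^-1 *: ((h *: (1 : R) + 0 : R) * `|h *: (1 : R) + 0 : R| - 0 * `|0 : R|)) @ 0^' --> (0 : R).
    apply/cvgrPdist_le => e e0; near=> h.
    have h0 : h != 0 by near: h; exact: nbhs_dnbhs_neq.
    rewrite sub0r normrN mul0r subr0 addr0 /GRing.scale/= mulr1 mulKf// normr_id.
    by near: h; exact: dnbhs0_le.
  apply: DeriveDef; first by apply/cvg_ex; exists 0.
  exact: cvg_lim q.
Unshelve. all: by end_near. Qed.

Lemma integral_norm_sub (u A : R) : 0 < A -> `|u| <= A ->
  (\int[lebesgue_measure]_(s in `[(- A)%R, A]) (`|u - s|)%:E = (u ^+ 2 + A ^+ 2)%:E)%E.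
Proof.
move=> A0 uA; have ltA : - A < A by lra.
have dF (s : R) : is_derive s (1 : R) (F u) `|s - u|.
  have h : is_derive s (1 : R) (fun t : R => t - u) 1.
    have := is_derive_affine 1 (- u) s.
    by rewrite (_ : (fun t => 1 * t + - u) = (fun t : R => t - u))//; apply/funext => t; rewrite mul1r.
  have := is_deriveZ 2^-1 (@is_derive1_comp _ (fun t : R => t * `|t|) (fun t : R => t - u) s _ _ (is_derive_normM (s - u)) h).
  by move/is_derive_eq; apply; rewrite /GRing.scale/= mulr1 mulKf// pnatr_eq0.
have cn : continuous (fun s : R => `|u - s|).
  move=> s; apply: (@continuous_comp _ _ _ (fun s : R => u - s)); last exact: norm_continuous.
  by apply: cvgB; [exact: cvg_cst|exact: cvg_id].
have cF (s : R) : {for s, continuous (F u)}.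
  by apply: differentiable_continuous; apply/derivable1_diffP; case: (dF s).
rewrite (continuous_FTC2 ltA (F := F u)).
- rewrite -EFinB; congr EFin; rewrite /F.
  move: uA; rewrite ler_norml => /andP[h1 h2].
  rewrite (ger0_norm (_ : 0 <= A - u)); last lra.
  rewrite (ler0_norm (_ : - A - u <= 0)); last lra.
  by field.
- exact: continuous_subspaceT.
- split; [by move=> s _; case: (dF s)|by apply: cvg_at_right_filter; exact: cF|by apply: cvg_at_left_filter; exact: cF].
- by move=> s _; rewrite derive1E (@derive_val _ _ _ _ _ _ _ (dF s)) distrC.
Qed.

End abs_primitive.

Section bump2.
Context {R : realType} {n : nat}.
Implicit Types (c x v : 'rV[R]_n) (r : R).

(* Symmetrized about [c], so that the odd parts of the integrands drop out. *)
Definition bump2 c v r x : R := cbump (c + v) r x + cbump (c - v) r x.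

Lemma Ck_cbump k c r : Ck k (cbump c r).
Proof. exact: Ck_dbump. Qed.

Lemma Ck_bump2 k c v r : Ck k (bump2 c v r).
Proof. by apply: CkD; exact: Ck_cbump. Qed.

Lemma cbump_eq0 c r x : 0 < r -> ~ cube c r x -> cbump c r x = 0.
Proof. exact: dbump_eq0. Qed.

Lemma bump2_eq0 c v r rho x : 0 < r -> (forall i, `|v ord0 i| + r <= rho) ->
  ~ cube c rho x -> bump2 c v r x = 0.
Proof.
move=> r0 vr nx; rewrite /bump2 !cbump_eq0 ?addr0// => h; apply: nx => i.
  have := h i; rewrite !mxE opprD opprK => hi.
  apply: le_trans (vr i); rewrite [leRHS]addrC.
  rewrite (_ : x ord0 i - c ord0 i = (x ord0 i + (- c ord0 i + v ord0 i)) - v ord0 i); last ring.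
  by apply: le_trans (ler_normB _ _) _; rewrite lerD2r.
have := h i; rewrite !mxE opprD => hi.
apply: le_trans (vr i); rewrite [leRHS]addrC.
rewrite (_ : x ord0 i - c ord0 i = (x ord0 i + (- c ord0 i - v ord0 i)) + v ord0 i); last ring.
by apply: le_trans (ler_normD _ _) _; rewrite lerD2r.
Qed.

Lemma pderiv_cbump i c r : pderiv i (cbump c r) = dbump c r (fun j => ((j == i) + 0)%N).
Proof. exact: pderiv_dbump. Qed.

Lemma pderiv2_cbump i c r : pderiv i (pderiv i (cbump c r)) =
  dbump c r (fun j => ((j == i) + ((j == i) + 0))%N).
Proof. by rewrite pderiv_cbump pderiv_dbump. Qed.

Lemma cbump_reflect c v r x : cbump (c + v) r (c + c - x) = cbump (c - v) r x.
Proof. by rewrite /cbump dbump_reflect big1// expr0 mul1r. Qed.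

Lemma pderiv_cbump_reflect i c v r x :
  pderiv i (cbump (c + v) r) (c + c - x) = - pderiv i (cbump (c - v) r) x.
Proof.
rewrite !pderiv_cbump dbump_reflect (bigD1 i)//= eqxx big1.
  by rewrite expr1 mulN1r.
by move=> j /negbTE ->.
Qed.

Lemma laplacian_cbump_reflect c v r x :
  laplacian (cbump (c + v) r) (c + c - x) = laplacian (cbump (c - v) r) x.
Proof.
apply: eq_bigr => i _; rewrite !pderiv2_cbump dbump_reflect (bigD1 i)//= eqxx big1.
  by rewrite sqrrN expr1n mul1r.
by move=> j /negbTE ->.
Qed.

Lemma laplacianD f g x : Ck 2 f -> Ck 2 (g : 'rV[R]_n -> R) ->
  laplacian (fun y => f y + g y) x = laplacian f x + laplacian g x.
Proof.
move=> Cf Cg; rewrite /laplacian -big_split/=; apply: eq_bigr => i _.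
have -> : pderiv i (fun y => f y + g y) = fun y => pderiv i f y + pderiv i g y.
  by apply/funext => y; apply: pderivD; [exact: (@Ck_derivable _ _ 1)|exact: (@Ck_derivable _ _ 1)].
by apply: pderivD; apply: (@Ck_derivable _ _ 0); exact: Ck_pderiv.
Qed.

Lemma pderiv_bump2 i c v r x :
  pderiv i (bump2 c v r) x = pderiv i (cbump (c + v) r) x + pderiv i (cbump (c - v) r) x.
Proof. by apply: pderivD; apply: (@Ck_derivable _ _ 0); exact: Ck_cbump. Qed.

Lemma laplacian_bump2 c v r x :
  laplacian (bump2 c v r) x = laplacian (cbump (c + v) r) x + laplacian (cbump (c - v) r) x.
Proof. by apply: laplacianD; exact: Ck_cbump. Qed.

Lemma bump2_reflect c v r x : bump2 c v r (c + c - x) = bump2 c v r x.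
Proof.
have := cbump_reflect c (- v) r x; rewrite opprK => h.
by rewrite /bump2 cbump_reflect h addrC.
Qed.

Lemma pderiv_bump2_reflect i c v r x :
  pderiv i (bump2 c v r) (c + c - x) = - pderiv i (bump2 c v r) x.
Proof.
have := pderiv_cbump_reflect i c (- v) r x; rewrite opprK => h.
by rewrite !pderiv_bump2 pderiv_cbump_reflect h addrC opprD.
Qed.

Lemma laplacian_bump2_reflect c v r x :
  laplacian (bump2 c v r) (c + c - x) = laplacian (bump2 c v r) x.
Proof.
have := laplacian_cbump_reflect c (- v) r x; rewrite opprK => h.
apply: (etrans (laplacian_bump2 c v r (c + c - x))).
apply: (etrans _ (esym (laplacian_bump2 c v r x))).
exact: (etrans (congr2 +%R (laplacian_cbump_reflect c v r x) h) (addrC _ _)).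
Qed.

(** Scaling: each derivative costs a factor [1 / r]. The constant is uniform in the centre, the
    shift and the radius, hence the same for all meshes. *)
Definition bump2_bound (C : R) : Prop := forall c v r, 0 < r ->
  [/\ forall x, `|bump2 c v r x| <= C,
      forall i x, `|pderiv i (bump2 c v r) x| <= C / r &
      forall x, `|laplacian (bump2 c v r) x| <= C / r ^+ 2].

Lemma exists_bump2_bound : exists2 C : R, 1 <= C & bump2_bound C.
Proof.
have [C C1 hC] := @eta_bound R; have C0 : 0 <= C by lra.
have Cn1 : 1 <= C ^+ n by exact: exprn_ege1.
pose N : R := n%:R; have N0 : 0 <= N by [].
have NC : 0 <= N * C ^+ n by rewrite mulr_ge0//; lra.
(* The 2 counts the two bumps, [1 + N] dominates both 1 and the number of second derivatives in the
   Laplacian, and [C ^+ n] bounds a product of [n] factors. *)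
exists (2 * (1 + N) * C ^+ n); first lra.
move=> c v r r0.
have b0 c' x : `|cbump c' r x| <= C ^+ n.
  have := @dbump_le _ _ c' r (fun=> 0%N) C x r0 C0 (fun _ t => hC 0%N t isT).
  by rewrite big1// expr0 mul1r.
have b1 c' i x : `|pderiv i (cbump c' r) x| <= r^-1 * C ^+ n.
  rewrite pderiv_cbump.
  have := @dbump_le _ _ c' r (fun j => ((j == i) + 0)%N) C x r0 C0 _.
  rewrite (bigD1 i)//= eqxx big1 ?addn0 ?expr1; last by move=> j /negbTE ->.
  by apply=> j t; apply: hC; case: (j == i).
have b2 c' i x : `|pderiv i (pderiv i (cbump c' r)) x| <= r^-1 ^+ 2 * C ^+ n.
  rewrite pderiv2_cbump.
  have := @dbump_le _ _ c' r (fun j => ((j == i) + ((j == i) + 0))%N) C x r0 C0 _.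
  rewrite (bigD1 i)//= eqxx big1 ?addn0; last by move=> j /negbTE ->.
  by apply=> j t; apply: hC; case: (j == i).
have b3 c' x : `|laplacian (cbump c' r) x| <= N * (r^-1 ^+ 2 * C ^+ n).
  apply: le_trans (ler_norm_sum _ _ _) _.
  have -> : N * (r^-1 ^+ 2 * C ^+ n) = \sum_(i < n) (r^-1 ^+ 2 * C ^+ n).
    by rewrite sumr_const card_ord mulr_natl.
  exact: ler_sum.
have ri : 0 < r^-1 by rewrite invr_gt0.
split.
- move=> x; apply: le_trans (ler_normD _ _) _.
  have := b0 (c + v) x; have := b0 (c - v) x; lra.
- move=> i x; rewrite pderiv_bump2; apply: le_trans (ler_normD _ _) _.
  apply: le_trans (lerD (b1 _ _ _) (b1 _ _ _)) _.
  rewrite -mulrDr mulrC; apply: ler_wpM2r; [exact: ltW|lra].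
- move=> x; rewrite laplacian_bump2; apply: le_trans (ler_normD _ _) _.
  apply: le_trans (lerD (b3 _ _) (b3 _ _)) _.
  rewrite -exprVn mulrCA -mulrDr mulrC; apply: ler_wpM2r; [exact: sqr_ge0|lra].
Qed.

(** Only the cube of half the radius, of volume [r ^+ n], is retained; there every factor is at
    least [expR (- 2) ^+ 2]. *)
Lemma Rintegral_cbump_ge c r : 0 < r ->
  (expR (- 2) ^+ 2 * r) ^+ n <= \int[leb_rV n]_x cbump c r x.
Proof.
move=> r0; have mc : measurable (cube c (r / 2)) by exact: measurable_cube.
pose d := (expR (- 2) ^+ 2 : R) ^+ n.
have -> : (expR (- 2) ^+ 2 * r) ^+ n = \int[leb_rV n]_(x in cube c (r / 2)) d.
  rewrite Rintegral_cst// leb_cube; last by rewrite divr_ge0// ltW.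
  by rewrite /= exprMn [X in _ = _ * X ^+ _]mulrC divfK.
have d0 : 0 <= d by rewrite exprn_ge0// exprn_ge0// expR_ge0.
rewrite [leLHS]Rintegral_mkcond; apply: le_Rintegral => //.
- apply: (@integrable_supported _ _ _ c (r / 2) d).
  + by rewrite divr_ge0// ltW.
  + by apply/(measurable_restrictT _ mc).
  + by move=> x ncx; rewrite patchE memNset.
  + by move=> x; rewrite patchE; case: ifP => _; rewrite ?normr0// ger0_norm.
- apply: (@integrable_Cc _ _ _ c r (ltW r0)).
    by apply: Ck_continuous (Ck_cbump 0 c r).
  by move=> x; exact: cbump_eq0.
- move=> x _; rewrite patchE; case: ifPn => [|_]; last exact: cbump_ge0.
  by rewrite inE => cx; exact: cbump_ge.
Qed.

Lemma Rintegral_bump2 c v r : 0 < r ->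
  \int[leb_rV n]_x bump2 c v r x = 2 * \int[leb_rV n]_x cbump c r x.
Proof.
move=> r0.
have cc c' : continuous (cbump c' r) by apply: Ck_continuous (Ck_cbump 0 c' r).
have ic c' : (leb_rV n).-integrable setT (EFin \o cbump c' r).
  by apply: (@integrable_Cc _ _ _ c' r (ltW r0) (cc c')) => x; exact: cbump_eq0.
(* Translation invariance, from the reflection about the midpoint of [c] and [c + w] and the
   evenness of [eta]. *)
have h w : \int[leb_rV n]_x cbump (c + w) r x = \int[leb_rV n]_x cbump c r x.
  rewrite -(@Rintegral_reflect _ _ (c + (c + w)) (cbump (c + w) r)); last exact: continuous_measurable_rV.
  apply: eq_Rintegral => x _.
  rewrite /cbump !dbumpE; apply: eq_bigr => i _; rewrite !expr0 !mul1r.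
  by rewrite /derive1n/= -eta_even -mulrN; congr (eta (_ * _)); rewrite !mxE; ring.
rewrite (RintegralD measurableT (ic _) (ic _)) (h v) (h (- v)); ring.
Qed.

End bump2.

(** * The distance to a hyperplane tested against bumps *)

Section hyperplane_layer.
Context {R : realType} {n : nat}.
Implicit Types (c x nu : 'rV[R]_n) (r : R).

Lemma row_tail_cons x t : row_tail (row_cons (x, t)) = x.
Proof. by apply/rowP => i; rewrite mxE row_consS. Qed.

Lemma measurable_row_tail : measurable_fun setT (@row_tail R n).
Proof.
apply: measurable_fun_row => i; under eq_fun do rewrite mxE.
exact: measurable_coord.
Qed.

Let lam nu c x : R := dotp nu (x - c).

Let Ck_lam k nu c : Ck k (lam nu c).
Proof.
apply: Ck_affine; exists (- dotp nu c), nu => x.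
by rewrite /lam dotpBr addrC.
Qed.

Let continuous_norm_lam nu c (s : R) : continuous (fun x => `|lam nu c x - s|).
Proof.
have cl : continuous (fun x => lam nu c x - s).
  exact: (@CkD _ _ 0 (lam nu c) (fun=> - s) (Ck_lam 0 nu c) (Ck_cst 0 (- s))).
by move=> x; apply: (continuous_comp (cl x)); exact: norm_continuous.
Qed.

Let pderiv_lam i nu c x : pderiv i (lam nu c) x = nu ord0 i.
Proof.
apply: (@pderiv_affine _ _ (- dotp nu c)) => y.
by rewrite /lam dotpBr addrC.
Qed.

Let lam_bound nu c x r : 0 <= r -> enorm nu = 1 -> cube c r x -> `|lam nu c x| <= n%:R * r.
Proof.
by move=> r0 nu1 cx; apply: norm_dotp_cube; rewrite ?nu1// => i; rewrite !mxE; exact: cx.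
Qed.

Lemma laplacian_lam_sqr nu c (a : R) x : enorm nu = 1 ->
  laplacian (fun x => lam nu c x * lam nu c x + a) x = 2.
Proof.
move=> nu1.
have dl i y : derivable (lam nu c) y (delta_mx ord0 i).
  by apply: (@Ck_derivable _ _ 0); exact: Ck_lam.
have e i : pderiv i (fun x => lam nu c x * lam nu c x + a) = fun x => (2 * nu ord0 i) * lam nu c x.
  apply/funext => y; rewrite pderivD; last 2 first.
  - exact: derivableM.
  - exact: derivable_cst.
  rewrite pderiv_cst addr0 pderivM// pderiv_lam; ring.
rewrite /laplacian; transitivity (2 * dotp nu nu); last by rewrite -sqr_enorm nu1 expr1n mulr1.
rewrite /dotp mulr_sumr; apply: eq_bigr => i _; have dc : derivable (fun _ : 'rV[R]_n => 2 * nu ord0 i) x (delta_mx ord0 i) by exact: derivable_cst.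
rewrite e (pderivM dc (dl i x)) pderiv_cst pderiv_lam; ring.
Qed.

(* Averaging over [s] turns the distance to the hyperplane into a quadratic function, since
   the integral of [|u - s|] over [[- A, A]] is [u ^+ 2 + A ^+ 2]. *)
Lemma exists_shift nu c r : (0 < n)%N -> enorm nu = 1 -> 0 < r ->
  exists2 s, `|s| <= n%:R * r &
    (\int[leb_rV n]_x cbump c r x) / (2 * (n%:R * r)) <=
    \int[leb_rV n]_x (`|lam nu c x - s| * laplacian (cbump c r) x).
Proof.
(* [A] bounds [|lam|] on the support of the bump, as [integral_norm_sub] requires. *)
move=> n0 nu1 r0; pose A := n%:R * r; rewrite -/A.
have A0 : 0 < A by rewrite mulr_gt0// ltr0n.
pose L := laplacian (cbump c r).
have L0 x : ~ cube c r x -> L x = 0.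
  by apply: laplacian_supported => y; exact: cbump_eq0.
have CL : continuous L by apply: (@Ck_continuous _ _ 0); apply: Ck_laplacian; exact: Ck_cbump.
have mL := continuous_measurable_rV CL.
have [M M0 LM] := supported_bounded CL L0.
have mlam : measurable_fun setT (lam nu c).
  by apply: continuous_measurable_rV; exact: Ck_continuous (Ck_lam 0 nu c).
pose J : set R := `[- A, A]%classic.
have mJ : measurable (J : set (measurableTypeR R)) by exact: measurable_itv.
have iJ : lebesgue_measure.-integrable setT (EFin \o (\1_J : R -> R)).
  exact: (@integrable_indic_itv R (- A) A true false).
have JE t : J t = (`|t| <= A) :> Prop by rewrite /J/= in_itv/= ler_norml.
pose I := \int[leb_rV n]_x cbump c r x.
have I0 : 0 < I.
  apply: lt_le_trans (Rintegral_cbump_ge c r0).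
  by rewrite exprn_gt0// mulr_gt0// exprn_gt0// expR_gt0.
(* Suppose every shift fails. Integrating over [s] in [[- A, A]], the slices add up to at most [I].
   In the other order the result is [2 * I], since Green's formula moves the Laplacian to
   [lam ^ 2 + A ^ 2], where it gives 2. This contradicts [I > 0]. *)
apply: contrapT => no.
have hs s : `|s| <= A -> \int[leb_rV n]_x (`|lam nu c x - s| * L x) <= I / (2 * A).
  by move=> sA; rewrite leNgt; apply/negP => h; apply: no; exists s => //; exact: ltW.
(* The pair of [s] and [x] is encoded as one vector with leading coordinate [s], so that the slicing
   of [leb_rV n.+1] provides both orders of integration. *)
pose F (y : 'rV[R]_n.+1) : R := \1_J (y ord0 ord0) *
  (`|lam nu c (row_tail y) - y ord0 ord0| * L (row_tail y)).
have mF : measurable_fun setT F.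
  have m0 := @measurable_coord R n.+1 ord0.
  have mt := measurable_row_tail.
  apply: measurable_funM.
    by apply: measurableT_comp m0; exact: measurable_indic.
  apply: measurable_funM; last exact: measurableT_comp mL mt.
  apply: measurableT_comp => //; apply: measurable_funB => //.
  exact: measurableT_comp mlam mt.
have F0 y : ~ cube (row_cons (c, 0)) (A + r) y -> F y = 0.
  move=> ny; rewrite /F indicE; case: (asboolP (J (y ord0 ord0))) => [Jy|nJ]; last first.
    by rewrite memNset// mul0r.
  rewrite (L0 (row_tail y)) ?mulr0// => cy; apply: ny => i.
  case: (unliftP ord0 i) => [j|] ->.
    rewrite row_consS/=; have := cy j; rewrite mxE => h; apply: le_trans h _.
    by rewrite lerDr ltW.
  by rewrite row_cons0 subr0; move: Jy; rewrite JE => h; apply: le_trans h _; rewrite lerDl ltW.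
have FM y : `|F y| <= 2 * A * M.
  have AM : 0 <= 2 * A * M by rewrite mulr_ge0// mulr_ge0// ltW.
  rewrite /F indicE; case: (asboolP (J (y ord0 ord0))) => [Jy|nJ]; last first.
    by rewrite memNset// mul0r normr0.
  rewrite mem_set// mul1r normrM normr_id.
  case: (pselect (cube c r (row_tail y))) => [cy|/L0 ->]; last by rewrite normr0 mulr0.
  apply: ler_pM => //; apply: le_trans (ler_normB _ _) _; rewrite mulr_natl mulr2n.
  by apply: lerD; [exact: lam_bound (ltW r0) nu1 cy|move: Jy; rewrite JE].
have Ar0 : 0 <= A + r by rewrite addr_ge0// ltW.
have iF := integrable_supported Ar0 mF F0 FM.
have FE x s : F (row_cons (x, s)) = \1_J s * (`|lam nu c x - s| * L x).
  by rewrite /F row_cons0 row_tail_cons.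
have ih (s : R) : (leb_rV n).-integrable setT (EFin \o (fun x => `|lam nu c x - s| * L x)).
  apply: (@integrable_Cc _ _ _ c r (ltW r0)); last by move=> x /L0 ->; rewrite mulr0.
  exact: (@CkM _ _ 0 _ L (@continuous_norm_lam nu c s) CL).
have E1 : (\int[leb_rV n.+1]_y (F y)%:E = (2 * I)%:E)%E.
  rewrite (integral_leb_rVS iF).
  transitivity (\int[leb_rV n]_x (((lam nu c x * lam nu c x + A ^+ 2) * L x)%:E))%E.
    apply: eq_integral => x _.
    transitivity (\int[lebesgue_measure]_(s in J) ((L x)%:E * (`|lam nu c x - s|)%:E))%E.
      rewrite [RHS]integral_mkcond; apply: eq_integral => s _.
      rewrite /= FE patchE indicE; case: ifPn => _; last by rewrite mul0r.
      by rewrite mul1r -EFinM mulrC.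
    have [cx|/L0 Lx] := pselect (cube c r x); last first.
      by rewrite Lx mulr0; apply: integral0_eq => s _; rewrite mul0e.
    rewrite integralZl//; last first.
      apply: continuous_compact_integrable; first exact: segment_compact.
      apply: continuous_subspaceT => s; apply: (@continuous_comp _ _ _ (fun s : R => lam nu c x - s)); last exact: norm_continuous.
      by apply: cvgB; [exact: cvg_cst|exact: cvg_id].
    rewrite (integral_norm_sub A0 (lam_bound (ltW r0) nu1 cx)) -EFinM; congr EFin.
    by rewrite mulrC expr2.
  have Cg : Ck 2 (fun x => lam nu c x * lam nu c x + A ^+ 2).
    by apply: CkD; [apply: CkM; exact: Ck_lam|exact: Ck_cst].
  have iG : (leb_rV n).-integrable setT (EFin \o (fun x => (lam nu c x * lam nu c x + A ^+ 2) * L x)).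
    apply: (@integrable_Cc _ _ _ c r (ltW r0)); last by move=> x /L0 ->; rewrite mulr0.
    exact: (@CkM _ _ 0 _ L (Ck_continuous Cg) CL).
  rewrite -[LHS]fineK ?integrable_fin_num//; congr EFin.
  have := green (ltW r0) Cg (Ck_cbump 2 c r) (fun x => @cbump_eq0 _ _ c r x r0).
  rewrite [LHS]/Rintegral => ->.
  under eq_Rintegral do rewrite laplacian_lam_sqr//.
  rewrite RintegralZl//; apply: (@integrable_Cc _ _ _ c r (ltW r0)).
    exact: Ck_continuous (Ck_cbump 0 c r).
  by move=> x; exact: cbump_eq0.
have E2 : (\int[leb_rV n.+1]_y (F y)%:E <= I%:E)%E.
  rewrite (integral_leb_rVS_swap iF).
  have -> : (I%:E = \int[lebesgue_measure]_s (I / (2 * A) * \1_J s)%:E)%E.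
    under eq_integral do rewrite EFinM.
    rewrite integralZl//.
    rewrite integral_indic// setIT /J.
    rewrite [X in (_ * X)%E](lebesgue_measure_itv `[- A, A])/= lte_fin.
    rewrite ifT; last lra.
    rewrite -EFinD -EFinM; congr EFin; field.
    by rewrite gt_eqF.
  apply: le_integral => //.
  - exact: integrable_leb_rVS_swap iF.
  - under eq_fun do rewrite EFinM.
    by apply: integrableZl.
  - move=> s _; under eq_integral do rewrite /= FE.
    rewrite indicE; case: (asboolP (J s)) => [Js|nJ]; last first.
      rewrite memNset// mulr0; under eq_integral do rewrite mul0r.
      by rewrite integral0.
    rewrite mem_set// mulr1; under eq_integral do rewrite mul1r.
    rewrite -[leLHS]fineK ?integrable_fin_num//; first by rewrite lee_fin; apply: hs; rewrite -JE.
    exact: ih.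
move: E2; rewrite E1 lee_fin; lra.
Qed.

(** Moving the kink of [|lam|] by [s] amounts to moving the bump by [s *: nu]. The mirror bump at
    [c - v] contributes the same amount because [|lam|] is even about [c], so symmetrization doubles
    both members. *)
Lemma exists_bump2 nu c r : (0 < n)%N -> enorm nu = 1 -> 0 < r ->
  exists2 v : 'rV[R]_n, (forall i, `|v ord0 i| <= n%:R * r) &
    (\int[leb_rV n]_x bump2 c v r x) / (2 * (n%:R * r)) <=
    \int[leb_rV n]_x (`|lam nu c x| * laplacian (bump2 c v r) x).
Proof.
move=> n0 nu1 r0; have [s sA hs] := exists_shift c n0 nu1 r0.
pose v := s *: nu; exists v.
  move=> i; rewrite mxE normrM -[leRHS]mulr1; apply: ler_pM => //.
  by rewrite -nu1; exact: coord_le_enorm.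
have clam : continuous (fun x => `|lam nu c x|).
  rewrite (_ : (fun x => _) = fun x => `|lam nu c x - 0|); first exact: continuous_norm_lam.
  by apply/funext => x; rewrite subr0.
have cL c' : continuous (laplacian (cbump c' r)).
  by apply: (@Ck_continuous _ _ 0); apply: Ck_laplacian; exact: Ck_cbump.
have cl c' : continuous (fun x => `|lam nu c x| * laplacian (cbump c' r) x).
  exact: (@CkM _ _ 0 _ _ clam (cL c')).
have il c' : (leb_rV n).-integrable setT (EFin \o (fun x => `|lam nu c x| * laplacian (cbump c' r) x)).
  apply: (@integrable_Cc _ _ _ c' r (ltW r0)) => // x nx.
  by rewrite (laplacian_supported _ nx) ?mulr0// => y; exact: cbump_eq0.
have e1 : \int[leb_rV n]_x (`|lam nu c x| * laplacian (cbump (c + v) r) x) =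
    \int[leb_rV n]_x (`|lam nu c x - s| * laplacian (cbump c r) x).
  (* The translation by [v] is realized as the reflection about the midpoint [c'] of [c] and
     [c + v]. *)
  pose c' := c + 2^-1 *: v.
  have c'E : c' + c' = c + (c + v).
    by rewrite /c' addrACA -scalerDl (_ : 2^-1 + 2^-1 = 1 :> R) ?scale1r ?addrA//; field.
  have c'D : c' + 2^-1 *: v = c + v.
    by rewrite /c' -addrA -scalerDl (_ : 2^-1 + 2^-1 = 1 :> R) ?scale1r//; field.
  have c'B : c' - 2^-1 *: v = c by rewrite addrK.
  apply: (etrans (esym (Rintegral_reflect (c' + c') (continuous_measurable_rV (cl (c + v)))))).
  apply: eq_Rintegral => x _.
  have := laplacian_cbump_reflect c' (2^-1 *: v) r x; rewrite c'D c'B => ->.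
  congr (_ * _); rewrite c'E /lam.
  have -> : c + (c + v) - x - c = v - (x - c).
    by apply/rowP => i; rewrite !mxE; ring.
  rewrite [in LHS]dotpBr /v dotpZr -sqr_enorm nu1 expr1n mulr1 distrC.
  by [].
have e2 : \int[leb_rV n]_x (`|lam nu c x| * laplacian (cbump (c - v) r) x) =
    \int[leb_rV n]_x (`|lam nu c x| * laplacian (cbump (c + v) r) x).
  apply: (etrans _ (Rintegral_reflect (c + c) (continuous_measurable_rV (cl (c + v))))).
  apply: eq_Rintegral => x _; rewrite (laplacian_cbump_reflect c v r x); congr (_ * _).
  have -> : lam nu c (c + c - x) = - lam nu c x.
    by rewrite /lam -dotpNr; congr dotp; apply/rowP => i; rewrite !mxE; ring.
  by rewrite normrN.
have -> : \int[leb_rV n]_x (`|lam nu c x| * laplacian (bump2 c v r) x) =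
    \int[leb_rV n]_x (`|lam nu c x| * laplacian (cbump (c + v) r) x +
                      `|lam nu c x| * laplacian (cbump (c - v) r) x).
  by apply: eq_Rintegral => x _; rewrite laplacian_bump2 mulrDr.
rewrite (etrans (RintegralD measurableT (il _) (il _)) (congr2 +%R e1 (etrans e2 e1))).
rewrite (Rintegral_bump2 c v r0).
move: hs; set a := _ / _; set b := Rintegral _ _ _ => hs.
have -> : 2 * (\int[leb_rV n]_x cbump c r x) / (2 * (n%:R * r)) = a + a by rewrite /a; ring.
exact: lerD.
Qed.

End hyperplane_layer.

(** * The weak formulation of the Stokes problem *)

Section boxes.
Context {R : realType} {n : nat}.
Implicit Types (a b x : 'rV[R]_n).

Definition obox a b : set 'rV[R]_n :=
  [set x | forall i, a ord0 i < x ord0 i < b ord0 i].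

Definition cbox a b : set 'rV[R]_n :=
  [set x | forall i, a ord0 i <= x ord0 i <= b ord0 i].

Lemma compact_cbox a b : compact (cbox a b).
Proof.
have -> : cbox a b = [set v | forall i, `[a ord0 i, b ord0 i]%classic (v ord0 i)].
  by apply/seteqP; split => y xy i; have := xy i; rewrite /= in_itv/=.
by apply: (@rV_compact _ _ (fun i => `[a ord0 i, b ord0 i]%classic)) => i; exact: segment_compact.
Qed.

Lemma measurable_obox a b : measurable (obox a b).
Proof.
have -> : obox a b = \big[setI/setT]_(i < n) [set x : 'rV[R]_n | a ord0 i < x ord0 i < b ord0 i].
  apply/seteqP; split => [x cx|x].
    by rewrite -bigcap_seq => i _; exact: cx.
  by rewrite -bigcap_seq => cx i; apply: cx; rewrite /= mem_index_enum.
apply: bigsetI_measurable => i _.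
have := @measurable_coord R n i measurableT `]a ord0 i, b ord0 i[%classic (measurable_itv _).
by rewrite setTI; congr measurable; apply/seteqP; split => x/=; rewrite in_itv.
Qed.

Lemma oboxI a b a' b' : obox a b `&` obox a' b' =
  obox (\row_i Num.max (a ord0 i) (a' ord0 i)) (\row_i Num.min (b ord0 i) (b' ord0 i)).
Proof.
apply/seteqP; split => [x [h h'] i|x h].
  by rewrite !mxE gt_max lt_min; have /andP[-> ->] := h i; have /andP[-> ->] := h' i.
split => i; have := h i; rewrite !mxE gt_max lt_min => /andP[/andP[h1 h2] /andP[h3 h4]].
  by rewrite h1 h3.
by rewrite h2 h4.
Qed.

(** It suffices that the identity, seen as a map from the sigma-algebra of the boxes, has measurable
    coordinates. The preimage of an interval is a slab, a countable union of boxes growing in the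
    other directions. *)
Lemma measurable_sub_oboxes :
  (@measurable _ 'rV[R]_n) `<=` <<s [set A | exists a b, A = obox a b] >>.
Proof.
set G := [set A | _]; move=> A mA.
have mid : measurable_fun setT (fun t : g_sigma_algebraType G => t : 'rV[R]_n).
  apply: measurable_fun_row => i.
  apply: (measurability _ (RGenOpens.measurableE R)) => _ [_ [u [v ->] <-]].
  rewrite setTI (_ : _ @^-1` _ = \bigcup_k obox
    (\row_j (if j == i then u else - k%:R)) (\row_j (if j == i then v else k%:R))).
    apply: bigcupT_measurable => k; apply: sub_sigma_algebra.
    by eexists; eexists; reflexivity.
  apply/seteqP; split => [x|x [k _ /(_ i)]]; last by rewrite !mxE eqxx /= in_itv.
  rewrite /= in_itv/= => hx; exists (Num.truncn (\sum_(i < n) `|x ord0 i|)).+1 => //= j.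
  rewrite !mxE; case: eqP => [->//|_]; rewrite -ltr_norml.
  apply: le_lt_trans (truncnS_gt _).
  by rewrite (bigD1 j)//= lerDl sumr_ge0.
have := mid measurableT A mA; rewrite setTI; exact.
Qed.

(* The open boxes form a pi-system generating the Borel sets. *)
Lemma ae_eq0_obox a b (w : 'rV[R]_n -> R) :
  (leb_rV n).-integrable (obox a b) (EFin \o w) ->
  (forall a' b', (\int[leb_rV n]_(x in obox a' b' `&` obox a b) (w x)%:E = 0)%E) ->
  ae_eq (leb_rV n) (obox a b) (EFin \o w) (cst 0%E).
Proof.
move=> iw w0; set Q := obox a b in iw w0 *.
have mQ : measurable Q by exact: measurable_obox.
have iwS E : measurable E -> (leb_rV n).-integrable (E `&` Q) (EFin \o w).
  move=> mE; apply: (@integrableS _ _ _ _ Q) => //; exact: measurableI.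
pose H := [set E : set 'rV[R]_n | measurable E /\ (\int[leb_rV n]_(x in E `&` Q) (w x)%:E = 0)%E].
have wQ : (\int[leb_rV n]_(x in Q) (w x)%:E = 0)%E by have := w0 a b; rewrite setIid.
have dH : dynkin H.
  split.
  - by split => //; rewrite setTI.
  - move=> E [mE E0]; split; first exact: measurableC.
    have := wQ; rewrite {1}(_ : Q = (E `&` Q) `|` (~` E `&` Q)); last first.
      by rewrite -setIUl setUv setTI.
    rewrite integral_setU_EFin//.
    + by rewrite E0 add0e.
    + exact: measurableI.
    + by apply: measurableI => //; exact: measurableC.
    + by rewrite -setIUl setUv setTI; apply/measurable_EFinP; exact: measurable_int iw.
    + apply/disj_setPS => x [[Ex _] [nEx _]]; exact: nEx.
  - move=> F tF HF; split; first by apply: bigcupT_measurable => k; case: (HF k).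
    rewrite setI_bigcupl integral_bigcup//.
    + by apply: eseries0 => k _ _; case: (HF k).
    + by apply: trivIset_setIr.
    + by move=> k; apply: measurableI => //; case: (HF k).
    + rewrite -setI_bigcupl; apply: iwS; apply: bigcupT_measurable => k; by case: (HF k).
have HT E : measurable E -> H E.
  move=> /measurable_sub_oboxes; apply: lambda_system_subset => //.
  - move=> _ _ [a1 [b1 ->]] [a2 [b2 ->]]; rewrite oboxI; eexists; eexists; reflexivity.
  - exact/dynkin_lambda_system.
  - by move=> _ [a1 [b1 ->]]; split; [exact: measurable_obox|exact: w0].
apply: integral_ae_eq => // E EQ mE.
by have [_] := HT E mE; rewrite setIidl// => ->; rewrite integral0.
Qed.

End boxes.

Section box_bump.
Context {R : realType} {n : nat}.
Implicit Types (a b x : 'rV[R]_n).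

(** [k] is a steepness: the functions stay between 0 and 1 and converge everywhere to the indicator
    of the open box, which suits dominated convergence. *)
Definition box_bump a b (k : nat) : 'rV[R]_n -> R :=
  prodfun (fun i => bump1 k%:R (a ord0 i) (b ord0 i)) (fun=> 0%N).

Lemma box_bumpE a b k x :
  box_bump a b k x = \prod_i bump1 k%:R (a ord0 i) (b ord0 i) (x ord0 i).
Proof. by []. Qed.

Lemma box_bump_eq0 a b k x : ~ obox a b x -> box_bump a b k x = 0.
Proof.
move=> /existsNP[i /negP]; rewrite negb_and -!leNgt => h.
by rewrite box_bumpE (bigD1 i)//= bump1_eq0 ?mul0r.
Qed.

Lemma obox_sub_cbox a b : obox a b `<=` cbox a b.
Proof. by move=> x h i; have /andP[/ltW -> /ltW ->] := h i. Qed.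

Lemma box_bump_bounds a b k x : 0 <= box_bump a b k x <= 1.
Proof.
rewrite box_bumpE prodr_ge0/=; last by move=> i _; exact: bump1_ge0.
by apply: prodr_ile1 => i; rewrite bump1_ge0 bump1_le1.
Qed.

Lemma test_box_bump (Omega : set 'rV[R]_n) a b k : cbox a b `<=` Omega ->
  test_function Omega (box_bump a b k).
Proof.
move=> abO; apply: (@test_function_supp _ _ _ (cbox a b)) => //.
- by move=> m; apply: Ck_prodfun => i; exact: smooth_bump1.
- exact: compact_cbox.
- by move=> x nx; apply: box_bump_eq0 => h; apply: nx; exact: obox_sub_cbox.
Qed.

Let cvg_flat1 (s : R) : 0 < s -> flat 1 (k%:R * s) @[k --> \oo] --> (1 : R).
Proof.
move=> s0; have h : - (k%:R * s)^-1 @[k --> \oo] --> (0 : R).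
  rewrite -[X in _ --> X]oppr0; apply: cvgN.
  have : (k%:R : R)^-1 * s^-1 @[k --> \oo] --> (0 * s^-1 : R).
    apply: cvgMl; apply/gtr0_cvgV0; last exact: cvgr_idn.
    by near=> k; rewrite ltr0n; near: k; exists 1%N.
  by rewrite mul0r; apply: cvg_trans; apply: near_eq_cvg; near=> k; rewrite invfM.
have he := @cvg_comp _ _ _ (fun k : nat => - (k%:R * s)^-1) expR \oo (nbhs 0) (nbhs (expR 0)) h (@continuous_expR R 0).
rewrite expR0 in he; apply: cvg_trans he; apply: near_eq_cvg; near=> k.
rewrite /flat hornerC mul1r ifT// mulr_gt0// ltr0n.
by near: k; exists 1%N.
Unshelve. all: by end_near. Qed.

Lemma cvg_box_bump a b x : box_bump a b k x @[k --> \oo] --> (\1_(obox a b) x : R).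
Proof.
rewrite indicE; case: (asboolP (obox a b x)) => [hx|nx]; last first.
  rewrite memNset//; under eq_fun do rewrite box_bump_eq0//.
  exact: cvg_cst.
rewrite mem_set// (_ : true%:R = \prod_(i < n) (1 : R)); last by rewrite big1.
apply: cvg_big => //; first exact: mul_continuous.
move=> i _; rewrite /derive1n/= /bump1; have /andP[h1 h2] := hx i.
by rewrite -[X in _ --> X]mulr1; apply: cvgM; apply: cvg_flat1; rewrite subr_gt0.
Qed.

End box_bump.

Section du_bois_reymond.
Context {R : realType} {n : nat}.
Variable Omega : set 'rV[R]_n.
Hypothesis oO : open Omega.

Let mO : measurable Omega. Proof. exact: open_measurable_rV. Qed.

(** Steep bumps tend to indicators, so the integral of [w] vanishes on every box whose closure lies
    in [Omega]. A monotone class argument gives [w = 0] almost everywhere on such a box, and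
    countably many rational boxes cover [Omega]. *)
Lemma du_bois_reymond (w : 'rV[R]_n -> R) :
  (leb_rV n).-integrable Omega (EFin \o w) ->
  (forall psi, test_function Omega psi -> \int[leb_rV n]_(x in Omega) (w x * psi x) = 0) ->
  {ae leb_rV n, forall x, Omega x -> w x = 0}.
Proof.
move=> iw w0; have mw := measurable_int _ iw.
have step a b : cbox a b `<=` Omega ->
    (\int[leb_rV n]_(x in obox a b) (w x)%:E = 0)%E.
  move=> abO; have oabO := subset_trans (@obox_sub_cbox _ _ a b) abO.
  have mk k : measurable_fun setT (box_bump a b k).
    by apply: continuous_measurable_rV; case: (test_box_bump k abO) => /(_ 0%N).
  have mwk k : measurable_fun Omega (fun x => (w x * box_bump a b k x)%:E).
    apply/measurable_EFinP; apply: measurable_funM; first exact/measurable_EFinP.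
    exact: measurable_funTS.
  have mw1 : measurable_fun Omega (fun x => (w x * \1_(obox a b) x)%:E).
    apply/measurable_EFinP; apply: measurable_funM; first exact/measurable_EFinP.
    by apply: measurable_indic; exact: measurable_obox.
  have cv : {ae leb_rV n, forall x, Omega x ->
      (w x * box_bump a b k x)%:E @[k --> \oo] --> (w x * \1_(obox a b) x)%:E}.
    apply: aeW => x _; apply: cvg_EFin; first exact: nearW.
    by apply: cvgMr; exact: cvg_box_bump.
  have dom : {ae leb_rV n, forall x k, Omega x ->
      (`|(w x * box_bump a b k x)%:E| <= (abse \o (EFin \o w)) x)%E}.
    apply: aeW => x k _; rewrite /= lee_fin normrM ler_piMr//.
    by have /andP[h1 h2] := box_bump_bounds a b k x; rewrite ger0_norm.
  have [_ _] := dominated_convergence mO mwk mw1 cv (integrable_abse iw) dom.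
  have -> : [sequence (\int[leb_rV n]_(x in Omega) (w x * box_bump a b k x)%:E)%E]_k = cst 0%E.
    apply/funext => k; have := w0 _ (test_box_bump k abO).
    rewrite /Rintegral /= => h; rewrite -[LHS]fineK ?h//.
    apply: integrable_fin_num => //; apply: (le_integrable mO (mwk k) _ iw) => x _.
    rewrite /= lee_fin normrM ler_piMr//.
    by have /andP[h1 h2] := box_bump_bounds a b k x; rewrite ger0_norm.
  move=> /cvg_lim => /(_ (@ereal_hausdorff R)); rewrite lim_cst// => e0.
  rewrite (_ : obox a b = Omega `&` obox a b); last by rewrite setIidr.
  rewrite integral_mkcondr [RHS]e0; apply: eq_integral => x _.
  by rewrite patchE indicE; case: ifPn => _; rewrite ?mulr1// mulr0.
have box0 a b : cbox a b `<=` Omega -> ae_eq (leb_rV n) (obox a b) (EFin \o w) (cst 0%E).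
  move=> abO; apply: ae_eq0_obox.
    apply: (@integrableS _ _ _ _ Omega) => //; first exact: measurable_obox.
    exact: subset_trans (@obox_sub_cbox _ _ a b) abO.
  move=> a' b'; rewrite oboxI; apply: step => x h; apply: abO => i.
  have := h i; rewrite !mxE ge_max le_min => /andP[/andP[_ ->] /andP[_ ->]].
  by [].
pose box_of (p : 'rV[rat]_n * 'rV[rat]_n) := (map_mx ratr p.1 : 'rV[R]_n, map_mx ratr p.2 : 'rV[R]_n).
pose Q (p : 'rV[rat]_n * 'rV[rat]_n) : set 'rV[R]_n :=
  if `[< cbox (box_of p).1 (box_of p).2 `<=` Omega >] then obox (box_of p).1 (box_of p).2 else set0.
have QO x : Omega x -> exists p, Q p x.
  move=> Ox; have [r r0 xrO] := nbhs_cube (open_nbhs_nbhs (conj oO Ox)).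
  have /choice[q hq] : forall i, exists q : rat, x ord0 i - r < ratr q < x ord0 i.
    move=> i; have [|q] := @rat_in_itvoo R (x ord0 i - r) (x ord0 i); first by rewrite ltrBlDr ltrDl.
    by rewrite in_itv/=; exists q.
  have /choice[q' hq'] : forall i, exists q : rat, x ord0 i < ratr q < x ord0 i + r.
    move=> i; have [|q'] := @rat_in_itvoo R (x ord0 i) (x ord0 i + r); first by rewrite ltrDl.
    by rewrite in_itv/=; exists q'.
  exists (\row_i q i, \row_i q' i); rewrite /Q; case: asboolP => [_ i|].
    by rewrite !mxE; have /andP[_ ->] := hq i; have /andP[-> _] := hq' i.
  case; apply: subset_trans xrO => y hy i; have := hy i; rewrite !mxE => /andP[h1 h2].
  have /andP[h3 _] := hq i; have /andP[_ h4] := hq' i.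
  by rewrite ler_distl; apply/andP; split; apply/ltW; [exact: lt_le_trans h1|exact: le_lt_trans h4].
have Q0 p : (leb_rV n).-negligible (Q p `&` [set x | w x != 0]).
  rewrite /Q; case: asboolP => [h|_]; last by rewrite set0I; exact: negligible_set0.
  have := box0 _ _ h; apply: negligibleS => x [bx /= /eqP wx] /= /(_ bx) /= [] h0.
  exact: wx.
have := @negligible_bigcup _ _ _ (leb_rV n)
  (fun k => oapp (fun p => Q p `&` [set x | w x != 0]) set0 (choice.unpickle k)).
have hk k : (leb_rV n).-negligible (oapp (fun p => Q p `&` [set x | w x != 0]) set0 (choice.unpickle k)).
  by case: (choice.unpickle k) => [p|]//=; exact: negligible_set0.
move=> /(_ hk); apply: negligibleS => x /= /not_implyP[/QO[p Qp] wx].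
by exists (choice.pickle p) => //; rewrite choice.pickleK/=; split => //; exact/eqP.
Qed.

End du_bois_reymond.

(** * Smooth test functions in the weak equations *)

Section weak_formulation.
Context {R : realType} {d : nat}.
Variable Omega : set 'rV[R]_d.
Hypothesis oO : open Omega.
Hypothesis bO : bounded_set Omega.
Local Notation mu := (leb_rV d).
Implicit Types (v w g q phi psi : 'rV[R]_d -> R).

Let mO : measurable Omega. Proof. exact: open_measurable_rV. Qed.

Lemma bounded_sub_cube : exists2 b, 0 <= b & Omega `<=` cube (0 : 'rV[R]_d) b.
Proof.
have [M [_ hM]] := bO; exists (`|M| + 1); first by rewrite addr_ge0.
move=> x Ox i; rewrite mxE subr0.
have := hM (`|M| + 1) _ x Ox; rewrite ltr_pwDr// ?ler_norm// => /(_ isT).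
apply: le_trans; rewrite /Num.norm/= mx_normrE.
exact: (le_bigmax _ (fun ij : 'I_1 * 'I_d => `|x ij.1 ij.2|) (ord0, i)).
Qed.

Lemma leb_bounded_lty : (mu Omega < +oo)%E.
Proof.
have [b b0 Ob] := bounded_sub_cube.
apply: (@le_lt_trans _ _ (mu (cube 0 b))); last by rewrite leb_cube// ltry.
by apply: le_measure => //; rewrite inE//; exact: measurable_cube.
Qed.

Lemma Rintegral_set_support (D : set 'rV[R]_d) g : (forall x, ~ D x -> g x = 0) ->
  \int[mu]_(x in D) g x = \int[mu]_x g x.
Proof.
move=> g0; rewrite Rintegral_mkcond; apply: eq_Rintegral => x _; rewrite patchE.
by case: ifPn => //; rewrite notin_setE => /g0.
Qed.

Lemma ae_eq_Rintegral g h : measurable_fun Omega g -> measurable_fun Omega h ->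
  {ae mu, forall x, Omega x -> g x = h x} ->
  \int[mu]_(x in Omega) g x = \int[mu]_(x in Omega) h x.
Proof.
move=> mg mh gh; congr fine; apply: ae_eq_integral => //; try exact/measurable_EFinP.
by apply: filterS gh => x /= gh /gh ->.
Qed.

Lemma L2_mul_integrable v w : L2 Omega v -> L2 Omega w ->
  mu.-integrable Omega (EFin \o (fun x => v x * w x)).
Proof.
move=> [mv fv] [mw fw].
have sq (u : 'rV[R]_d -> R) : measurable_fun Omega u -> (\int[mu]_(x in Omega) (u x ^+ 2)%:E < +oo)%E ->
    mu.-integrable Omega (EFin \o (fun x => u x ^+ 2)).
  move=> m h; apply/integrableP; split; first by apply/measurable_EFinP; exact: measurable_funX.
  by under eq_integral do rewrite /= ger0_norm ?sqr_ge0//.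
apply: (@le_integrable _ _ _ mu Omega mO _ (EFin \o (fun x => v x ^+ 2 + w x ^+ 2))).
- by apply/measurable_EFinP; exact: measurable_funM.
- move=> x _; rewrite /= lee_fin [leRHS]ger0_norm ?addr_ge0 ?sqr_ge0//.
  by rewrite ler_norml; apply/andP; split; nra.
- exact: (integrableD mO (sq _ mv fv) (sq _ mw fw)).
Qed.

Lemma bounded_L2 v M : measurable_fun Omega v -> (forall x, `|v x| <= M) -> L2 Omega v.
Proof.
move=> mv vM; split => //.
have : mu.-integrable Omega (EFin \o (fun x => v x ^+ 2)).
  apply: measurable_bounded_integrable => //.
  - exact: leb_bounded_lty.
  - exact: measurable_funX.
  - exists (M ^+ 2); split; first exact: num_real.
    move=> y My x _; rewrite /= normrX; apply: le_trans (ltW My).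
    by rewrite ler_pXn2r ?nnegrE// (le_trans _ (vM x)).
by move=> i; exact: integrable_lty i.
Qed.

Lemma L2_integrable v : L2 Omega v -> mu.-integrable Omega (EFin \o v).
Proof.
move=> Lv; have L1 : L2 Omega (fun=> 1 : R).
  by apply: (@bounded_L2 _ 1) => // x; rewrite normr1.
have := L2_mul_integrable Lv L1.
by apply: eq_integrable => // x _; rewrite /= mulr1.
Qed.

Lemma test_measurable phi : test_function Omega phi -> measurable_fun Omega phi.
Proof.
move=> [Cphi _ _]; apply: measurable_funTS.
by apply: continuous_measurable_rV; exact: Ck_continuous (Cphi 0%N).
Qed.

Lemma test_L2 phi : test_function Omega phi -> L2 Omega phi.
Proof.
move=> tphi; have [M _ hM] := test_function_bounded tphi.
by apply: (@bounded_L2 _ M) => //; exact: test_measurable.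
Qed.

Lemma test_is_wderiv i phi : test_function Omega phi -> is_wderiv Omega i phi (pderiv i phi).
Proof.
move=> tphi psi tpsi; have [b b0 Ob] := bounded_sub_cube.
have [Cphi _ _] := tphi; have [Cpsi _ _] := tpsi.
have psi0 x : ~ Omega x -> psi x = 0 by exact: test_function_eq0.
have e1 : \int[mu]_(x in Omega) (phi x * pderiv i psi x) = \int[mu]_x (phi x * pderiv i psi x).
  apply: Rintegral_set_support => x nx.
  by rewrite (test_function_eq0 (test_function_pderiv i tpsi) nx) mulr0.
have e2 : \int[mu]_(x in Omega) (pderiv i phi x * psi x) = \int[mu]_x (pderiv i phi x * psi x).
  by apply: Rintegral_set_support => x /psi0 ->; rewrite mulr0.
have psi0' x : ~ cube 0 b x -> psi x = 0 by move=> nx; apply: psi0 => /Ob.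
by rewrite e1 e2; exact: (integration_by_parts_rV i b0 (Cphi 1%N) (Cpsi 1%N) psi0').
Qed.

Lemma wderivP i v : H1 Omega v -> L2 Omega (wderiv Omega i v) /\
  is_wderiv Omega i v (wderiv Omega i v).
Proof. by move=> [_ /(_ i) ex]; exact: (getPex ex). Qed.

Lemma test_H1 phi : test_function Omega phi -> H1 Omega phi.
Proof.
move=> tphi; split; first exact: test_L2.
move=> i; exists (pderiv i phi); split; last exact: test_is_wderiv.
by apply: test_L2; exact: test_function_pderiv.
Qed.

(** Since [wderiv] is a choice among weak derivatives, agreement with the classical derivative is a
    matter of uniqueness, that is, of [du_bois_reymond]. *)
Lemma wderiv_test i phi : test_function Omega phi ->
  {ae mu, forall x, Omega x -> wderiv Omega i phi x = pderiv i phi x}.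
Proof.
move=> tphi; have [Lw ww] := wderivP i (test_H1 tphi).
have td := test_function_pderiv i tphi.
have := du_bois_reymond oO (w := fun x => wderiv Omega i phi x - pderiv i phi x).
have iw := L2_integrable Lw; have id := L2_integrable (test_L2 td).
move=> /(_ (integrableB mO iw id)) h.
suff : {ae mu, forall x, Omega x -> wderiv Omega i phi x - pderiv i phi x = 0}.
  by apply: filterS => x hx /hx /eqP; rewrite subr_eq0 => /eqP.
apply: h => psi tpsi.
under eq_Rintegral do rewrite mulrBl.
rewrite RintegralB//; last 2 first.
- by apply: L2_mul_integrable => //; exact: test_L2.
- by apply: L2_mul_integrable; exact: test_L2.
have := ww _ tpsi; rewrite (test_is_wderiv i tphi tpsi) => /oppr_inj ->.
by rewrite subrr.
Qed.

Lemma test_H10 phi : test_function Omega phi -> H10 Omega phi.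
Proof.
move=> tphi; split; first exact: test_H1.
exists (fun=> phi); split => //.
have -> : (fun n : nat => \int[mu]_(x in Omega) ((phi x - phi x) ^+ 2 +
    \sum_(i < d) (wderiv Omega i phi x - pderiv i phi x) ^+ 2)%:E)%E = cst 0%E; last exact: cvg_cst.
apply/funext => k; rewrite /= -(integral0 mu Omega); apply: ae_eq_integral => //.
- apply/measurable_EFinP; apply: measurable_funD.
    by apply: measurable_funX; apply: measurable_funB; exact: test_measurable.
  apply: measurable_sum => i; apply: measurable_funX; apply: measurable_funB.
    by have [[]] := wderivP i (test_H1 tphi).
  by apply: test_measurable; exact: test_function_pderiv.
- have h : {ae mu, forall x, forall i : 'I_d, Omega x -> wderiv Omega i phi x = pderiv i phi x}.
    by apply: filter_forall => i; exact: wderiv_test.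
  apply: filterS h => x h Ox; rewrite subrr expr0n add0r big1// => i _.
  by rewrite h// subrr expr0n.
Qed.

Definition single (i : 'I_d) phi : 'I_d -> 'rV[R]_d -> R :=
  fun k => if k == i then phi else (fun=> 0).

Lemma single_H10v i phi : test_function Omega phi -> H10v Omega (single i phi).
Proof.
move=> tphi k; rewrite /single; case: eqP => _; first exact: test_H10.
by apply: test_H10; exact: test_function0.
Qed.

Let ae_wderiv_single i phi : test_function Omega phi ->
  {ae mu, forall x, forall k j : 'I_d, Omega x ->
    wderiv Omega j (single i phi k) x = if k == i then pderiv j phi x else 0}.
Proof.
move=> tphi; apply: filter_forall => k; apply: filter_forall => j.
rewrite /single; case: eqP => _; first exact: wderiv_test.
have := wderiv_test j (test_function0 Omega).
by apply: filterS => x h /h ->; rewrite pderiv_cst.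
Qed.

Let measurable_wderiv j v : H1 Omega v -> measurable_fun Omega (wderiv Omega j v).
Proof. by move=> hv; have [[]] := wderivP j hv. Qed.

Let L2_dtest j phi : test_function Omega phi -> L2 Omega (pderiv j phi).
Proof. by move=> t; apply: test_L2; exact: test_function_pderiv. Qed.

Lemma form_a_single i phi (y : 'I_d -> 'rV[R]_d -> R) : H10v Omega y ->
  test_function Omega phi ->
  form_a Omega y (single i phi) = - \int[mu]_(x in Omega) (y i x * laplacian phi x).
Proof.
move=> Hy tphi.
have H1y k : H1 Omega (y k) by case: (Hy k).
have H1s k : H1 Omega (single i phi k) by case: (single_H10v i tphi k).
have -> : form_a Omega y (single i phi) =
    \int[mu]_(x in Omega) (\sum_(j < d) wderiv Omega j (y i) x * pderiv j phi x).
  apply: ae_eq_Rintegral.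
  - apply: measurable_sum => k; apply: measurable_sum => j.
    by apply: measurable_funM; apply: measurable_wderiv.
  - apply: measurable_sum => j; apply: measurable_funM; first exact: measurable_wderiv.
    by have [] := L2_dtest j tphi.
  - apply: filterS (ae_wderiv_single i tphi) => x h Ox.
    rewrite (bigD1 i)//= [X in _ + X]big1 ?addr0 => [|k /negbTE ki].
      by apply: eq_bigr => j _; rewrite h// eqxx.
    by rewrite big1// => j _; rewrite h// ki mulr0.
have i1 j : mu.-integrable Omega (EFin \o (fun x => wderiv Omega j (y i) x * pderiv j phi x)).
  by apply: L2_mul_integrable; [case: (wderivP j (H1y i))|exact: L2_dtest].
have i2 j : mu.-integrable Omega (EFin \o (fun x => y i x * pderiv j (pderiv j phi) x)).
  apply: L2_mul_integrable; first by case: (H1y i).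
  by apply: L2_dtest; exact: test_function_pderiv.
rewrite (Rintegral_sum _ mO i1).2.
have -> : \int[mu]_(x in Omega) (y i x * laplacian phi x) =
    \int[mu]_(x in Omega) (\sum_(j < d) y i x * pderiv j (pderiv j phi) x).
  by apply: eq_Rintegral => x _; rewrite mulr_sumr.
rewrite (Rintegral_sum _ mO i2).2 -sumrN; apply: eq_bigr => j _.
have [_ /(_ _ (test_function_pderiv j tphi)) ->] := wderivP j (H1y i).
by rewrite opprK.
Qed.

Lemma form_b_single i phi q : L2 Omega q -> test_function Omega phi ->
  form_b Omega (single i phi) q = - \int[mu]_(x in Omega) (q x * pderiv i phi x).
Proof.
move=> [mq _] tphi; congr (- _).
have H1s k : H1 Omega (single i phi k) by case: (single_H10v i tphi k).
apply: ae_eq_Rintegral.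
- apply: measurable_funM => //; apply: measurable_sum => k; exact: measurable_wderiv.
- by apply: measurable_funM => //; have [] := L2_dtest i tphi.
- apply: filterS (ae_wderiv_single i tphi) => x h Ox; congr (_ * _).
  rewrite (bigD1 i)//= big1 ?addr0 => [|k /negbTE ki]; first by rewrite h// eqxx.
  by rewrite h// ki.
Qed.

Lemma L2_dot_single i phi (f : 'I_d -> 'rV[R]_d -> R) :
  L2_dot Omega f (single i phi) = \int[mu]_(x in Omega) (f i x * phi x).
Proof.
apply: eq_Rintegral => x _; rewrite (bigD1 i)//= big1 ?addr0 => [|k /negbTE ki].
  by rewrite /single eqxx.
by rewrite /single ki mulr0.
Qed.

(** With all derivatives on [phi], only the values of [y] and [p] enter, so maximum norm errors can
    be inserted directly. *)
Lemma stokes_momentum (f y : 'I_d -> 'rV[R]_d -> R) (p : 'rV[R]_d -> R) i phi :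
  stokes_solution Omega (H10v Omega) (L2_0 Omega) f y p -> test_function Omega phi ->
  \int[mu]_(x in Omega) (y i x * laplacian phi x) +
  \int[mu]_(x in Omega) (p x * pderiv i phi x) = - \int[mu]_(x in Omega) (f i x * phi x).
Proof.
move=> [Hy [Lp _] eq _] tphi; have := eq _ (single_H10v i tphi).
rewrite form_a_single// form_b_single// L2_dot_single => <-.
by rewrite opprD !opprK.
Qed.

Lemma leb_setT_gt0 : (0 < mu [set: 'rV[R]_d])%E.
Proof.
apply: (@lt_le_trans _ _ (mu (cube 0 1))).
  by rewrite leb_cube// lte_fin exprn_gt0// mulr1.
by apply: le_measure; rewrite ?inE//; exact: measurable_cube.
Qed.

Lemma Linf_norm_ae (D : set 'rV[R]_d) g (M : R) : (Linf_norm D g <= M%:E)%E ->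
  {ae mu, forall x, D x -> `|g x| <= M}.
Proof.
(* Unfolding the norm leaves a case distinction on the measure of the whole space, settled by
   [leb_setT_gt0]. *)
rewrite /Linf_norm unlock leb_setT_gt0 => h.
have := ess_sup_ge mu (abse \o (EFin \o (g \_ D))).
apply: filterS => x hx Dx; have := le_trans hx h.
by rewrite /= patchE mem_set// lee_fin.
Qed.

Lemma Linf_norm_le (D : set 'rV[R]_d) g (M : R) : 0 <= M ->
  {ae mu, forall x, D x -> `|g x| <= M} -> (Linf_norm D g <= M%:E)%E.
Proof.
move=> M0 h; rewrite /Linf_norm unlock leb_setT_gt0; apply/ess_supP.
apply: filterS h => x hx; rewrite /= patchE; case: ifPn => [|_].
  by rewrite inE => /hx; rewrite lee_fin.
by rewrite normr0 lee_fin.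
Qed.

Lemma Linf_L2 g : Linf Omega g -> L2 Omega g.
Proof.
move=> [mg fg]; split => //.
have g0 : (0 <= Linf_norm Omega g)%E by exact: Lnorm_ge0.
have gM : (Linf_norm Omega g <= (fine (Linf_norm Omega g))%:E)%E.
  by rewrite fineK// ge0_fin_numE.
set M := fine _ in gM; have hM := Linf_norm_ae gM.
apply: (@le_lt_trans _ _ (\int[mu]_(x in Omega) (M ^+ 2)%:E)%E).
  apply: ae_ge0_le_integral => //.
  - by move=> x _; rewrite lee_fin sqr_ge0.
  - by apply/measurable_EFinP; exact: measurable_funX.
  - by move=> x _; rewrite lee_fin sqr_ge0.
  - apply: filterS hM => x hx Ox; rewrite lee_fin -real_normK ?num_real//.
    by rewrite ler_pXn2r ?nnegrE// ?hx// (le_trans _ (hx Ox)).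
rewrite integral_cst//; have := leb_bounded_lty.
by rewrite -ge0_fin_numE// => /fineK <-; rewrite -EFinM ltry.
Qed.

(** A substitute for the Cauchy-Schwarz inequality: once the squared error has integral below
    [e ^+ 2], both terms integrate to a multiple of [e]. *)
Let young (t e : R) : 0 < e -> `|t| <= e + e^-1 * t ^+ 2.
Proof.
move=> e0; have [h|h] := leP `|t| e.
  by rewrite ler_wpDr// mulr_ge0 ?sqr_ge0// invr_ge0 ltW.
apply: ler_wpDl; first exact: ltW.
rewrite ler_pdivlMl// -real_normK ?num_real// expr2.
by rewrite ler_wpM2r// ltW.
Qed.

(* Passage to the limit from the test functions, whose derivatives have zero mean. *)
Lemma H10_mean_wderiv i v : H10 Omega v -> \int[mu]_(x in Omega) wderiv Omega i v x = 0.
Proof.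
move=> [H1v [phi [tphi cv]]].
have Lw j : L2 Omega (wderiv Omega j v) by case: (wderivP j H1v).
have Lv : L2 Omega v by case: H1v.
have iw := L2_integrable (Lw i).
pose V := fine (mu Omega); have V0 : 0 <= V by exact: fine_ge0.
suff h e : 0 < e -> `|\int[mu]_(x in Omega) wderiv Omega i v x| <= e * (V + 1).
  apply/eqP; rewrite -normr_le0; apply/ler_addgt0Pl => e e0; rewrite addr0.
  have V1 : 0 < V + 1 by rewrite ltr_wpDl.
  by have := h (e / (V + 1)) (divr_gt0 e0 V1); rewrite divfK ?gt_eqF.
move=> e0.
have e20 : 0 < e ^+ 2 by exact: exprn_gt0.
pose G n x := (v x - phi n x) ^+ 2 + \sum_(i < d) (wderiv Omega i v x - pderiv i (phi n) x) ^+ 2.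
have : \forall n \near \oo, (\int[mu]_(x in Omega) (G n x)%:E < (e ^+ 2)%:E)%E.
  have oe : open [set y : \bar R | (y < (e ^+ 2)%:E)%E] by exact: open_ereal_lt_ereal.
  have n0 : nbhs 0%E [set y : \bar R | (y < (e ^+ 2)%:E)%E].
    by apply: open_nbhs_nbhs; split => //=; rewrite lte_fin.
  exact: (cv _ n0).
move=> [n _ /(_ n (leqnn n)) /= hn].
have Ld j : L2 Omega (pderiv j (phi n)) by exact: L2_dtest.
have id := L2_integrable (Ld i).
have d0 : \int[mu]_(x in Omega) pderiv i (phi n) x = 0.
  have [b b0 Ob] := bounded_sub_cube.
  have t0 x : ~ Omega x -> pderiv i (phi n) x = 0.
    by apply: test_function_eq0; exact: test_function_pderiv.
  rewrite (Rintegral_set_support t0).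
  have [/(_ 1%N) C1 _ _] := tphi n.
  apply: (@Rintegral_pderiv _ _ i _ 0 b b0 C1) => x nx.
  by apply: (test_function_eq0 (tphi n)) => /Ob.
rewrite -[X in `|X|]subr0 -d0 -RintegralB//.
apply: (le_trans (le_normr_Rintegral mO (integrableB mO iw id))).
have G0 x : 0 <= G n x by rewrite addr_ge0 ?sqr_ge0// sumr_ge0// => j _; rewrite sqr_ge0.
have mG : measurable_fun Omega (G n).
  apply: measurable_funD.
    apply: measurable_funX; apply: measurable_funB; first by case: Lv.
    exact: test_measurable.
  apply: measurable_sum => j; apply: measurable_funX; apply: measurable_funB.
    by case: (Lw j).
  by case: (Ld j).
have iG : mu.-integrable Omega (EFin \o G n).
  apply/integrableP; split; first exact/measurable_EFinP.
  under eq_integral do rewrite /= ger0_norm//.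
  by apply: lt_trans hn _; rewrite ltry.
have ic : mu.-integrable Omega (EFin \o (fun=> e : R)).
  by apply: L2_integrable; apply: (@bounded_L2 _ e) => // x; rewrite ger0_norm// ltW.
have ieG : mu.-integrable Omega (EFin \o (fun x => e^-1 * G n x)).
  by have := integrableZl mO e^-1 iG.
apply: (@le_trans _ _ (\int[mu]_(x in Omega) (e + e^-1 * G n x))).
  apply: le_Rintegral => //.
  - by apply: integrable_norm; exact: (integrableB mO iw id).
  - exact: (integrableD mO ic ieG).
  - move=> x _; apply: le_trans (young _ e0) _; rewrite lerD2l ler_wpM2l//.
      by rewrite invr_ge0 ltW.
    rewrite /G (bigD1 i)//= addrCA lerDl addr_ge0 ?sqr_ge0// sumr_ge0// => j _.
    exact: sqr_ge0.
rewrite (RintegralD mO ic ieG) Rintegral_cst// RintegralZl// mulrDr mulr1 lerD2l.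
rewrite ler_pdivrMl// -expr2 /Rintegral -lee_fin fineK; first exact: ltW.
exact: integrable_fin_num.
Qed.

Lemma leb_open_gt0 : Omega !=set0 -> (0 < mu Omega)%E.
Proof.
move=> [x Ox]; have [r r0 xrO] := nbhs_cube (open_nbhs_nbhs (conj oO Ox)).
apply: (@lt_le_trans _ _ (mu (cube x r))).
  by rewrite leb_cube ?ltW// lte_fin exprn_gt0// mulr_gt0.
by apply: le_measure; rewrite ?inE//; exact: measurable_cube.
Qed.

(** A test function need not have zero mean and so is not an admissible pressure. Its mean [m] is
    subtracted, at no cost because the divergence of a field in [H10v] integrates to zero. *)
Lemma stokes_div (f y : 'I_d -> 'rV[R]_d -> R) (p : 'rV[R]_d -> R) phi :
  Omega !=set0 ->
  stokes_solution Omega (H10v Omega) (L2_0 Omega) f y p -> test_function Omega phi ->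
  \sum_i \int[mu]_(x in Omega) (y i x * pderiv i phi x) = 0.
Proof.
move=> O0 [Hy _ _ eq0] tphi.
pose V := fine (mu Omega).
have V0 : 0 < V.
  by rewrite fine_gt0// leb_open_gt0//= leb_bounded_lty.
pose m := (\int[mu]_(x in Omega) phi x) / V.
have Lphi := test_L2 tphi; have iphi := L2_integrable Lphi.
have Lm : L2 Omega (fun=> m) by apply: (@bounded_L2 _ `|m|).
have im := L2_integrable Lm.
have H1y i : H1 Omega (y i) by case: (Hy i).
have Lw i : L2 Omega (wderiv Omega i (y i)) by case: (wderivP i (H1y i)).
have Lq : L2 Omega (fun x => phi x - m).
  have [M _ hM] := test_function_bounded tphi.
  apply: (@bounded_L2 _ (M + `|m|)).
    by apply: measurable_funB => //; exact: test_measurable.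
  by move=> x; apply: le_trans (ler_normB _ _) _; rewrite lerD2r.
have L0q : L2_0 Omega (fun x => phi x - m).
  split => //; rewrite RintegralB// Rintegral_cst// -/V /m divfK ?subrr//.
  by rewrite gt_eqF.
have i1 i : mu.-integrable Omega (EFin \o (fun x => (phi x - m) * wderiv Omega i (y i) x)).
  exact: L2_mul_integrable.
have := eq0 _ L0q; rewrite /form_b => /eqP; rewrite oppr_eq0 => /eqP.
under eq_Rintegral do rewrite mulr_sumr.
rewrite (Rintegral_sum _ mO i1).2 => h.
rewrite -[RHS]oppr0 -[X in _ = - X]h -sumrN; apply: eq_bigr => i _.
have [_ ww] := wderivP i (H1y i); rewrite (ww _ tphi); congr (- _).
have -> : \int[mu]_(x in Omega) ((phi x - m) * wderiv Omega i (y i) x) =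
    \int[mu]_(x in Omega) (wderiv Omega i (y i) x * phi x - m * wderiv Omega i (y i) x).
  by apply: eq_Rintegral => x _; rewrite mulrBl mulrC.
have i2 : mu.-integrable Omega (EFin \o (fun x => wderiv Omega i (y i) x * phi x)).
  exact: L2_mul_integrable.
have i3 : mu.-integrable Omega (EFin \o (fun x => m * wderiv Omega i (y i) x)).
  exact: L2_mul_integrable.
rewrite (RintegralB mO i2 i3) RintegralZl//; last exact: L2_integrable.
by rewrite (H10_mean_wderiv i (Hy i)) mulr0 subr0.
Qed.

End weak_formulation.

(** * Simplices and their sides *)

Section affine_theory.
Context {R : realType} {d : nat}.
Implicit Types (g : 'rV[R]_d -> R) (x v : 'rV[R]_d).

Lemma dotp_sumr (I : Type) (s : seq I) (F : I -> 'rV[R]_d) x :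
  dotp x (\sum_(i <- s) F i) = \sum_(i <- s) dotp x (F i).
Proof.
apply: (big_morph (dotp x)) => [u v|]; first exact: dotpDr.
by rewrite /dotp big1// => i _; rewrite mxE mulr0.
Qed.

Lemma affine_comb g (s : seq 'rV[R]_d) (w : 'rV[R]_d -> R) : affine g ->
  \sum_(v <- s) w v = 1 -> g (\sum_(v <- s) w v *: v) = \sum_(v <- s) w v * g v.
Proof.
move=> [a [b gE]] w1; rewrite gE.
have -> : dotp b (\sum_(v <- s) w v *: v) = \sum_(v <- s) w v * dotp b v.
  by rewrite dotp_sumr; apply: eq_bigr => v _; rewrite dotpZr.
under [RHS]eq_bigr do rewrite gE mulrDr.
by rewrite big_split/= -mulr_suml w1 mul1r.
Qed.

Lemma affine_line g x v (t : R) : affine g -> g (x + t *: v) = g x + t * (g (x + v) - g x).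
Proof. by move=> [a [b gE]]; rewrite !gE !dotpDr dotpZr; ring. Qed.

Lemma affine_mid g x v : affine g -> g (2^-1 *: (x + v)) = 2^-1 * (g x + g v).
Proof. by move=> [a [b gE]]; rewrite !gE dotpZr dotpDr; field. Qed.

Lemma affineD g h : affine g -> affine h -> affine (fun x => g x + h x).
Proof.
move=> [a [b gE]] [a' [b' hE]]; exists (a + a'), (b + b') => x.
by rewrite gE hE dotpDl; ring.
Qed.

Lemma affineZ g (k : R) : affine g -> affine (fun x => k * g x).
Proof. by move=> [a [b gE]]; exists (k * a), (k *: b) => x; rewrite gE dotpZl; ring. Qed.

Lemma affine_cst (k : R) : affine (fun _ : 'rV[R]_d => k).
Proof.
by exists k, 0 => x; rewrite /dotp big1 ?addr0// => i _; rewrite mxE mul0r.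
Qed.

Lemma affine_sum n (F : 'I_n -> 'rV[R]_d -> R) : (forall i, affine (F i)) ->
  affine (fun x => \sum_i F i x).
Proof.
move=> aF; elim: n F aF => [|n ih] F aF.
  by under eq_fun do rewrite big_ord0; exact: affine_cst.
under eq_fun do rewrite big_ord_recl.
by apply: affineD => //; exact: ih.
Qed.

End affine_theory.

Section barycentric.
Context {R : realType} {d : nat}.
Local Notation simplex := {fset 'rV[R]_d}.
Implicit Types (T S : simplex) (x v u : 'rV[R]_d).

Definition barycentric T (mu : 'rV[R]_d -> 'rV[R]_d -> R) : Prop :=
  [/\ forall v, affine (mu v),
      forall v u, v \in T -> u \in T -> mu v u = (v == u)%:R,
      forall x, \sum_(v <- T) mu v x = 1 &
      forall x, \sum_(v <- T) mu v x *: v = x].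

Lemma sum_fset_nth (V : nmodType) T n (F : 'rV[R]_d -> V) : #|` T| = n ->
  \sum_(v <- T) F v = \sum_(i < n) F (nth 0 T i).
Proof. by move=> Tn; rewrite (big_nth 0) big_mkord Tn. Qed.

(** Affine independence is the invertibility of the matrix whose rows are the vertices with a 1
    attached; the coordinates of [x] are read off by applying the inverse to the row of [x]. *)
Lemma exists_barycentric T : is_simplex T -> exists mu, barycentric T mu.
Proof.
move=> [cT indT].
pose s : seq 'rV[R]_d := enum_fset T.
have us : uniq s by exact: fset_uniq.
have ss : size s = d.+1 by [].
pose A : 'M[R]_d.+1 := \matrix_i row_cons (nth 0 s i, 1).
have rowA (i : 'I_d.+1) : row i A = row_cons (nth 0 s i, 1) by rewrite rowK.
have mulA (w : 'rV[R]_d.+1) : w *m A = \row_j (\sum_i w ord0 i * A i j).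
  by apply/rowP => j; rewrite !mxE.
have A0 i : A i ord0 = 1 by rewrite mxE row_cons0.
have AS i j : A i (lift ord0 j) = nth 0 s i ord0 j by rewrite mxE row_consS.
have uA : A \in unitmx.
  rewrite -row_free_unit; apply: inj_row_free => w wA.
  (* A vector of the left kernel, read as a weight on the vertices, is an affine dependency. *)
  pose W v := w ord0 (inord (index v s)).
  have WE (i : 'I_d.+1) : W (nth 0 s i) = w ord0 i.
    by rewrite /W index_uniq ?ss ?inord_val.
  have W1 : \sum_(v <- T) W v = 0.
    rewrite (sum_fset_nth _ cT); have := congr1 (fun z : 'rV[R]_d.+1 => z ord0 ord0) wA.
    rewrite /= mulA 2!mxE => h; rewrite -[RHS]h; apply: eq_bigr => i _.
    by rewrite WE A0 mulr1.
  have W2 : \sum_(v <- T) W v *: v = 0.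
    rewrite (sum_fset_nth _ cT); apply/rowP => j.
    have := congr1 (fun z : 'rV[R]_d.+1 => z ord0 (lift ord0 j)) wA.
    rewrite /= mulA 2!mxE => h; rewrite summxE mxE -[RHS]h; apply: eq_bigr => i _.
    by rewrite mxE WE AS.
  apply/rowP => i; rewrite mxE -WE; apply: (indT W W1 W2).
  by rewrite -/s mem_nth// ss.
pose B := invmx A.
pose mu v x := (row_cons (x, 1) *m B) ord0 (inord (index v s)).
have muE x (i : 'I_d.+1) : mu (nth 0 s i) x = (row_cons (x, 1) *m B) ord0 i.
  by rewrite /mu index_uniq ?ss ?inord_val.
have BA x : row_cons (x, 1) *m B *m A = row_cons (x, 1) by rewrite mulmxKV.
exists mu; split.
- move=> v; exists (B ord0 (inord (index v s))), (\row_j B (lift ord0 j) (inord (index v s))) => x.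
  rewrite /mu mxE big_ord_recl row_cons0/= mul1r; congr +%R.
  by apply: eq_bigr => j _; rewrite row_consS !mxE mulrC.
- move=> v u vT uT.
  have ius : (index u s < d.+1)%N by rewrite -ss index_mem.
  have uA' : row_cons (u, 1) = row (Ordinal ius) A by rewrite rowA nth_index.
  rewrite /mu uA' -row_mul mulmxV// !mxE -val_eqE/= inordK; last by rewrite -ss index_mem.
  congr (nat_of_bool _)%:R; apply/eqP/eqP => [|->//] h.
  by rewrite -(nth_index 0 vT) -(nth_index 0 uT) -h.
- move=> x; rewrite (sum_fset_nth _ cT).
  have := congr1 (fun z : 'rV[R]_d.+1 => z ord0 ord0) (BA x).
  rewrite /= mulA row_cons0 mxE => h; rewrite -[RHS]h; apply: eq_bigr => i _.
  by rewrite muE A0 mulr1.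
- move=> x; rewrite (sum_fset_nth _ cT); apply/rowP => j.
  have := congr1 (fun z : 'rV[R]_d.+1 => z ord0 (lift ord0 j)) (BA x).
  rewrite /= mulA row_consS mxE => h; rewrite summxE -[RHS]h; apply: eq_bigr => i _.
  by rewrite mxE muE AS.
Qed.

Lemma conv_hullP T mu x : barycentric T mu ->
  conv_hull T x <-> forall v, v \in T -> 0 <= mu v x.
Proof.
move=> [amu dmu s1 sx]; split => [[w [w0 w1 ->]] v vT|h]; last first.
  by exists (mu^~ x); split => //; rewrite sx.
rewrite (affine_comb _ w1)// big_seq sumr_ge0// => u uT.
by rewrite mulr_ge0 ?w0// dmu.
Qed.

Lemma sub_conv_hull T S : (S `<=` T)%fset -> conv_hull S `<=` conv_hull T.
Proof.
move=> /fsubsetP ST x [w [w0 w1 ->]].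
pose w' v := if v \in S then w v else 0.
have e (V : zmodType) (F : 'rV[R]_d -> V) : \sum_(v <- T) (if v \in S then F v else 0) = \sum_(v <- S) F v.
  rewrite -big_mkcond/= -big_filter; apply: perm_big; apply: uniq_perm.
  - by rewrite filter_uniq// fset_uniq.
  - exact: fset_uniq.
  move=> v; rewrite mem_filter; apply/andP/idP => [[]//|vS]; by split => //; exact: ST.
exists w'; split.
- by move=> v _; rewrite /w'; case: ifP => // /w0.
- by rewrite (e _ w).
- rewrite -(e _ (fun v => w v *: v)); apply: eq_bigr => v _; rewrite /w'.
  by case: ifP => //; rewrite scale0r.
Qed.

Lemma vertex_conv_hull T v : v \in T -> conv_hull T v.
Proof.
move=> vT; exists (fun u => (u == v)%:R); split => //.
- rewrite (big_fsetD1 v)//= eqxx big_seq big1 ?addr0// => u; rewrite !inE => /andP[/negbTE -> _].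
  by [].
- rewrite (big_fsetD1 v)//= eqxx scale1r big_seq big1 ?addr0// => u; rewrite !inE => /andP[/negbTE -> _].
  by rewrite scale0r.
Qed.

Lemma barycentric_le1 T mu x v : barycentric T mu -> v \in T -> conv_hull T x -> mu v x <= 1.
Proof.
move=> bT vT /(conv_hullP _ bT) h; have [_ _ s1 _] := bT.
rewrite -(s1 x) (big_fsetD1 v)//= lerDl big_seq sumr_ge0// => u.
by rewrite !inE => /andP[_ /h].
Qed.

Lemma face_barycentric0 T S mu x v : barycentric T mu -> (S `<=` T)%fset ->
  v \in T -> v \notin S -> conv_hull S x -> mu v x = 0.
Proof.
move=> [amu dmu _ _] /fsubsetP ST vT vS [w [w0 w1 ->]].
rewrite (affine_comb _ w1)// big_seq big1// => u uS.
rewrite dmu ?(ST u)//; case: eqP => [vu|_]; last by rewrite mulr0.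
by rewrite vu uS in vS.
Qed.

(** On a ball inside [T] the coordinate stays between 0 and 1, and an affine function varies most
    between opposite points of a ball. Hence the gradient has length at most the inverse of
    [inball_diam]. *)
Lemma inball_barycentric T mu v x w : barycentric T mu -> v \in T ->
  0 < inball_diam (conv_hull T) ->
  inball_diam (conv_hull T) * `|mu v (x + w) - mu v x| <= enorm w.
Proof.
move=> bT vT i0; have [amu _ _ _] := bT; have [a [b muE]] := amu v.
have -> : mu v (x + w) - mu v x = dotp b w by rewrite !muE dotpDr; ring.
have [->|w0] := eqVneq w 0.
  rewrite (_ : dotp b 0 = 0) ?normr0 ?mulr0 ?enorm_ge0//.
  by rewrite /dotp big1// => i _; rewrite mxE mulr0.
have nw : 0 < enorm w by rewrite lt_neqAle enorm_ge0 andbT eq_sym enorm_eq0.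
have [->|bw0] := eqVneq (dotp b w) 0; first by rewrite normr0 mulr0 ltW.
have nb : 0 < `|dotp b w| by rewrite normr_gt0.
rewrite -ler_pdivlMr//; apply: ge_sup.
  (* The supremum of an empty set is 0 by default, which [i0] excludes. *)
  by apply: contrapT => /set0P/negP/negPn/eqP h; move: i0; rewrite /inball_diam h sup0 ltxx.
move=> _ [r [r0 [c hc]] <-]; rewrite ler_pdivlMr//.
have key (k : R) : `|k| = 1 -> 2 * r * (k * dotp b w) <= enorm w.
  move=> k1; pose z := (k * r / enorm w) *: w.
  have nz : enorm z = r.
    rewrite /z enormZ !normrM k1 mul1r (ger0_norm r0) normfV (gtr0_norm nw) divfK// gt_eqF//.
  have h1 : conv_hull T (c + z) by apply: hc; rewrite /= addrAC subrr add0r nz.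
  have h2 : conv_hull T (c - z) by apply: hc; rewrite /= addrAC subrr add0r enormN nz.
  have g1 := barycentric_le1 bT vT h1.
  have g2 := (conv_hullP _ bT).1 h2 v vT.
  have : mu v (c + z) - mu v (c - z) <= 1 by lra.
  have -> : mu v (c + z) - mu v (c - z) = 2 * r * (k * dotp b w) / enorm w.
    rewrite !muE !dotpDr dotpNr /z dotpZr; field.
    by rewrite gt_eqF.
  by rewrite ler_pdivrMr// mul1r.
have [h|h] := lerP 0 (dotp b w).
  by rewrite ger0_norm//; have := key 1; rewrite normr1 mul1r => /(_ erefl).
by rewrite ltr0_norm//; have := key (- 1); rewrite normrN normr1 mulN1r => /(_ erefl).
Qed.

Lemma conv_hull_coord_bounded T : exists2 M : R, 0 <= M & forall x i, conv_hull T x -> `|x ord0 i| <= M.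
Proof.
exists (\sum_(v <- T) \sum_i `|v ord0 i|); first by do 2 (apply: sumr_ge0 => ? _).
move=> x i [w [w0 w1 ->]]; rewrite summxE; apply: le_trans (ler_norm_sum _ _ _) _.
rewrite big_seq [leRHS]big_seq; apply: ler_sum => v vT; rewrite mxE normrM.
have wv1 : `|w v| <= 1.
  rewrite ger0_norm ?w0// -w1 (big_fsetD1 v)//= lerDl big_seq sumr_ge0// => u.
  by rewrite !inE => /andP[_ /w0].
apply: (@le_trans _ _ `|v ord0 i|); first by rewrite ler_piMl.
by rewrite (bigD1 i)//= lerDl sumr_ge0.
Qed.

Lemma enorm_le_mesh_size T x y : conv_hull T x -> conv_hull T y -> enorm (x - y) <= mesh_size T.
Proof.
move=> Tx Ty; apply: ub_le_sup; last by exists (x, y).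
have [M M0 hM] := conv_hull_coord_bounded T.
exists (\sum_(i < d) (M + M)) => _ [[u v] [/= Tu Tv] <-].
apply: le_trans (enorm_le_sum _) _; apply: ler_sum => i _; rewrite !mxE.
by apply: le_trans (ler_normB _ _) _; apply: lerD; exact: hM.
Qed.

(** Along the edge the coordinate of [u] rises from 0 to 1, with the slope bounded by
    [inball_barycentric]. *)
Lemma inball_le_edge T u v : is_simplex T -> u \in T -> v \in T -> u != v ->
  0 < inball_diam (conv_hull T) -> inball_diam (conv_hull T) <= enorm (u - v).
Proof.
move=> sT uT vT uv i0; have [mu bT] := exists_barycentric sT.
have [_ dmu _ _] := bT.
have := @inball_barycentric T mu u v (u - v) bT uT i0.
rewrite (_ : v + (u - v) = u); last by rewrite addrC subrK.
by rewrite !dmu// eqxx (negbTE uv) subr0 normr1 mulr1.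
Qed.

(** The Euclidean radius of the cube is at most [d%:R * rho], too short for the coordinate to drop
    from [be] below 0. *)
Lemma cube_barycentric T mu v c (be rho : R) x : barycentric T mu -> v \in T ->
  0 < inball_diam (conv_hull T) -> be <= mu v c ->
  d%:R * rho <= be * inball_diam (conv_hull T) -> cube c rho x -> 0 <= mu v x.
Proof.
move=> bT vT i0 bc h cx.
have := @inball_barycentric T mu v c (x - c) bT vT i0.
rewrite (addrC c) subrK.
have : enorm (x - c) <= d%:R * rho.
  apply: le_trans (enorm_le_sum _) _.
  have -> : d%:R * rho = \sum_(i < d) rho by rewrite sumr_const card_ord mulr_natl.
  by apply: ler_sum => i _; rewrite !mxE; exact: cx.
move=> h1 h2; have h3 := le_trans h2 (le_trans h1 h).
move: h3; rewrite mulrC ler_pM2r// ler_norml => /andP[h4 _]; lra.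
Qed.

End barycentric.

Section test_points.
Context {R : realType} {d : nat}.
Local Notation simplex := {fset 'rV[R]_d}.
Implicit Types (T S U : simplex) (x v u : 'rV[R]_d).

Definition barycenter U : 'rV[R]_d := (#|` U|%:R)^-1 *: \sum_(v <- U) v.

(* Points well inside the simplex, at which affine functions are determined. *)
Definition test_points U : seq 'rV[R]_d :=
  barycenter U :: [seq 2^-1 *: (barycenter U + v) | v <- enum_fset U].

Lemma affine_barycenter g U : affine g -> U != fset0 ->
  g (barycenter U) = (#|` U|%:R)^-1 * \sum_(v <- U) g v.
Proof.
move=> ag U0.
have c0 : (#|` U|%:R : R) != 0 by rewrite pnatr_eq0 cardfs_eq0.
rewrite /barycenter scaler_sumr mulr_sumr.
apply: (@affine_comb _ _ g U (fun=> (#|` U|%:R)^-1) ag).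
by rewrite big_const_seq count_predT iter_addr_0 -[X in X = _]mulr_natr mulVf.
Qed.

(** The value at a vertex is twice that at the midpoint with the barycenter, minus that at the
    barycenter: this is the factor 3. Elsewhere the value is a convex combination. *)
Lemma test_points_bound g U (M : R) x : affine g -> U != fset0 ->
  (forall c, c \in test_points U -> `|g c| <= M) -> conv_hull U x -> `|g x| <= 3 * M.
Proof.
move=> ag U0 gM [w [w0 w1 ->]]; rewrite (affine_comb ag w1).
have gv v : v \in U -> `|g v| <= 3 * M.
  move=> vU; have h0 := gM _ (mem_head _ _).
  have h1 : `|g (2^-1 *: (barycenter U + v))| <= M.
    by apply: gM; rewrite inE; apply/orP; right; apply/mapP; exists v.
  rewrite affine_mid// in h1.
  have -> : g v = 2 * (2^-1 * (g (barycenter U) + g v)) - g (barycenter U) by field.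
  apply: le_trans (ler_normB _ _) _; rewrite normrM (ger0_norm (_ : 0 <= 2))//; lra.
apply: le_trans (ler_norm_sum _ _ _) _.
have -> : 3 * M = \sum_(v <- U) w v * (3 * M) by rewrite -mulr_suml w1 mul1r.
rewrite big_seq [leRHS]big_seq; apply: ler_sum => v vU.
by rewrite normrM (ger0_norm (w0 v vU)); apply: ler_wpM2l; [exact: w0|exact: gv].
Qed.

(** The coordinates equal [1 / #U] at the barycenter, and halving towards a vertex at worst halves
    them. [U] may be a face, with the coordinates of the whole simplex. *)
Lemma test_points_barycentric T U mu c u : barycentric T mu -> (U `<=` T)%fset ->
  U != fset0 -> c \in test_points U -> u \in U -> (2 * #|` U|%:R)^-1 <= mu u c.
Proof.
move=> [amu dmu _ _] /fsubsetP UT U0 cU uU.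
have c0 : 0 < (#|` U|%:R : R) by rewrite ltr0n lt0n cardfs_eq0.
have mb : mu u (barycenter U) = (#|` U|%:R)^-1.
  rewrite affine_barycenter// (big_fsetD1 u)//= dmu ?(UT u)// eqxx big_seq big1 ?addr0 ?mulr1//.
  by move=> v; rewrite !inE => /andP[vu vU]; rewrite dmu ?(UT u) ?(UT v)// eq_sym (negbTE vu).
have ci : 0 < (#|` U|%:R : R)^-1 by rewrite invr_gt0.
move: cU; rewrite inE => /orP[/eqP ->|/mapP[v vU ->]].
  by rewrite mb invfM; lra.
rewrite affine_mid// mb invfM ler_pM2l ?invr_gt0// lerDl dmu ?(UT u) ?(UT v)//.
Qed.

Lemma test_points_conv_hull U c : U != fset0 -> c \in test_points U -> conv_hull U c.
Proof.
move=> U0 cU.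
have c0 : (#|` U|%:R : R) != 0 by rewrite pnatr_eq0 cardfs_eq0.
have hb : conv_hull U (barycenter U).
  exists (fun=> (#|` U|%:R)^-1); split.
  - by move=> v _; rewrite invr_ge0.
  - by rewrite big_const_seq count_predT iter_addr_0 -[X in X = _]mulr_natr mulVf.
  - by rewrite /barycenter scaler_sumr.
move: cU; rewrite inE => /orP[/eqP ->//|/mapP[v vU ->]].
have [w [w0 w1 wx]] := hb; have [w' [w'0 w'1 w'x]] := vertex_conv_hull vU.
exists (fun u => 2^-1 * (w u + w' u)); split.
- by move=> u uU; rewrite mulr_ge0 ?invr_ge0// addr_ge0 ?w0 ?w'0.
- by rewrite -mulr_sumr big_split/= w1 w'1; field.
- rewrite {1}wx {1}w'x -big_split/= scaler_sumr; apply: eq_bigr => u _.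
  by rewrite -scalerDl scalerA.
Qed.

End test_points.

(** * Sides shared by two simplices *)

Section simplex_sides.
Context {R : realType} {d : nat}.
Local Notation simplex := {fset 'rV[R]_d}.
Implicit Types (T S : simplex) (x v u a c g nu : 'rV[R]_d).

(** [S] is the face of [T] opposite to the vertex [a]. *)
Definition side_of T S a := [/\ (S `<=` T)%fset, a \in T, a \notin S &
  forall v, v \in T -> v != a -> v \in S].

Lemma side_ofE T S a : side_of T S a -> T = (a |` S)%fset.
Proof.
move=> [/fsubsetP ST aT _ TS]; apply/fsetP => v; rewrite !inE.
by apply/idP/orP => [vT|[/eqP ->//|/ST//]]; case: eqVneq => [|/(TS _ vT)]; [left|right].
Qed.

Lemma big_side (V : nmodType) T S a (F : 'rV[R]_d -> V) : side_of T S a ->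
  \sum_(v <- T) F v = F a + \sum_(v <- S) F v.
Proof. by move=> Sa; rewrite (side_ofE Sa) big_fsetU1//; case: Sa. Qed.

Lemma exists_side_of T T' : #|` T| = d.+1 -> #|` (T `&` T')%fset| = d ->
  exists2 a, side_of T (T `&` T')%fset a & a \notin T'.
Proof.
move=> cT cS; have : #|` (T `\` T')%fset| == 1%N.
  by rewrite cardfsD cT cS subSnn.
move=> /cardfs1P[a TT'].
have aTT' : a \in (T `\` T')%fset by rewrite TT' inE.
move: aTT'; rewrite inE => /andP[aT' aT]; exists a => //; split => //.
- exact: fsubsetIl.
- by rewrite inE aT (negbTE aT').
- move=> v vT va; rewrite inE vT; apply: contraT => vT'.
  have : v \in (T `\` T')%fset by rewrite inE vT vT'.
  by rewrite TT' inE (negbTE va).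
Qed.

(* A covector annihilating the directions of the side is a multiple of the
   gradient of the barycentric coordinate of the opposite vertex. *)
Lemma tangential_dual T S mu a c g z : barycentric T mu -> side_of T S a ->
  (forall v, v \in S -> dotp g (v - c) = 0) ->
  dotp g z = (mu a (c + z) - mu a c) * dotp g (a - c).
Proof.
move=> [amu dmu s1 sx] Sa g0.
have zE : z = \sum_(v <- T) (mu v (c + z) - mu v c) *: (v - c).
  have -> : \sum_(v <- T) (mu v (c + z) - mu v c) *: (v - c) =
      (\sum_(v <- T) mu v (c + z) *: v - \sum_(v <- T) mu v c *: v) -
      (\sum_(v <- T) mu v (c + z) - \sum_(v <- T) mu v c) *: c.
    rewrite -!sumrB scaler_suml -sumrB; apply: eq_bigr => v _.
    by rewrite scalerBr -scalerBl.
  by rewrite !s1 !sx subrr scale0r subr0 addrAC subrr add0r.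
rewrite [in LHS]zE dotp_sumr (big_side _ Sa) dotpZr big_seq big1 ?addr0// => v vS.
by rewrite dotpZr g0 ?mulr0.
Qed.

(* Were [mu' a' a >= 0], a point of [T] slightly off the barycenter of the side
   towards [a] would lie in both simplices, but not on the side. *)
Lemma opposite_barycentric T T' S mu mu' a a' : (0 < d)%N ->
  barycentric T mu -> barycentric T' mu' -> side_of T S a -> side_of T' S a' ->
  #|` S| = d -> conv_hull T `&` conv_hull T' = conv_hull S ->
  mu' a' a < 0 /\ forall x, mu' a' x = mu a x * mu' a' a.
Proof.
move=> d0 bT bT' Sa Sa' cS TT'.
have [amu dmu s1 sx] := bT; have [amu' dmu' s1' sx'] := bT'.
have [/fsubsetP ST aT aS TS] := Sa; have [/fsubsetP ST' aT' aS' TS'] := Sa'.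
have main x : mu' a' x = mu a x * mu' a' a.
  rewrite -[in LHS](sx x) (affine_comb (amu' a') (s1 x)) (big_side _ Sa) big_seq big1 ?addr0//.
  move=> v vS; have va : a' == v = false by apply/eqP => a'v; rewrite a'v vS in aS'.
  by rewrite (dmu' _ _ aT' (ST' _ vS)) va mulr0.
split; last exact: main.
rewrite ltNge; apply/negP => k0.
have S0 : S != fset0 by rewrite -cardfs_eq0 cS -lt0n.
have [c cU] : exists c, c \in test_points S by exists (barycenter S); exact: mem_head.
pose be : R := (2 * #|` S|%:R)^-1.
have be0 : 0 < be by rewrite invr_gt0 mulr_gt0// ltr0n cS.
have hT v : v \in S -> be <= mu v c by move=> vS; apply: (test_points_barycentric bT) => //; apply/fsubsetP.
have hT' v : v \in S -> be <= mu' v c by move=> vS; apply: (test_points_barycentric bT') => //; apply/fsubsetP.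
(* [K] bounds the variation towards [a] of all coordinates of the side, so moving by the fraction
   [e] uses up at most [be]. *)
pose K := 1 + \sum_(v <- S) `|mu' v a - mu' v c|.
have K1 : 1 <= K by rewrite lerDl sumr_ge0.
have K0 : 0 < K by lra.
pose e := Num.min 1 (be / K).
have e0 : 0 < e by rewrite lt_min ltr01 divr_gt0.
have e1 : e <= 1 by rewrite ge_min lexx.
have eK : e * K <= be by rewrite -ler_pdivlMr// ge_min lexx orbT.
pose x := c + e *: (a - c).
have mux v : mu v x = mu v c + e * (mu v a - mu v c).
  by rewrite (affine_line _ _ _ (amu v)) (addrC c (a - c)) subrK.
have mux' v : mu' v x = mu' v c + e * (mu' v a - mu' v c).
  by rewrite (affine_line _ _ _ (amu' v)) (addrC c (a - c)) subrK.
have cS' : conv_hull S c by exact: test_points_conv_hull.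
have mac : mu a c = 0 by apply: (face_barycentric0 bT _ aT aS cS'); apply/fsubsetP.
have Tx : conv_hull T x.
  apply/(conv_hullP _ bT) => v vT; rewrite mux.
  have [->|va] := eqVneq v a; first by rewrite mac (dmu a a)// eqxx mulr1n; lra.
  have vS := TS v vT va; rewrite (dmu v a)// (negbTE va) mulr0n sub0r.
  have := hT v vS; nra.
have T'x : conv_hull T' x.
  apply/(conv_hullP _ bT') => v vT'.
  have [->|va] := eqVneq v a'.
    by rewrite main mux mac (dmu a a)// eqxx mulr1n mulr_ge0//; lra.
  have vS := TS' v vT' va; rewrite mux'.
  have h1 := hT' v vS.
  have h2 : `|mu' v a - mu' v c| <= K.
    rewrite /K (big_fsetD1 v)//= addrCA lerDl addr_ge0// sumr_ge0//.
  have : `|e * (mu' v a - mu' v c)| <= be.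
    by rewrite normrM (gtr0_norm e0); apply: le_trans eK; rewrite ler_pM2l.
  by rewrite ler_norml => /andP[h3 _]; lra.
have Sx : conv_hull S x by rewrite -TT'; split.
have max0 : mu a x = 0 by apply: (face_barycentric0 bT _ aT aS Sx); apply/fsubsetP.
by move: max0; rewrite mux mac (dmu a a)// eqxx mulr1n; lra.
Qed.

Lemma barycentric_gradient T mu v : barycentric T mu -> exists b, forall x z,
  mu v (x + z) = mu v x + dotp b z.
Proof. by move=> [/(_ v)[a [b h]] _ _ _]; exists b => x z; rewrite !h dotpDr addrA. Qed.

End simplex_sides.

Section simplex_size.
Context {R : realType} {d : nat}.
Local Notation simplex := {fset 'rV[R]_d}.
Implicit Types (T S : simplex) (x v u a c : 'rV[R]_d).

Lemma edge_le_mesh_size T u v : u \in T -> v \in T -> enorm (u - v) <= mesh_size T.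
Proof. by move=> uT vT; apply: enorm_le_mesh_size; exact: vertex_conv_hull. Qed.

Lemma inball_diam_ge0 (D : set 'rV[R]_d) : 0 <= inball_diam D.
Proof.
rewrite /inball_diam; set A := (X in sup X).
have [[x Ax]|nA] := pselect (A !=set0); last first.
  by rewrite (_ : A = set0) ?sup0//; apply/eqP/negPn/negP => /set0P.
have [hA|hA] := pselect (has_ubound A); last by rewrite sup_out// => -[].
apply: le_trans (ub_le_sup hA Ax); case: Ax => r [r0 _] <-.
by rewrite mulr_ge0.
Qed.

Lemma exists_edge S : (1 < #|` S|)%N -> exists u v, [/\ u \in S, v \in S & u != v].
Proof.
move=> S1.
have /fset0Pn[u uS] : S != fset0 by rewrite -cardfs_eq0 -lt0n; apply: ltn_trans S1.
have : (S `\ u)%fset != fset0.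
  by move: S1; rewrite (cardfsD1 u) uS ltnS lt0n cardfs_eq0.
move=> /fset0Pn[v]; rewrite !inE => /andP[vu vS].
by exists u, v; split => //; rewrite eq_sym.
Qed.

Lemma mesh_size_gt0 T : (0 < d)%N -> #|` T| = d.+1 -> 0 < mesh_size T.
Proof.
move=> d0 cT; have [|u [v [uT vT uv]]] := @exists_edge T; first by rewrite cT.
apply: lt_le_trans (edge_le_mesh_size uT vT).
by rewrite lt_neqAle enorm_ge0 andbT eq_sym enorm_eq0 subr_eq0.
Qed.

Lemma inball_diam_gt0 T (sigma : R) : (0 < d)%N -> #|` T| = d.+1 ->
  mesh_size T <= sigma * inball_diam (conv_hull T) -> 0 < inball_diam (conv_hull T).
Proof.
move=> d0 cT h; rewrite lt_neqAle inball_diam_ge0 andbT eq_sym; apply/negP => /eqP i0.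
by move: h; rewrite i0 mulr0 leNgt mesh_size_gt0.
Qed.

(** An edge common to both simplices is at least as long as the inscribed diameter of [T] and at
    most as long as the diameter of [T']. Having an edge in common requires sides with two vertices,
    hence [d >= 2]. *)
Lemma neighbour_mesh_size T T' (sigma : R) : (0 < d)%N -> 0 <= sigma ->
  is_simplex T -> (1 < #|` (T `&` T')%fset|)%N ->
  mesh_size T <= sigma * inball_diam (conv_hull T) -> mesh_size T <= sigma * mesh_size T'.
Proof.
move=> d0 s0 sT S1 h; have [u [v [uS vS uv]]] := exists_edge S1.
move: uS vS; rewrite !inE => /andP[uT uT'] /andP[vT vT'].
have i0 : 0 < inball_diam (conv_hull T) by apply: (inball_diam_gt0 d0 _ h); case: sT.
apply: le_trans h _; apply: ler_wpM2l => //.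
apply: le_trans (edge_le_mesh_size uT' vT').
by apply: inball_le_edge.
Qed.

Definition open_hull T (mu : 'rV[R]_d -> 'rV[R]_d -> R) : set 'rV[R]_d :=
  [set x | forall v, v \in T -> 0 < mu v x].

Lemma continuous_barycentric T mu v : barycentric T mu -> continuous (mu v).
Proof. by move=> [amu _ _ _]; exact: Ck_continuous (Ck_affine 0 (amu v)). Qed.

Lemma open_hull_sub T mu : barycentric T mu -> open_hull T mu `<=` conv_hull T.
Proof. by move=> bT x h; apply/(conv_hullP _ bT) => v /h /ltW. Qed.

Lemma open_open_hull T mu : barycentric T mu -> open (open_hull T mu).
Proof.
move=> bT; rewrite openE => x hx; rewrite /interior.
have : nbhs x (\bigcap_(v in [set` T]) (mu v @^-1` [set t | 0 < t])).
  apply: filter_bigI => v vT; apply: (continuous_barycentric bT); apply: open_nbhs_nbhs.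
  by split; [exact: open_gt|exact: hx].
by apply: filterS => z h v; exact: h.
Qed.

Lemma open_hull_interior T mu : barycentric T mu -> open_hull T mu `<=` interior (conv_hull T).
Proof.
move=> bT; rewrite -open_subsetE; last exact: open_open_hull.
exact: open_hull_sub.
Qed.

(** What is removed lies in the zero sets of finitely many coordinates, which are hyperplanes: no
    coordinate is constant, as it takes the values 1 and 0 at two vertices. *)
Lemma ae_open_hull T mu : (0 < d)%N -> is_simplex T -> barycentric T mu ->
  {ae leb_rV d, forall x, conv_hull T x -> open_hull T mu x}.
Proof.
move=> d0 [cT _] bT; have [amu dmu _ _] := bT.
pose N v := [set x | mu v x = 0].
have mN v : measurable (N v).
  have [b [g gE]] := amu v; rewrite (_ : N v = [set x | dotp g x = - b]); first exact: measurable_hyperplane.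
  by apply/seteqP; split => x; rewrite /N/= gE => h; lra.
have N0 v : v \in T -> leb_rV d (N v) = 0%E.
  move=> vT; have [b [g gE]] := amu v.
  rewrite (_ : N v = [set x | dotp g x = - b]); last first.
    by apply/seteqP; split => x; rewrite /N/= gE => h; lra.
  apply: leb_hyperplane; apply/eqP => g0.
  have /fset0Pn[u] : (T `\ v)%fset != fset0.
    by rewrite -cardfs_eq0 -lt0n; move: cT; rewrite (cardfsD1 v) vT add1n => -[->].
  rewrite !inE => /andP[uv uT].
  have := dmu v u vT uT; have := dmu v v vT vT.
  have d0' z : dotp 0 z = 0 :> R by rewrite /dotp big1// => i _; rewrite mxE mul0r.
  by rewrite eqxx (eq_sym v u) (negbTE uv) !gE g0 !d0'; rewrite mulr1n mulr0n => -> /eqP; rewrite oner_eq0.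
have : {ae leb_rV d, forall x, (\bigcap_(v in [set` T]) [set x | mu v x != 0]) x}.
  apply: filter_bigI => v vT; exists (N v); split; [exact: mN|exact: N0|].
  by move=> x /= /negP/negPn/eqP.
apply: filterS => x h Tx v vT; rewrite lt_neqAle eq_sym (conv_hullP _ bT).1//= andbT.
exact: h.
Qed.

(** A small step towards the barycenter makes all coordinates positive. This makes the filter in the
    definition of [trace] proper, so that the limit is determined. *)
Lemma conv_hull_closure_interior T mu x : #|` T| = d.+1 -> barycentric T mu -> conv_hull T x ->
  closure (interior (conv_hull T)) x.
Proof.
move=> cT bT Tx B nB.
have T0 : T != fset0 by rewrite -cardfs_eq0 cT.
have [r r0 rB] := nbhs_cube nB.
pose c := barycenter T.
have [amu _ _ _] := bT.
have cU : c \in test_points T by exact: mem_head.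
have hc v : v \in T -> 0 < mu v c.
  move=> vT; apply: lt_le_trans (test_points_barycentric bT _ T0 cU vT) => //.
  by rewrite invr_gt0 mulr_gt0// ltr0n cT.
pose K := 1 + enorm (c - x); have K0 : 0 < K by rewrite ltr_wpDr ?enorm_ge0.
pose e := Num.min 1 (r / K).
have e0 : 0 < e by rewrite lt_min ltr01 divr_gt0.
have e1 : e <= 1 by rewrite ge_min lexx.
have eK : e * K <= r by rewrite -ler_pdivlMr// ge_min lexx orbT.
exists (x + e *: (c - x)); split.
  apply: (open_hull_interior bT) => v vT.
  rewrite (affine_line _ _ _ (amu v)) (addrC x) subrK.
  have := (conv_hullP _ bT).1 Tx v vT; have := hc v vT; nra.
apply: rB => i; rewrite mxE addrAC subrr add0r mxE normrM (gtr0_norm e0).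
apply: le_trans eK; rewrite ler_pM2l//.
by apply: le_trans (coord_le_enorm _ _) _; rewrite /K lerDr.
Qed.

End simplex_size.

Section convex.
Context {R : realType} {d : nat}.
Variable Omega : set 'rV[R]_d.

(** The segment from [z0] to [x] is prolonged slightly to a point of the closure, which is
    approximated by [y'] in [Omega]; displacing [z0] accordingly keeps [x] on the segment between
    two points of [Omega]. Meshes cover the closure, whereas bumps must be supported in [Omega]
    itself. *)
Lemma interior_closure_convex : Omega !=set0 -> open Omega ->
  convex_set (Omega : set (convex_lmodType 'rV[R]_d)) -> interior (closure Omega) `<=` Omega.
Proof.
move=> [z0 Oz0] oO cO x /nbhs_cube[r r0 rO].
have [s s0 sO] := nbhs_cube (open_nbhs_nbhs (conj oO Oz0)).
pose K := 1 + enorm (x - z0); have K0 : 0 < K by rewrite ltr_wpDr ?enorm_ge0.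
have K1 : 1 <= K by rewrite lerDl enorm_ge0.
pose t := r / K; have t0 : 0 < t by exact: divr_gt0.
have cy : closure Omega (x + t *: (x - z0)).
  apply: rO => i; rewrite mxE addrAC subrr add0r mxE normrM (gtr0_norm t0) /t mulrAC ler_pdivrMr//.
  rewrite ler_pM2l//; apply: le_trans (coord_le_enorm _ _) _; by rewrite /K lerDr.
have [y' [Oy' cy']] := cy _ (cube_nbhs (x + t *: (x - z0)) (mulr_gt0 t0 s0)).
(* Chosen so that [y' + t *: z' = (1 + t) *: x]. *)
pose z' := z0 + t^-1 *: (x + t *: (x - z0) - y').
have Oz' : Omega z'.
  apply: sO => i; rewrite /z' mxE addrAC subrr add0r mxE normrM normfV (gtr0_norm t0) mulrC ler_pdivrMr//.
  have := cy' i; rewrite -normrN !mxE opprB. rewrite (mulrC s); exact.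
have l0 : 0 <= (1 + t)^-1 by rewrite invr_ge0; lra.
have l1 : (1 + t)^-1 <= 1 by rewrite invf_le1; lra.
have l01 : Itv.spec (@Itv.num_sem R) (Itv.Real `[Posz 0, Posz 1]%Z) (1 + t)^-1.
  by rewrite /Itv.spec/= /Itv.num_sem/= in_itv/= num_real l0 l1.
have := cO y' z' (Itv.mk l01); rewrite !inE => /(_ Oy' Oz').
congr (Omega _); rewrite /conv/= /unstable.onem /z'.
apply/rowP => i; rewrite !mxE; field.
by apply/andP; split; lra.
Qed.

End convex.

Section polynomials.
Context {R : realType} {n : nat}.
Implicit Types (g h : 'rV[R]_n -> R).

Lemma quadraticD g h : quadratic g -> quadratic h -> quadratic (fun x => g x + h x).
Proof.
move=> [a [b [A gE]]] [a' [b' [A' hE]]].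
exists (a + a'), (b + b'), (fun i j => A i j + A' i j) => x; rewrite gE hE dotpDl.
have -> : \sum_i \sum_j (A i j + A' i j) * (x ord0 i * x ord0 j) =
    \sum_i \sum_j A i j * (x ord0 i * x ord0 j) + \sum_i \sum_j A' i j * (x ord0 i * x ord0 j).
  rewrite -big_split/=; apply: eq_bigr => i _; rewrite -big_split/=; apply: eq_bigr => j _.
  by rewrite mulrDl.
by ring.
Qed.

Lemma quadraticZ g (k : R) : quadratic g -> quadratic (fun x => k * g x).
Proof.
move=> [a [b [A gE]]]; exists (k * a), (k *: b), (fun i j => k * A i j) => x.
rewrite gE dotpZl !mulrDr; congr (_ + _); rewrite mulr_sumr; apply: eq_bigr => i _.
by rewrite mulr_sumr; apply: eq_bigr => j _; rewrite mulrA.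
Qed.

Lemma affine_quadratic g : affine g -> quadratic g.
Proof.
move=> [a [b gE]]; exists a, b, (fun _ _ => 0) => x.
by rewrite gE [X in _ = _ + X]big1 ?addr0// => i _; rewrite big1// => j _; rewrite mul0r.
Qed.

Lemma affine_coord i : affine (fun x : 'rV[R]_n => x ord0 i).
Proof. by exists 0, (delta_mx ord0 i) => x; rewrite add0r dotpC dotp_delta. Qed.

Lemma quadratic_coordM i j : quadratic (fun x : 'rV[R]_n => x ord0 i * x ord0 j).
Proof.
exists 0, 0, (fun k l => ((k == i) && (l == j))%:R) => x.
rewrite (_ : dotp 0 x = 0) ?add0r; last by rewrite /dotp big1// => k _; rewrite mxE mul0r.
rewrite (bigD1 i)//= (bigD1 j)//= !eqxx mul1r !big1 ?addr0// => [k /negbTE ki|l /negbTE lj].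
  by rewrite big1// => l _; rewrite ki mul0r.
by rewrite lj mul0r.
Qed.

Lemma monomial_deg0 (m : 'I_n -> nat) (X : 'I_n -> R) : (\sum_i m i = 0)%N ->
  \prod_i X i ^+ m i = 1.
Proof.
move=> /eqP; rewrite sum_nat_eq0 => /forallP h; rewrite big1// => i _.
by have := h i; rewrite implyTb => /eqP ->; rewrite expr0.
Qed.

Lemma monomial_degS (m : 'I_n -> nat) k : (\sum_i m i = k.+1)%N -> exists i m',
  (\sum_i m' i = k)%N /\ forall X : 'I_n -> R, \prod_j X j ^+ m j = X i * \prod_j X j ^+ m' j.
Proof.
move=> mk; have [i mi] : exists i, (0 < m i)%N.
  apply: contrapT => h; move: mk; rewrite big1// => i _; apply/eqP; rewrite -leqn0 leqNgt.
  by apply/negP => mi; apply: h; exists i.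
exists i, (fun j => if j == i then (m i).-1 else m j); split.
  move: mk; rewrite (bigD1 i)//= [in X in _ -> X](bigD1 i)//= eqxx -{1}(prednK mi) addSn => -[<-].
  by congr addn; apply: eq_bigr => j /negbTE ->.
move=> X; rewrite (bigD1 i)//= [in RHS](bigD1 i)//= eqxx mulrA -exprS prednK//.
by congr *%R; apply: eq_bigr => j /negbTE ->.
Qed.

Lemma affine_monomial (m : 'I_n -> nat) : (\sum_i m i <= 1)%N ->
  affine (fun x : 'rV[R]_n => \prod_i x ord0 i ^+ m i).
Proof.
case E : (\sum_i m i)%N => [|[|//]] _.
  by under eq_fun do rewrite (monomial_deg0 _ E); exact: affine_cst.
have [i [m' [m0 h]]] := monomial_degS E.
under eq_fun do rewrite (h (fun i => _ ord0 i)) (monomial_deg0 _ m0) mulr1.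
exact: affine_coord.
Qed.

Lemma quadratic_monomial (m : 'I_n -> nat) : (\sum_i m i <= 2)%N ->
  quadratic (fun x : 'rV[R]_n => \prod_i x ord0 i ^+ m i).
Proof.
case E : (\sum_i m i)%N => [|[|[|//]]] _; try by apply/affine_quadratic/affine_monomial; rewrite E.
have [i [m' [m1 h]]] := monomial_degS E; have [j [m'' [m0 h']]] := monomial_degS m1.
under eq_fun do rewrite (h (fun i => _ ord0 i)) (h' (fun i => _ ord0 i)) (monomial_deg0 _ m0) mulr1.
exact: quadratic_coordM.
Qed.

(** The discrete functions are polynomial only on an element; replacing them by functions affine on
    the whole space allows differentiation and integration by parts there. *)
Lemma polynomial_on_affine (D : set 'rV[R]_n) g : polynomial_on 1 D g ->
  exists2 P, affine P & forall x, D x -> g x = P x.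
Proof.
move=> [P [sP gP]]; exists (fun x => mpoly.meval (fun i => x ord0 i) P) => //.
under eq_fun do rewrite mpoly.mevalE.
have : all (fun m => mpoly.mdeg m <= 1)%N (mpoly.msupp P).
  apply/allP => m mP; rewrite -ltnS; apply: leq_trans sP; exact: mpoly.msize_mdeg_lt.
elim: (mpoly.msupp P) => [_|m s ih /= /andP[dm /ih{}ih]].
  by under eq_fun do rewrite big_nil; exact: affine_cst.
under eq_fun do rewrite big_cons.
by apply: affineD => //; apply: affineZ; apply: affine_monomial; rewrite -mpoly.mdegE.
Qed.

Lemma polynomial_on_quadratic (D : set 'rV[R]_n) g : polynomial_on 2 D g ->
  exists2 P, quadratic P & forall x, D x -> g x = P x.
Proof.
move=> [P [sP gP]]; exists (fun x => mpoly.meval (fun i => x ord0 i) P) => //.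
under eq_fun do rewrite mpoly.mevalE.
have : all (fun m => mpoly.mdeg m <= 2)%N (mpoly.msupp P).
  apply/allP => m mP; rewrite -ltnS; apply: leq_trans sP; exact: mpoly.msize_mdeg_lt.
elim: (mpoly.msupp P) => [_|m s ih /= /andP[dm /ih{}ih]].
  by under eq_fun do rewrite big_nil; apply: affine_quadratic; exact: affine_cst.
under eq_fun do rewrite big_cons.
by apply: quadraticD => //; apply: quadraticZ; apply: quadratic_monomial; rewrite -mpoly.mdegE.
Qed.

(* When the set defining the projection is empty, [get] returns a constant
   function, which is affine as well. *)
Lemma L2_proj_affine (Omega : set 'rV[R]_n) (M : {fset {fset 'rV[R]_n}}) g T : T \in M ->
  exists2 F, affine F & forall x, interior (conv_hull T) x -> L2_proj Omega M g x = F x.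
Proof.
move=> TM; rewrite /L2_proj; set A := (X in get X).
have [exA|nA] := pselect (exists h, A h).
  by have [[_ /(_ T TM) /polynomial_on_affine]] := getPex exA.
rewrite getPN; last by move=> h Ah; apply: nA; exists h.
by exists (fun=> point); [exact: affine_cst|].
Qed.

End polynomials.

(** * Residuals at a point *)

Section pairing.
Context {R : realType} {n : nat}.
Local Notation mu := (leb_rV n).
Implicit Types (g h F G P psi : 'rV[R]_n -> R) (c x : 'rV[R]_n).

(** Enough for a product with a [cube_test] function to be integrable, while still admitting the
    discontinuous functions produced by [glue]. *)
Definition cube_regular c b g : Prop :=
  measurable_fun setT g /\ exists2 B : R, 0 <= B & forall x, cube c b x -> `|g x| <= B.

Definition cube_test c b psi : Prop :=
  continuous psi /\ forall x, ~ cube c b x -> psi x = 0.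

Lemma cube_regularD c b g h : cube_regular c b g -> cube_regular c b h ->
  cube_regular c b (fun x => g x + h x).
Proof.
move=> [mg [B B0 gB]] [mh [B' B'0 hB]]; split; first exact: measurable_funD.
exists (B + B'); first exact: addr_ge0.
by move=> x cx; apply: le_trans (ler_normD _ _) _; apply: lerD; [exact: gB|exact: hB].
Qed.

Lemma cube_regularM c b g h : cube_regular c b g -> cube_regular c b h ->
  cube_regular c b (fun x => g x * h x).
Proof.
move=> [mg [B B0 gB]] [mh [B' B'0 hB]]; split; first exact: measurable_funM.
exists (B * B'); first exact: mulr_ge0.
by move=> x cx; rewrite normrM; apply: ler_pM => //; [exact: gB|exact: hB].
Qed.

Lemma cube_regular_continuous c b g : continuous g -> cube_regular c b g.
Proof.
move=> cg; split; first exact: continuous_measurable_rV.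
have : compact (g @` cube c b).
  by apply: continuous_compact (@compact_cube _ _ c b); exact: continuous_subspaceT.
move=> /compact_bounded[M [_ hM]]; exists (`|M| + 1); first by rewrite addr_ge0.
by move=> x cx; apply: (hM (`|M| + 1)); [rewrite ltr_pwDr// ler_norm|exists x].
Qed.

Lemma cube_regular_cst c b (k : R) : cube_regular c b (fun=> k).
Proof. by apply: (@cube_regular_continuous c b (fun=> k)) => x; exact: (@cvg_cst _ _ _ (nbhs x)). Qed.

Lemma cube_regular_bounded c b g (B : R) : measurable_fun setT g -> (forall x, `|g x| <= B) ->
  cube_regular c b g.
Proof.
move=> mg gB; split=> //; exists B => [|x _]; last exact: gB.
exact: le_trans (normr_ge0 _) (gB 0).
Qed.

Lemma integrable_pairing c b g psi : 0 <= b -> cube_regular c b g -> cube_test c b psi ->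
  mu.-integrable setT (EFin \o (fun x => g x * psi x)).
Proof.
move=> b0 [mg [B B0 gB]] [cpsi psi0]; have [K K0 hK] := supported_bounded cpsi psi0.
apply: (@integrable_supported _ _ _ c b (B * K) b0).
- by apply: measurable_funM => //; exact: continuous_measurable_rV.
- by move=> x /psi0 ->; rewrite mulr0.
- move=> x; have [cx|/psi0 ->] := pselect (cube c b x).
    by rewrite normrM; apply: ler_pM => //; exact: gB.
  by rewrite mulr0 normr0 mulr_ge0.
Qed.

Lemma pairingD c b g h psi : 0 <= b -> cube_regular c b g -> cube_regular c b h -> cube_test c b psi ->
  \int[mu]_x ((g x + h x) * psi x) = \int[mu]_x (g x * psi x) + \int[mu]_x (h x * psi x).
Proof.
move=> b0 rg rh tpsi; rewrite -RintegralD//; try exact: integrable_pairing tpsi.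
by apply: eq_Rintegral => x _; rewrite mulrDl.
Qed.

Lemma pairingZ c b g psi (k : R) : 0 <= b -> cube_regular c b g -> cube_test c b psi ->
  \int[mu]_x ((k * g x) * psi x) = k * \int[mu]_x (g x * psi x).
Proof.
move=> b0 rg tpsi; rewrite -RintegralZl//; last exact: integrable_pairing tpsi.
by apply: eq_Rintegral => x _; rewrite mulrA.
Qed.

Lemma pairing_cst c b psi (k : R) : 0 <= b -> cube_test c b psi ->
  \int[mu]_x (k * psi x) = k * \int[mu]_x psi x.
Proof. by move=> b0 [cpsi psi0]; rewrite RintegralZl//; exact: integrable_Cc psi0. Qed.

(** The difference [g - g c] is odd about [c]. *)
Lemma pairing_affine_even c b g psi : 0 <= b -> affine g -> cube_test c b psi ->
  (forall x, psi (c + c - x) = psi x) ->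
  \int[mu]_x (g x * psi x) = g c * \int[mu]_x psi x.
Proof.
move=> b0 ag tpsi epsi; have [a [s gE]] := ag.
have rg : cube_regular c b g.
  by apply: cube_regular_continuous; exact: Ck_continuous (Ck_affine 0 ag).
have e : \int[mu]_x ((g x + - g c) * psi x) = 0.
  apply: (@integral_odd _ _ (c + c)).
    apply: measurable_funM; last by apply: continuous_measurable_rV; case: tpsi.
    by apply: measurable_funD => //; case: rg.
  by move=> x; rewrite epsi !gE dotpBr dotpDr; ring.
move: e; rewrite (pairingD b0 rg (cube_regular_cst _ _ (- g c)) tpsi) (pairing_cst _ b0 tpsi).
by lra.
Qed.

(* The almost everywhere bound is turned into a global one by truncation. *)
Lemma pairing_close (Omega : set 'rV[R]_n) c b g U psi (E K : R) :
  open Omega -> bounded_set Omega -> 0 <= b -> cube c b `<=` Omega -> 0 <= E -> 0 <= K ->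
  L2 Omega g -> cube_regular c b U -> cube_test c b psi -> (forall x, `|psi x| <= K) ->
  {ae mu, forall x, cube c b x -> `|g x - U x| <= E} ->
  `|\int[mu]_x (U x * psi x) - \int[mu]_(x in Omega) (g x * psi x)| <= E * K * (2 * b) ^+ n.
Proof.
move=> oO bO b0 cO E0 K0 Lg rU tpsi psiK gU.
have mO : measurable Omega by exact: open_measurable_rV.
have [cpsi psi0] := tpsi.
have psiO x : ~ Omega x -> psi x = 0 by move=> nO; apply: psi0 => /cO.
have mpsi := continuous_measurable_rV cpsi.
have Lpsi : L2 Omega psi by apply: (bounded_L2 oO bO (M := K)) => //; exact: measurable_funTS.
have igpsi := L2_mul_integrable oO Lg Lpsi.
pose w : 'rV[R]_n -> R := (fun x => (U x - g x) * psi x) \_ Omega.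
have mw : measurable_fun setT w.
  apply/(measurable_restrictT _ mO). apply: measurable_funM; last exact: measurable_funTS.
  by apply: measurable_funB; [apply: measurable_funTS; case: rU|case: Lg].
pose w' x := Num.max (- (E * K)) (Num.min (E * K) (w x)).
have EK : 0 <= E * K by exact: mulr_ge0.
have w0 x : ~ cube c b x -> w x = 0.
  by move=> /psi0 h; rewrite /w patchE; case: ifP => // _; rewrite h mulr0.
have -> : \int[mu]_x (U x * psi x) - \int[mu]_(x in Omega) (g x * psi x) = \int[mu]_x w' x.
  rewrite -(Rintegral_set_support (D := Omega)) => [|x /psiO ->]; last by rewrite mulr0.
  rewrite -RintegralB//; last first.
    by apply: integrableS (integrable_pairing b0 rU tpsi).
  have -> : \int[mu]_(x in Omega) (U x * psi x - g x * psi x) = \int[mu]_x w x.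
    rewrite /w -Rintegral_mkcond; apply: eq_Rintegral => x _; by rewrite mulrBl.
  apply: (congr1 fine); apply: ae_eq_integral => //; try exact/measurable_EFinP.
    apply/measurable_EFinP; apply: measurable_maxr => //; exact: measurable_minr.
  apply: filterS gU => x h _; rewrite /= /w'; congr EFin.
  have : `|w x| <= E * K.
    have [cx|/w0 ->] := pselect (cube c b x); last by rewrite normr0.
    rewrite /w patchE mem_set ?normrM; last exact: cO.
    by apply: ler_pM => //; rewrite distrC; exact: h.
  by rewrite ler_norml => /andP[h1 h2]; rewrite (min_r h2) max_r.
apply: (norm_Rintegral_supported (c := c) b0).
- by apply: measurable_maxr => //; exact: measurable_minr.
- by move=> x /w0 h; rewrite /w' h (min_r EK) max_r// oppr_le0.
- by move=> x; rewrite ler_norml /w' le_max lexx/= ge_max ge_min lexx/= andbT; lra.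
Qed.

End pairing.

Lemma affine_reflect (R : realType) (d : nat) (c x : 'rV[R]_d) (Q Q' : 'rV[R]_d -> R) :
  affine Q -> affine Q' -> Q c = Q' c ->
  2^-1 * (Q (c + c - x) - Q' (c + c - x)) = - (2^-1 * (Q x - Q' x)).
Proof.
move=> [a [s QE]] [a' [s' QE']]; rewrite !QE !QE' !dotpBr !dotpDr.
by move: (dotp s c) (dotp s' c) (dotp s x) (dotp s' x) => *; lra.
Qed.

Section local_estimates.
Context {R : realType} {d : nat}.
Variable Omega : set 'rV[R]_d.
Hypotheses (d0 : (0 < d)%N) (O0 : Omega !=set0) (oO : open Omega) (bO : bounded_set Omega).
Variables (f y : 'I_d -> 'rV[R]_d -> R) (p : 'rV[R]_d -> R).
Hypothesis Lf : forall i, Linf Omega (f i).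
Hypothesis sol : stokes_solution Omega (H10v Omega) (L2_0 Omega) f y p.
Variable C : R.
Hypothesis C1 : 1 <= C.
Hypothesis bumpC : @bump2_bound R d C.
Local Notation mu := (leb_rV d).
Implicit Types (c v x nu : 'rV[R]_d) (P Q F U : 'rV[R]_d -> R).

Let C0 : 0 <= C. Proof. exact: le_trans ler01 C1. Qed.

Let Ly i : L2 Omega (y i). Proof. by case: sol => Hy _ _ _; case: (Hy i) => -[]. Qed.

Let Lp : L2 Omega p. Proof. by case: sol => _ [] . Qed.

Local Notation ex_exp := (expR (- 2) ^+ 2 : R).

Let ex_gt0 : 0 < ex_exp. Proof. by rewrite exprn_gt0// expR_gt0. Qed.

Let bump_int_ge c v r : 0 < r -> 2 * (ex_exp * r) ^+ d <= \int[mu]_x bump2 c v r x.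
Proof. by move=> r0; rewrite Rintegral_bump2// ler_pM2l//; exact: Rintegral_cbump_ge. Qed.

Section bump.
Variables (c v : 'rV[R]_d) (r rho : R).
Hypotheses (r0 : 0 < r) (rho0 : 0 <= rho) (hv : forall i, `|v ord0 i| + r <= rho).
Hypothesis cO : cube c rho `<=` Omega.
Local Notation phi := (bump2 c v r).

Let phi0 x : ~ cube c rho x -> phi x = 0. Proof. exact: bump2_eq0. Qed.

Lemma test_bump2 : test_function Omega phi.
Proof.
apply: (@test_function_supp _ _ Omega (cube c rho)) => //.
- by move=> k; exact: Ck_bump2.
- exact: compact_cube.
Qed.

Let t0 : cube_test c rho phi.
Proof. by split=> //; exact: Ck_continuous (Ck_bump2 0 c v r). Qed.

Let t1 i : cube_test c rho (pderiv i phi).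
Proof.
split; first exact: Ck_continuous (Ck_pderiv i (Ck_bump2 1 c v r)).
exact: pderiv_supported.
Qed.

Let t2 : cube_test c rho (laplacian phi).
Proof.
split; first exact: Ck_continuous (Ck_laplacian (Ck_bump2 2 c v r)).
exact: laplacian_supported.
Qed.

(** The identity is exact for [y] and [p]. Replacing them costs the error times the bound on the
    derivative of the bump times the volume of the cube. [U] and [Pi] are left general so as to
    cover one polynomial as well as two glued ones. *)
Lemma momentum_residual i U Pi (E eps : R) : 0 <= E -> 0 <= eps ->
  cube_regular c rho U -> cube_regular c rho Pi ->
  {ae mu, forall x, cube c rho x -> `|y i x - U x| <= E} ->
  {ae mu, forall x, cube c rho x -> `|p x - Pi x| <= eps} ->
  `|\int[mu]_x (U x * laplacian phi x) + \int[mu]_x (Pi x * pderiv i phi x) +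
    \int[mu]_(x in Omega) (f i x * phi x)| <= C * (E / r ^+ 2 + eps / r) * (2 * rho) ^+ d.
Proof.
move=> E0 eps0 rU rPi yU pPi.
have [_ b1 b2] := bumpC c v r0.
have := stokes_momentum oO bO i sol test_bump2.
have K1 : 0 <= C / r by rewrite divr_ge0// ltW.
have K2 : 0 <= C / r ^+ 2 by rewrite divr_ge0// exprn_ge0// ltW.
have h1 := pairing_close oO bO rho0 cO E0 K2 (Ly i) rU t2 b2 yU.
have h2 := pairing_close oO bO rho0 cO eps0 K1 Lp rPi (t1 i) (b1 i) pPi.
move: h1 h2; set I1 := \int[mu]_x _; set I2 := \int[mu]_(x in Omega) _.
set I3 := \int[mu]_x _; set I4 := \int[mu]_(x in Omega) _; set I5 := \int[mu]_(x in Omega) _.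
move=> h1 h2 eq5; have -> : I1 + I3 + I5 = (I1 - I2) + (I3 - I4) by lra.
apply: le_trans (ler_normD _ _) _.  apply: le_trans (lerD h1 h2) _.
rewrite -mulrDl; apply: ler_wpM2r; first by rewrite exprn_ge0// mulr_ge0.
by rewrite le_eqVlt; apply/orP; left; apply/eqP; field; rewrite gt_eqF.
Qed.

Lemma div_residual (U : 'I_d -> 'rV[R]_d -> R) (E : R) : 0 <= E ->
  (forall i, cube_regular c rho (U i)) ->
  (forall i, {ae mu, forall x, cube c rho x -> `|y i x - U i x| <= E}) ->
  `|\sum_i \int[mu]_x (U i x * pderiv i phi x)| <= d%:R * (C * (E / r) * (2 * rho) ^+ d).
Proof.
move=> E0 rU yU; have [_ b1 _] := bumpC c v r0.
have K1 : 0 <= C / r by rewrite divr_ge0// ltW.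
have dy := stokes_div oO bO O0 sol test_bump2.
have -> : \sum_i \int[mu]_x (U i x * pderiv i phi x) = \sum_i (\int[mu]_x (U i x * pderiv i phi x) -
    \int[mu]_(x in Omega) (y i x * pderiv i phi x)) by rewrite sumrB dy subr0.
apply: le_trans (ler_norm_sum _ _ _) _.
have -> : d%:R * (C * (E / r) * (2 * rho) ^+ d) = \sum_(i < d) (C * (E / r) * (2 * rho) ^+ d).
  by rewrite sumr_const card_ord mulr_natl.
apply: ler_sum => i _.
have := pairing_close oO bO rho0 cO E0 K1 (Ly i) (rU i) (t1 i) (b1 i) (yU i).
by rewrite (_ : E * (C / r) = C * (E / r)); last by ring.
Qed.

Lemma source_close i U (o : R) : 0 <= o -> cube_regular c rho U ->
  {ae mu, forall x, cube c rho x -> `|f i x - U x| <= o} ->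
  `|\int[mu]_x (U x * phi x) - \int[mu]_(x in Omega) (f i x * phi x)| <= C * o * (2 * rho) ^+ d.
Proof.
move=> o0 rU fU; have [b0 _ _] := bumpC c v r0.
by rewrite (mulrC C); exact: (pairing_close oO bO rho0 cO o0 C0 (Linf_L2 oO bO (Lf i)) rU t0 b0 fU).
Qed.

Lemma pairing_laplacian P : quadratic P ->
  \int[mu]_x (P x * laplacian phi x) = laplacian P c * \int[mu]_x phi x.
Proof.
move=> qP; rewrite (green rho0 (Ck_quadratic 2 qP) (Ck_bump2 2 c v r) phi0).
have [L PL] := laplacian_quadratic qP; rewrite PL -(pairing_cst _ rho0 t0).
by apply: eq_Rintegral => x _; rewrite PL.
Qed.

Lemma pairing_pderiv i Q : affine Q ->
  \int[mu]_x (Q x * pderiv i phi x) = - (pderiv i Q c * \int[mu]_x phi x).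
Proof.
move=> aQ; rewrite (integration_by_parts_rV i rho0 (Ck_affine 1 aQ) (Ck_bump2 1 c v r) phi0).
have [a [s QE]] := aQ; rewrite (pderiv_affine i c QE) -(pairing_cst _ rho0 t0).
by congr (- _); apply: eq_Rintegral => x _; rewrite (pderiv_affine i x QE).
Qed.

Lemma pairing_pderiv_quadratic i P : quadratic P ->
  \int[mu]_x (P x * pderiv i phi x) = - (pderiv i P c * \int[mu]_x phi x).
Proof.
move=> qP; rewrite (integration_by_parts_rV i rho0 (Ck_quadratic 1 qP) (Ck_bump2 1 c v r) phi0).
congr (- _).
exact: (pairing_affine_even rho0 (affine_pderiv_quadratic i qP) t0 (bump2_reflect c v r)).
Qed.

End bump.

Let cube_regular_affine c b F : affine F -> cube_regular c b F.
Proof. by move=> aF; apply: cube_regular_continuous; exact: Ck_continuous (Ck_affine 0 aF). Qed.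

Let cube_regular_quadratic c b P : quadratic P -> cube_regular c b P.
Proof. by move=> qP; apply: cube_regular_continuous; exact: Ck_continuous (Ck_quadratic 0 qP). Qed.

Let zero_shift (r : R) i : `|(0 : 'rV[R]_d) ord0 i| + r <= r.
Proof. by rewrite mxE normr0 add0r. Qed.

(** The mass of the bump is comparable to the volume of the cube of half-width [k * r], and the
    constant is the ratio of the two. Inside an element [k = 1]; at a side [k = d + 1], because of
    the shift. *)
Let divide_mass c v r (a k A : R) : 0 < r -> 0 <= A -> 0 <= k ->
  `|a * \int[mu]_x bump2 c v r x| <= A * (2 * (k * r)) ^+ d -> `|a| <= (2 * k / ex_exp) ^+ d * A.
Proof.
move=> r0 A0 k0 h; have J := bump_int_ge c v r0.
have e0 : 0 < (ex_exp * r) ^+ d by rewrite exprn_gt0// mulr_gt0.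
have J0 : 0 < \int[mu]_x bump2 c v r x by apply: lt_le_trans J; rewrite mulr_gt0.
have h1 : `|a| * (ex_exp * r) ^+ d <= A * (2 * (k * r)) ^+ d.
  apply: le_trans h; rewrite normrM (gtr0_norm J0); apply: ler_wpM2l => //.
  by apply: le_trans J; rewrite ler_peMl// ?ltW// ltr1n.
rewrite -(ler_pM2r e0); apply: le_trans h1 _.
rewrite mulrAC -exprMn mulrC (_ : 2 * k / ex_exp * (ex_exp * r) = 2 * (k * r))//.
by field; rewrite gt_eqF.
Qed.

Lemma element_residual i c r P Q F (E eps o : R) : 0 < r -> cube c r `<=` Omega ->
  0 <= E -> 0 <= eps -> 0 <= o -> quadratic P -> affine Q -> affine F ->
  {ae mu, forall x, cube c r x -> `|y i x - P x| <= E} ->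
  {ae mu, forall x, cube c r x -> `|p x - Q x| <= eps} ->
  {ae mu, forall x, cube c r x -> `|f i x - F x| <= o} ->
  `|F c + laplacian P c - pderiv i Q c| <=
    (2 * 1 / ex_exp) ^+ d * (C * (E / r ^+ 2 + eps / r) + C * o).
Proof.
move=> r0 cO E0 eps0 o0 qP aQ aF yP pQ fF; have rr := ltW r0.
have hv i := zero_shift r i.
apply: (@divide_mass c 0 r) => //.
  by rewrite addr_ge0// mulr_ge0// addr_ge0// divr_ge0// exprn_ge0.
have h1 := momentum_residual r0 rr hv cO E0 eps0 (cube_regular_quadratic _ _ qP)
  (cube_regular_affine _ _ aQ) yP pQ.
have h2 := source_close r0 rr hv cO o0 (cube_regular_affine _ _ aF) fF.
rewrite (pairing_laplacian c r0 rr hv) // (pairing_pderiv c r0 rr hv)// in h1.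
have tphi : cube_test c r (bump2 c 0 r).
  by split; [exact: Ck_continuous (Ck_bump2 0 _ _ _)|move=> x; exact: bump2_eq0].
rewrite (pairing_affine_even rr aF tphi (bump2_reflect c 0 r)) in h2.
move: h1 h2; set J := \int[mu]_x _; set I := \int[mu]_(x in Omega) _ => h1 h2.
have -> : (F c + laplacian P c - pderiv i Q c) * J =
  (laplacian P c * J + - (pderiv i Q c * J) + I) + (F c * J - I) by ring.
by rewrite mul1r mulrDl; apply: le_trans (ler_normD _ _) (lerD h1 h2).
Qed.

Lemma element_div c r (P : 'I_d -> 'rV[R]_d -> R) (E : R) : 0 < r -> cube c r `<=` Omega ->
  0 <= E -> (forall i, quadratic (P i)) ->
  (forall i, {ae mu, forall x, cube c r x -> `|y i x - P i x| <= E}) ->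
  `|\sum_i pderiv i (P i) c| <= (2 * 1 / ex_exp) ^+ d * (d%:R * (C * (E / r))).
Proof.
move=> r0 cO E0 qP yP; have rr := ltW r0.
have hv i := zero_shift r i.
apply: (@divide_mass c 0 r) => //; first by rewrite !mulr_ge0// invr_ge0.
have := div_residual r0 rr hv cO E0 (fun i => cube_regular_quadratic _ _ (qP i)) yP.
rewrite mul1r mulrA; apply: le_trans; rewrite -normrN mulr_suml -sumrN.
rewrite le_eqVlt; apply/orP; left; apply/eqP; congr `|_|; apply: eq_bigr => i _.
by rewrite (pairing_pderiv_quadratic c r0 rr hv).
Qed.

Section jump.
Variables (c nu : 'rV[R]_d).
Hypothesis nu1 : enorm nu = 1.
Local Notation lam x := (dotp nu (x - c)).
Local Notation sgn x := (Num.sg (dotp nu (x - c))).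

Let continuous_lam : continuous (fun x => lam x).
Proof.
apply: (@Ck_continuous _ _ 0); apply: Ck_affine.
by exists (- dotp nu c), nu => x; rewrite dotpBr addrC.
Qed.

Let measurable_sgn : measurable_fun setT (fun x => sgn x).
Proof.
have ml : measurable_fun setT (fun x => lam x) by exact: continuous_measurable_rV.
apply: measurable_fun_ifT => //; first exact: measurable_fun_eqr.
by apply: measurable_fun_ifT => //; exact: measurable_fun_ltr.
Qed.

Let cube_regular_sgn b : cube_regular c b (fun x => sgn x).
Proof.
apply: (@cube_regular_bounded _ _ c b _ 1) => // x; rewrite normr_sg.
by case: (_ != 0); rewrite ?ler01.
Qed.

Let lam_reflect x : lam (c + c - x) = - lam x.
Proof. by rewrite !dotpBr dotpDr; ring. Qed.

Let sgn_reflect x : sgn (c + c - x) = - sgn x.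
Proof. by rewrite lam_reflect sgrN. Qed.

Let ae_lam_neq0 : {ae mu, forall x, lam x != 0}.
Proof.
exists [set x | dotp nu x = dotp nu c]; split.
- exact: measurable_hyperplane.
- apply: leb_hyperplane; apply/eqP => nu0; move: nu1; rewrite nu0.
  by move/eqP; rewrite (_ : enorm 0 = 0) 1?eq_sym ?oner_eq0//; apply/eqP; rewrite enorm_eq0.
- by move=> x /= /negP/negPn; rewrite dotpBr subr_eq0 => /eqP.
Qed.

(* As the sign vanishes on the hyperplane, the factor [sgn x] is exactly odd about [c]. *)
Definition glue (A B : 'rV[R]_d -> R) x := 2^-1 * (A x + B x) + sgn x * (2^-1 * (A x - B x)).

Lemma cube_regular_glue b A B : cube_regular c b A -> cube_regular c b B ->
  cube_regular c b (glue A B).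
Proof.
move=> rA rB; have rk k : cube_regular c b (fun=> k : R) by exact: cube_regular_cst.
have rN : cube_regular c b (fun x => A x - B x).
  apply: cube_regularD => //; have -> : (fun x => - B x) = (fun x => -1 * B x).
    by apply/funext => x; rewrite mulN1r.
  exact: cube_regularM.
apply: cube_regularD; first by apply: cube_regularM => //; exact: cube_regularD.
by apply: cube_regularM => //; exact: cube_regularM.
Qed.

Lemma ae_glue b (g A B : 'rV[R]_d -> R) (E : R) :
  {ae mu, forall x, cube c b x -> 0 < lam x -> `|g x - A x| <= E} ->
  {ae mu, forall x, cube c b x -> lam x < 0 -> `|g x - B x| <= E} ->
  {ae mu, forall x, cube c b x -> `|g x - glue A B x| <= E}.
Proof.
move=> h1 h2; apply: filterS3 ae_lam_neq0 h1 h2 => x l0 h1 h2 cx; rewrite /glue.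
move: l0; rewrite neq_lt => /orP[l|l].
  rewrite ltr0_sg// (_ : 2^-1 * (A x + B x) + -1 * (2^-1 * (A x - B x)) = B x); last by field.
  exact: h2.
rewrite gtr0_sg// (_ : 2^-1 * (A x + B x) + 1 * (2^-1 * (A x - B x)) = A x); last by field.
exact: h1.
Qed.

Let cube_regularB b A B : cube_regular c b A -> cube_regular c b B ->
  cube_regular c b (fun x => 2^-1 * (A x - B x)).
Proof.
move=> rA rB; apply: cube_regularM; first exact: cube_regular_cst.
apply: cube_regularD => //; have -> : (fun x => - B x) = (fun x => -1 * B x).
  by apply/funext => x; rewrite mulN1r.
by apply: cube_regularM => //; exact: cube_regular_cst.
Qed.

Lemma pairing_glue b A B psi : 0 <= b -> cube_regular c b A -> cube_regular c b B ->
  cube_test c b psi ->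
  \int[mu]_x (glue A B x * psi x) = 2^-1 * (\int[mu]_x (A x * psi x) + \int[mu]_x (B x * psi x)) +
    \int[mu]_x ((sgn x * (2^-1 * (A x - B x))) * psi x).
Proof.
move=> b0 rA rB tpsi.
rewrite (pairingD b0 _ _ tpsi); first last.
- by apply: cube_regularM => //; exact: cube_regularB.
- by apply: cube_regularM; [exact: cube_regular_cst|exact: cube_regularD].
congr (_ + _); rewrite (pairingZ _ b0 _ tpsi); last exact: cube_regularD.
by congr (_ * _); exact: (pairingD b0 rA rB tpsi).
Qed.

Lemma pairing_sgn_even b h psi : cube_regular c b h -> cube_test c b psi ->
  (forall x, h (c + c - x) * psi (c + c - x) = h x * psi x) ->
  \int[mu]_x ((sgn x * h x) * psi x) = 0.
Proof.
move=> [mh _] [cpsi _] even; apply: (@integral_odd _ _ (c + c)).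
  by apply: measurable_funM; [exact: measurable_funM|exact: continuous_measurable_rV].
by move=> x; rewrite sgn_reflect -mulrA even mulNr mulrA.
Qed.

(** Half the difference of [P] and [P'] is [2^-1 * g * lam] plus a function even about [c].
    Multiplied by [sgn], the first becomes [2^-1 * g * |lam|] and the second becomes odd, hence
    invisible. The difference of [Q] and [Q'] vanishes at [c], so it is odd; [sgn] makes it even and
    it drops out against the odd derivative of the bump. *)
Lemma jump_residual i r P P' Q Q' (g E eps Rs : R) : 0 < r ->
  cube c (d.+1%:R * r) `<=` Omega -> 0 <= E -> 0 <= eps -> 0 <= Rs ->
  quadratic P -> quadratic P' -> affine Q -> affine Q' ->
  P c = P' c -> Q c = Q' c ->
  (forall z, dotp (\row_j pderiv j P c) z - dotp (\row_j pderiv j P' c) z = g * dotp nu z) ->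
  {ae mu, forall x, cube c (d.+1%:R * r) x -> 0 < lam x -> [/\ `|y i x - P x| <= E,
    `|p x - Q x| <= eps & `|f i x + (laplacian P c - pderiv i Q c)| <= Rs]} ->
  {ae mu, forall x, cube c (d.+1%:R * r) x -> lam x < 0 -> [/\ `|y i x - P' x| <= E,
    `|p x - Q' x| <= eps & `|f i x + (laplacian P' c - pderiv i Q' c)| <= Rs]} ->
  `|g| <= 4 * d%:R * (2 * d.+1%:R / ex_exp) ^+ d * (r * (C * (E / r ^+ 2 + eps / r) + C * Rs)).
Proof.
move=> r0 cO E0 eps0 Rs0 qP qP' aQ aQ' Pc Qc dg aeT aeT'.
(* The identity isolating the jump term: the means of the Laplacians and of the pressure derivatives
   cancel against the constants that stand for [f]. *)
have alg (l l' q q' J L I : R) : 2^-1 * g * L = 2^-1 * ((l + l') * J) + 2^-1 * g * L +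
  - (2^-1 * ((q + q') * J)) + I + (- (2^-1 * ((l - q + (l' - q')) * J)) - I) by field.
have [v hv0 lv] := exists_bump2 c d0 nu1 r0.
(* The shift is at most [d * r] in each coordinate, to which the radius [r] is added. *)
pose rho := d.+1%:R * r; have rho0 : 0 <= rho by rewrite mulr_ge0// ltW.
have hv j : `|v ord0 j| + r <= rho.
  by rewrite /rho -natr1 mulrDl mul1r lerD2r; exact: hv0.
set phi := bump2 c v r in lv.
pose G := laplacian P c - pderiv i Q c; pose G' := laplacian P' c - pderiv i Q' c.
have rP := cube_regular_quadratic c rho qP; have rP' := cube_regular_quadratic c rho qP'.
have rQ := cube_regular_affine c rho aQ; have rQ' := cube_regular_affine c rho aQ'.
have rk k : cube_regular c rho (fun=> k : R) by exact: cube_regular_cst.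
have phi0 x : ~ cube c rho x -> phi x = 0 by exact: bump2_eq0.
have t0 : cube_test c rho phi by split=> //; exact: Ck_continuous (Ck_bump2 0 c v r).
have t1 : cube_test c rho (pderiv i phi).
  split; first exact: Ck_continuous (Ck_pderiv i (Ck_bump2 1 c v r)).
  exact: pderiv_supported.
have t2 : cube_test c rho (laplacian phi).
  split; first exact: Ck_continuous (Ck_laplacian (Ck_bump2 2 c v r)).
  exact: laplacian_supported.
have yG : {ae mu, forall x, cube c rho x -> `|y i x - glue P P' x| <= E}.
  by apply: ae_glue; [apply: filterS aeT|apply: filterS aeT'] => x h cx l; have [] := h cx l.
have pG : {ae mu, forall x, cube c rho x -> `|p x - glue Q Q' x| <= eps}.
  by apply: ae_glue; [apply: filterS aeT|apply: filterS aeT'] => x h cx l; have [] := h cx l.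
have h1 := momentum_residual r0 rho0 hv cO E0 eps0 (cube_regular_glue rP rP')
  (cube_regular_glue rQ rQ') yG pG.
have h2 : `|\int[mu]_x (glue (fun=> - G) (fun=> - G') x * phi x) -
    \int[mu]_(x in Omega) (f i x * phi x)| <= C * Rs * (2 * rho) ^+ d.
  apply: (source_close r0 rho0 hv cO Rs0 (cube_regular_glue (rk _) (rk _))).
  apply: ae_glue.
    by apply: filterS aeT => x h cx l; have [_ _] := h cx l; rewrite opprK.
  by apply: filterS aeT' => x h cx l; have [_ _] := h cx l; rewrite opprK.
set J := \int[mu]_x phi x.
have e1 : \int[mu]_x (glue P P' x * laplacian phi x) =
    2^-1 * ((laplacian P c + laplacian P' c) * J) +
    2^-1 * g * \int[mu]_x (`|lam x| * laplacian phi x).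
  rewrite (pairing_glue rho0 rP rP' t2).
  rewrite (pairing_laplacian c r0 rho0 hv qP) (pairing_laplacian c r0 rho0 hv qP').
  rewrite mulrDl; congr (_ + _).
  have [q q2 qE] := taylor_quadratic c qP; have [q' q2' qE'] := taylor_quadratic c qP'.
  pose h x := 2^-1 * (q (x - c) - q' (x - c)).
  have hE x : 2^-1 * (P x - P' x) = 2^-1 * g * lam x + h x.
    have xc : x = c + (x - c) by rewrite addrC subrK.
    rewrite {1 2}xc qE qE' Pc /h -mulrA -dg; ring.
  have rh : cube_regular c rho h.
    have -> : h = (fun x => 2^-1 * (P x - P' x) + (- (2^-1 * g)) * lam x).
      by apply/funext => x; rewrite hE mulNr; ring.
    by apply: cube_regularD; [exact: cube_regularB|
      apply: cube_regularM => //; exact: cube_regular_continuous].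
  have rl : cube_regular c rho (fun x => `|lam x|).
    apply: (@cube_regular_continuous _ _ c rho (fun x => `|lam x|)) => x.
    by apply: (continuous_comp (continuous_lam (x := x))); exact: norm_continuous.
  rewrite -(pairingZ _ rho0 rl t2).
  have <- : \int[mu]_x ((2^-1 * g * `|lam x| + sgn x * h x) * laplacian phi x) =
            \int[mu]_x ((2^-1 * g * `|lam x|) * laplacian phi x).
    have r1 : cube_regular c rho (fun x => 2^-1 * g * `|lam x|) by exact: cube_regularM.
    have r2 : cube_regular c rho (fun x => sgn x * h x) by exact: cube_regularM.
    apply: (etrans (pairingD rho0 r1 r2 t2)).
    have odd0 : \int[mu]_x ((sgn x * h x) * laplacian phi x) = 0.
      apply: (pairing_sgn_even rh t2) => x.
      rewrite (laplacian_bump2_reflect c v r x) /h (_ : c + c - x - c = - (x - c)) ?q2 ?q2'//.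
      by apply/rowP => k; rewrite !mxE; ring.
    by apply: (etrans (congr1 (fun t => _ + t) odd0)); exact: addr0.
  apply: eq_Rintegral => x _; congr (_ * _).
  by rewrite hE normrEsg; ring.
have e2 : \int[mu]_x (glue Q Q' x * pderiv i phi x) =
    - (2^-1 * ((pderiv i Q c + pderiv i Q' c) * J)).
  have oddQ x := affine_reflect x aQ aQ' Qc.
  have odd0 : \int[mu]_x ((sgn x * (2^-1 * (Q x - Q' x))) * pderiv i phi x) = 0.
    apply: (pairing_sgn_even (cube_regularB rQ rQ') (t1)) => x.
    by apply: (etrans (congr2 *%R (oddQ x) (pderiv_bump2_reflect i c v r x))); exact: mulrNN.
  apply: (etrans (pairing_glue rho0 rQ rQ' t1)).
  apply: (etrans (congr1 (fun t => _ + t) odd0)).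
  rewrite (pairing_pderiv c r0 rho0 hv i aQ) (pairing_pderiv c r0 rho0 hv i aQ') -/J.
  by ring.
have e3 : \int[mu]_x (glue (fun=> - G) (fun=> - G') x * phi x) = - (2^-1 * ((G + G') * J)).
  rewrite (pairing_glue rho0 (rk _) (rk _) t0) !(pairing_cst _ rho0 t0) -/J.
  rewrite (@pairing_sgn_even rho (fun=> 2^-1 * (- G - - G')) phi (rk _) t0); first by ring.
  by move=> x; congr (_ * _); exact: bump2_reflect.
pose L := \int[mu]_x (`|lam x| * laplacian phi x).
have hL : `|2^-1 * g * L| <= (C * (E / r ^+ 2 + eps / r) + C * Rs) * (2 * rho) ^+ d.
  have -> : 2^-1 * g * L = (\int[mu]_x (glue P P' x * laplacian phi x) +
      \int[mu]_x (glue Q Q' x * pderiv i phi x) +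
      \int[mu]_(x in Omega) (f i x * phi x)) +
     (\int[mu]_x (glue (fun=> - G) (fun=> - G') x * phi x) -
      \int[mu]_(x in Omega) (f i x * phi x)).
    by rewrite e1 e2 e3 -/L /G /G'; exact: alg.
  apply: le_trans (ler_normD _ _) _.  apply: le_trans (lerD h1 h2) _.
  by rewrite -mulrDl.
have J0 : 0 < J by apply: lt_le_trans (bump_int_ge c v r0); rewrite mulr_gt0// exprn_gt0// mulr_gt0.
have dr : 0 < 2 * (d%:R * r) by rewrite !mulr_gt0// ltr0n.
set K := C * _ + _ in hL *.
have K0 : 0 <= K.
  by rewrite addr_ge0// mulr_ge0// addr_ge0// divr_ge0// ?exprn_ge0// ltW.
(* One factor 2 undoes the half in front of [g]; [2 * (d%:R * r)] is the loss in [exists_bump2]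
   between the mass and the integral of [|lam|] against the Laplacian. *)
have h : `|g * J| <= (2 * (2 * (d%:R * r)) * K) * (2 * (d.+1%:R * r)) ^+ d.
  have hg : `|g| * (J / (2 * (d%:R * r))) <= `|g| * L.
    by apply: ler_wpM2l => //; exact: lv.
  have LJ : 0 <= L by apply: le_trans lv; rewrite divr_ge0 ?ltW.
  have h3 : `|g| * L <= 2 * (K * (2 * rho) ^+ d).
    move: hL; rewrite -mulrA normrM (ger0_norm (_ : 0 <= 2^-1))// normrM (ger0_norm LJ).
    by rewrite ler_pdivrMl.
  rewrite normrM (gtr0_norm J0).
  have -> : `|g| * J = `|g| * (J / (2 * (d%:R * r))) * (2 * (d%:R * r)).
    by rewrite -mulrA divfK// gt_eqF.
  have -> : (2 * (2 * (d%:R * r)) * K) * (2 * (d.+1%:R * r)) ^+ d =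
     2 * (K * (2 * rho) ^+ d) * (2 * (d%:R * r)) by rewrite /rho; ring.
  by rewrite ler_pM2r//; exact: le_trans hg h3.
have := divide_mass r0 (mulr_ge0 (mulr_ge0 (ler0n R 2) (ltW dr)) K0) (ler0n _ _) h.
move=> /le_trans; apply; rewrite le_eqVlt; apply/orP; left; apply/eqP; ring.
Qed.

End jump.

End local_estimates.

(** * Traces and normal jumps *)

Section side_frame.
Context {R : realType} {d : nat}.
Local Notation simplex := {fset 'rV[R]_d}.
Implicit Types (T S : simplex) (x v u a c g nu z : 'rV[R]_d).

Lemma dotp_nn nu : enorm nu = 1 -> dotp nu nu = 1.
Proof. by rewrite -sqr_enorm => ->; rewrite expr1n. Qed.

(** [nu] is the normalized gradient of the coordinate of [a]. By [opposite_barycentric] the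
    coordinate of [a'] in [T'] is a negative multiple of it, so one normal serves both simplices. *)
Lemma exists_side_frame T T' S mu mu' a a' : (0 < d)%N ->
  barycentric T mu -> barycentric T' mu' -> side_of T S a -> side_of T' S a' ->
  #|` S| = d -> conv_hull T `&` conv_hull T' = conv_hull S ->
  exists nu (k k' : R), [/\ enorm nu = 1, 0 < k, 0 < k',
    forall x z, mu a (x + z) = mu a x + k * dotp nu z &
    forall x z, mu' a' (x + z) = mu' a' x + k' * dotp (- nu) z].
Proof.
move=> d0 bT bT' Sa Sa' cS TT'.
have [k0 main] := opposite_barycentric d0 bT bT' Sa Sa' cS TT'.
have [b bE] := barycentric_gradient a bT.
have [amu dmu _ _] := bT; have [/fsubsetP ST aT aS _] := Sa.
have /fset0Pn[v vS] : S != fset0 by rewrite -cardfs_eq0 cS -lt0n.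
have va : v == a = false by apply/eqP => va; rewrite -va vS in aS.
have b0 : b != 0.
  apply/eqP => b0; have := bE v (a - v).
  rewrite (addrC v) subrK (dmu a a)// (dmu a v)// ?ST// eqxx eq_sym va mulr1n mulr0n add0r b0.
  rewrite /dotp big1 => [/eqP|i _]; first by rewrite oner_eq0.
  by rewrite mxE mul0r.
have nb : 0 < enorm b by rewrite lt_neqAle enorm_ge0 andbT eq_sym enorm_eq0.
exists ((enorm b)^-1 *: b), (enorm b), (enorm b * - mu' a' a); split => //.
- by rewrite enormZ normfV gtr0_norm// mulVf// gt_eqF.
- by rewrite mulr_gt0// oppr_gt0.
- by move=> x z; rewrite bE dotpZl mulrA mulfV ?mul1r// gt_eqF.
- move=> x z; rewrite main bE (main x) dotpNl dotpZl; field.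
  by rewrite gt_eqF.
Qed.

Section frame.
Variables (T S : simplex) (mu : 'rV[R]_d -> 'rV[R]_d -> R) (a nu : 'rV[R]_d) (k : R).
Hypotheses (bT : barycentric T mu) (Sa : side_of T S a) (nu1 : enorm nu = 1) (k0 : 0 < k).
Hypothesis muE : forall x z, mu a (x + z) = mu a x + k * dotp nu z.

Lemma frame_tangential c g z : (forall v, v \in S -> dotp g (v - c) = 0) ->
  dotp g z = dotp g nu * dotp nu z.
Proof.
move=> g0; rewrite (tangential_dual z bT Sa g0) (tangential_dual nu bT Sa g0) !muE.
rewrite dotp_nn//; ring.
Qed.

Lemma frame_side0 x : conv_hull S x -> mu a x = 0.
Proof. by case: Sa => ST aT aS _ Sx; exact: (face_barycentric0 bT ST aT aS Sx). Qed.

Lemma frame_dotp x y : conv_hull S y -> dotp nu (x - y) = k^-1 * mu a x.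
Proof.
move=> Sy; have := muE y (x - y); rewrite (addrC y) subrK (frame_side0 Sy) add0r => ->.
by rewrite mulKf// gt_eqF.
Qed.

(** [side_normal] is a choice, so existence and uniqueness are both needed: [nu] qualifies, and a
    candidate is a multiple of [nu] by orthogonality to the side, with factor 1 by length and
    orientation. *)
Lemma side_normal_frame : S != fset0 -> side_normal S T = nu.
Proof.
move=> /fset0Pn[c cS]; have [ST aT aS TS] := Sa; have Sc := vertex_conv_hull cS.
rewrite /side_normal; set A := (X in get X).
have Anu : A nu.
  split => // x y hx hy; rewrite frame_dotp//; first by rewrite frame_side0 ?mulr0.
  by rewrite mulr_ge0 ?invr_ge0 ?(ltW k0)//; exact: (conv_hullP _ bT).1.
have [nu'1 nu'0 nu'T] : A (get A) by apply: getPex; exists nu.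
set nu' := get A in nu'1 nu'0 nu'T *.
have main z : dotp nu' z = dotp nu' nu * dotp nu z.
  by apply: (@frame_tangential c) => v vS; apply: nu'0 => //; exact: vertex_conv_hull.
set t := dotp nu' nu in main.
have nuE : nu' = t *: nu.
  by apply/rowP => i; rewrite mxE -!dotp_delta main.
have t0 : 0 <= t.
  have := nu'T a c (vertex_conv_hull aT) Sc; rewrite main frame_dotp//.
  have [_ dmu _ _] := bT; rewrite dmu// eqxx mulr1.
  by rewrite pmulr_lge0// invr_gt0.
by move: nu'1; rewrite nuE enormZ nu1 mulr1 ger0_norm// => ->; rewrite scale1r.
Qed.

End frame.

Lemma affine_dotp_gradient g nu (P : 'rV[R]_d -> R) : quadratic P ->
  affine (fun x => dotp (\row_j pderiv j P x) nu).
Proof.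
move=> qP; have -> : (fun x => dotp (\row_j pderiv j P x) nu) =
    (fun x => \sum_j nu ord0 j * pderiv j P x).
  by apply/funext => x; apply: eq_bigr => j _; rewrite mxE mulrC.
apply: affine_sum => j; apply: affineZ; exact: affine_pderiv_quadratic.
Qed.

(** Expanded about the midpoint, the even second order part cancels. *)
Lemma gradient_midpoint (P : 'rV[R]_d -> R) x z : quadratic P ->
  P (x + z) - P x = dotp (\row_j pderiv j P (x + 2^-1 *: z)) z.
Proof.
move=> qP; have [q2 even qE] := taylor_quadratic (x + 2^-1 *: z) qP.
have -> : x + z = x + 2^-1 *: z + 2^-1 *: z.
  by rewrite -addrA -scalerDl (_ : 2^-1 + 2^-1 = 1 :> R) ?scale1r//; lra.
have e : P x = P (x + 2^-1 *: z + - (2^-1 *: z)) by rewrite addrK.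
by rewrite [P x]e !qE even dotpNr dotpZr; field.
Qed.

(** Both functions agree along the segment from [x] to [v]. The midpoint rule on the whole segment
    and on its first half makes the affine function [u] vanish at the parameters [1 / 2] and
    [1 / 4], hence also at [x]. The jump of the gradient is therefore normal to the side. *)
Lemma gradient_side (P P' : 'rV[R]_d -> R) S x v : quadratic P -> quadratic P' ->
  (forall x, conv_hull S x -> P x = P' x) -> conv_hull S x -> conv_hull S v ->
  dotp (\row_j pderiv j P x - \row_j pderiv j P' x) (v - x) = 0.
Proof.
move=> qP qP' PP' Sx Sv; set z := v - x.
have seg (t : R) : 0 <= t -> t <= 1 -> conv_hull S (x + t *: z).
  move=> t0 t1; have [w [w0 w1 wx]] := Sx; have [w' [w'0 w'1 wv]] := Sv.
  exists (fun u => (1 - t) * w u + t * w' u); split.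
  - by move=> u uS; rewrite addr_ge0// mulr_ge0 ?w0 ?w'0// subr_ge0.
  - by rewrite big_split/= -!mulr_sumr w1 w'1; ring.
  - have -> : x + t *: z = (1 - t) *: x + t *: v.
      by rewrite /z scalerBr scalerBl scale1r [RHS]addrAC addrA.
    have sE (k : R) w0' (y0 : 'rV[R]_d) : y0 = \sum_(u <- S) w0' u *: u ->
        k *: y0 = \sum_(u <- S) (k * w0' u) *: u.
      by move=> ->; rewrite scaler_sumr; apply: eq_bigr => u _; rewrite scalerA.
    rewrite (sE _ _ _ wx) (sE _ _ _ wv) -big_split/=; apply: eq_bigr => u _.
    by rewrite scalerDl.
pose u y := dotp (\row_j pderiv j P y) z - dotp (\row_j pderiv j P' y) z.
have au : affine u.
  rewrite /u; apply: affineD; first exact: (affine_dotp_gradient 0).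
  have -> : (fun y => - dotp (\row_j pderiv j P' y) z) = (fun y => -1 * dotp (\row_j pderiv j P' y) z).
    by apply/funext => y; rewrite mulN1r.
  by apply: affineZ; exact: (affine_dotp_gradient 0).
have S2 : conv_hull S (x + 2^-1 *: z) by apply: seg; lra.
have S1 : conv_hull S (x + z) by rewrite -[z]scale1r; apply: seg; lra.
have u2 : u (x + 2^-1 *: z) = 0 by rewrite /u -!gradient_midpoint// !PP' // subrr.
have u4 : u (x + 4^-1 *: z) = 0.
  have e (G : 'rV[R]_d -> R) : quadratic G ->
      dotp (\row_j pderiv j G (x + 4^-1 *: z)) z = 2 * (G (x + 2^-1 *: z) - G x).
    move=> qG; rewrite (gradient_midpoint _ _ qG) scalerA dotpZr.
    by rewrite (_ : 2^-1 * 2^-1 = 4^-1 :> R); field.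
  by rewrite /u !e// !PP'// subrr.
move: u2 u4; rewrite !(affine_line _ _ _ au) dotpDl dotpNl -/(u x); lra.
Qed.

End side_frame.

Section traces.
Context {R : realType} {d : nat}.
Local Notation simplex := {fset 'rV[R]_d}.
Implicit Types (T S : simplex) (x v : 'rV[R]_d) (g h P : 'rV[R]_d -> R).

Lemma trace_interior T mu g h x : #|` T| = d.+1 -> barycentric T mu -> conv_hull T x ->
  continuous h -> (forall z, interior (conv_hull T) z -> g z = h z) -> trace T g x = h x.
Proof.
move=> cT bT Tx ch gh; have cl := conv_hull_closure_interior cT bT Tx.
have PF : ProperFilter (within (interior (conv_hull T)) (nbhs x)).
  by apply: within_nbhs_proper.
rewrite /trace; apply: cvg_lim; first exact: Rhausdorff.
have : h z @[z --> within (interior (conv_hull T)) (nbhs x)] --> h x.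
  by apply: cvg_trans (ch x); apply: cvg_app; exact: cvg_within.
apply: cvg_trans; apply: near_eq_cvg.
have : \forall z \near x, interior (conv_hull T) z -> h z = g z by apply: (@filterS _ (nbhs x) _ setT); [move=> z _ Tz; rewrite gh|exact: filterT].
exact.
Qed.

Lemma pderiv_eq_interior (D : set 'rV[R]_d) j g h z : (forall x, D x -> g x = h x) ->
  interior D z -> pderiv j g z = pderiv j h z.
Proof.
move=> gh Dz; apply: near_eq_derive.
- by apply: filterS Dz => x /gh.
Qed.

Lemma laplacian_eq_interior (D : set 'rV[R]_d) g h z : (forall x, D x -> g x = h x) ->
  interior D z -> laplacian g z = laplacian h z.
Proof.
move=> gh Dz; apply: eq_bigr => j _; apply: (@pderiv_eq_interior (interior D)).
  by move=> x; exact: pderiv_eq_interior.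
have := @open_interior _ D; rewrite openE; exact.
Qed.

Lemma normal_jumpE T T' mu mu' a a' nu (k k' : R) (g P P' : 'rV[R]_d -> R) x :
  #|` T| = d.+1 -> #|` T'| = d.+1 -> (T `&` T')%fset != fset0 ->
  barycentric T mu -> barycentric T' mu' ->
  side_of T (T `&` T')%fset a -> side_of T' (T `&` T')%fset a' ->
  enorm nu = 1 -> 0 < k -> 0 < k' ->
  (forall x z, mu a (x + z) = mu a x + k * dotp nu z) ->
  (forall x z, mu' a' (x + z) = mu' a' x + k' * dotp (- nu) z) ->
  quadratic P -> quadratic P' -> (forall x, conv_hull T x -> g x = P x) ->
  (forall x, conv_hull T' x -> g x = P' x) -> conv_hull (T `&` T')%fset x ->
  normal_jump T T' (fun j => pderiv j g) x =
    dotp (\row_j pderiv j P x - \row_j pderiv j P' x) nu.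
Proof.
move=> cT cT' S0 bT bT' Sa Sa' nu1 k0 k'0 muE muE' qP qP' gP gP' Sx.
have nuN1 : enorm (- nu) = 1 by rewrite enormN.
have Tx : conv_hull T x by apply: sub_conv_hull Sx; exact: fsubsetIl.
have T'x : conv_hull T' x by apply: sub_conv_hull Sx; exact: fsubsetIr.
rewrite /normal_jump (side_normal_frame bT Sa nu1 k0 muE S0)
  (side_normal_frame bT' Sa' nuN1 k'0 muE' S0).
apply: eq_bigr => j _.
rewrite (trace_interior (h := pderiv j P) cT bT Tx); first last.
- by move=> z; exact: pderiv_eq_interior.
- by apply: (@Ck_continuous _ _ 0); apply: Ck_affine; exact: affine_pderiv_quadratic.
rewrite (trace_interior (h := pderiv j P') cT' bT' T'x); first last.
- by move=> z; exact: pderiv_eq_interior.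
- by apply: (@Ck_continuous _ _ 0); apply: Ck_affine; exact: affine_pderiv_quadratic.
by rewrite !mxE; ring.
Qed.

(** Stated for [T] because coordinates are available there; applied to both neighbours, it places
    the point on the side by conformity. *)
Lemma side_param_conv_hull T mu S (t : 'rV[R]_d.-1) : barycentric T mu -> (0 < d)%N ->
  (S `<=` T)%fset -> #|` S| = d -> ref_simplex t -> conv_hull T (side_param S t).
Proof.
move=> bT d0 /fsubsetP ST cS [t0 t1]; apply/(conv_hullP _ bT) => v vT.
have [amu dmu _ _] := bT; have [al [be muE]] := amu v.
have nS i : (i < d)%N -> nth 0 (enum_fset S) i \in T by move=> id; apply: ST; apply: mem_nth; rewrite cS.
have muge u : u \in T -> 0 <= mu v u by move=> uT; rewrite dmu.
have -> : mu v (side_param S t) = mu v S`_0 + \sum_(i < d.-1) t ord0 i * (mu v S`_i.+1 - mu v S`_0).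
  rewrite /side_param !muE dotpDr addrA; congr (_ + _).
  rewrite dotp_sumr; apply: eq_bigr => i _.
  by rewrite dotpZr !muE dotpBr; ring.
have h0 := muge _ (nS 0%N d0).
have -> : mu v S`_0 + \sum_(i < d.-1) t ord0 i * (mu v S`_i.+1 - mu v S`_0) =
    (1 - \sum_(i < d.-1) t ord0 i) * mu v S`_0 + \sum_(i < d.-1) t ord0 i * mu v S`_i.+1.
  rewrite mulrBl mul1r -addrA; congr (_ + _).
  rewrite mulr_suml -sumrN -big_split/=; apply: eq_bigr => i _; ring.
rewrite addr_ge0//; first by rewrite mulr_ge0// subr_ge0.
apply: sumr_ge0 => i _; rewrite mulr_ge0//; apply: muge; apply: nS.
by apply: leq_ltn_trans (ltn_ord i) _; rewrite ltn_predL.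
Qed.

End traces.

(** * Estimates on elements and sides *)

Section mesh_estimates.
Context {R : realType} {d : nat}.
Variable Omega : set 'rV[R]_d.
Hypotheses (d0 : (0 < d)%N) (O0 : Omega !=set0) (oO : open Omega) (bO : bounded_set Omega).
Hypothesis cvO : convex_set (Omega : set (convex_lmodType 'rV[R]_d)).
Variables (f y : 'I_d -> 'rV[R]_d -> R) (p : 'rV[R]_d -> R).
Hypothesis Lf : forall i, Linf Omega (f i).
Hypothesis sol : stokes_solution Omega (H10v Omega) (L2_0 Omega) f y p.
Variable C : R.
Hypothesis C1 : 1 <= C.
Hypothesis bumpC : @bump2_bound R d C.
Local Notation mu := (leb_rV d).
Local Notation simplex := {fset 'rV[R]_d}.
Local Notation N := (d.+1%:R : R).
Local Notation Ke := ((2 * 1 / (expR (- 2) ^+ 2)) ^+ d : R).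
Local Notation Kj := (4 * d%:R * (2 * d.+1%:R / (expR (- 2) ^+ 2)) ^+ d : R).
Implicit Types (T S : simplex) (c x nu a : 'rV[R]_d).

Let C0 : 0 <= C. Proof. exact: le_trans ler01 C1. Qed.

Let Ke0 : 0 <= Ke. Proof. by rewrite exprn_ge0// divr_ge0// exprn_ge0// expR_ge0. Qed.

Let Kj0 : 0 <= Kj.
Proof. by rewrite mulr_ge0 ?exprn_ge0 ?mulr_ge0// divr_ge0 ?mulr_ge0// exprn_ge0// expR_ge0. Qed.

(** Elements only lie in the closure of [Omega]. A strictly smaller cube lies in the interior of the
    closure, which convexity identifies with [Omega]. *)
Lemma cube_in_domain c (b rho : R) : rho < b -> cube c b `<=` closure Omega ->
  cube c rho `<=` Omega.
Proof.
move=> rb cO x cx; apply: interior_closure_convex => //.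
have br : 0 < b - rho by rewrite subr_gt0.
apply: (filterS _ (cube_nbhs x br)) => z xz; apply: cO => i.
rewrite -(subrK (x ord0 i) (z ord0 i)) -addrA; apply: le_trans (ler_normD _ _) _.
by have := xz i; have := cx i; lra.
Qed.

(** [P], [Q] and [F] will be the polynomials that represent on [T] the discrete velocity, the
    discrete pressure and the projected source. *)
Definition approximates T (P : 'I_d -> 'rV[R]_d -> R) (Q : 'rV[R]_d -> R)
    (F : 'I_d -> 'rV[R]_d -> R) (E eps o : R) : Prop :=
  [/\ forall i, quadratic (P i), affine Q, forall i, affine (F i) &
      {ae mu, forall x, conv_hull T x -> [/\ forall i, `|y i x - P i x| <= E,
        `|p x - Q x| <= eps & forall i, `|f i x - F i x| <= o]}].

Lemma test_point_cube T mu c (b : R) : is_simplex T -> barycentric T mu ->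
  0 < inball_diam (conv_hull T) -> d%:R * b <= (2 * N)^-1 * inball_diam (conv_hull T) ->
  c \in test_points T -> cube c b `<=` conv_hull T.
Proof.
move=> [cT _] bT i0 hb cU x cx; apply/(conv_hullP _ bT) => v vT.
apply: (cube_barycentric bT vT i0 _ hb cx); rewrite -cT.
by apply: (test_points_barycentric bT) => //; rewrite -cardfs_eq0 cT.
Qed.

Section element.
Variables (T : simplex) (nu : 'rV[R]_d -> 'rV[R]_d -> R) (r : R).
Hypotheses (sT : is_simplex T) (bT : barycentric T nu) (TO : conv_hull T `<=` closure Omega).
Hypotheses (r0 : 0 < r) (i0 : 0 < inball_diam (conv_hull T)).
Hypothesis rT : d%:R * (2 * r) <= (2 * N)^-1 * inball_diam (conv_hull T).
Variables (P : 'I_d -> 'rV[R]_d -> R) (Q : 'rV[R]_d -> R) (F : 'I_d -> 'rV[R]_d -> R).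
Variables (E eps o w : R).
Hypotheses (E0 : 0 <= E) (eps0 : 0 <= eps) (o0 : 0 <= o).
Hypothesis wE : E / r ^+ 2 + eps / r + o <= w.
Hypothesis aT : approximates T P Q F E eps o.

Let T0 : T != fset0. Proof. by case: sT => cT _; rewrite -cardfs_eq0 cT. Qed.

Let cubeT c : c \in test_points T -> cube c r `<=` conv_hull T /\ cube c r `<=` Omega.
Proof.
move=> cU; have h := test_point_cube sT bT i0 rT cU; split.
  move=> x cx; apply: h => i; apply: le_trans (cx i) _; move: r0; lra.
by apply: (@cube_in_domain c (2 * r)); [move: r0; lra|exact: subset_trans h TO].
Qed.

(** The factor 3 comes from the test points, [Ke] from dividing by the mass of the bump, and [C]
    from the size of its derivatives. *)
Lemma element_bound i x : conv_hull T x ->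
  `|F i x + laplacian (P i) x - pderiv i Q x| <= 3 * (Ke * (C * w)).
Proof.
have [qP aQ aF ae] := aT.
apply: (@test_points_bound _ _ (fun x => F i x + laplacian (P i) x - pderiv i Q x)) => //.
  have [L PL] := laplacian_quadratic (qP i); have [b [s QE]] := aQ.
  have -> : (fun x => F i x + laplacian (P i) x - pderiv i Q x) =
      (fun x => F i x + (L - s ord0 i)).
    by apply/funext => z; rewrite PL (pderiv_affine i z QE) addrA.
  by apply: affineD => //; exact: affine_cst.
move=> c cU; have [cT cO] := cubeT cU.
apply: le_trans (element_residual oO bO Lf sol C1 bumpC (i := i) (c := c) (r := r)
  (E := E) (eps := eps) (o := o) r0 cO E0 eps0 o0 (qP i) aQ (aF i) _ _ _) _.
- by apply: filterS ae => z h /cT /h [].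
- by apply: filterS ae => z h /cT /h [].
- by apply: filterS ae => z h /cT /h [].
by apply: ler_wpM2l => //; rewrite -mulrDr; apply: ler_wpM2l.
Qed.

Lemma div_bound x : conv_hull T x ->
  `|\sum_i pderiv i (P i) x| <= 3 * (Ke * (d%:R * (C * (r * w)))).
Proof.
have [qP aQ aF ae] := aT.
apply: (@test_points_bound _ _ (fun x => \sum_i pderiv i (P i) x)) => //.
  by apply: affine_sum => i; exact: affine_pderiv_quadratic.
move=> c cU; have [cT cO] := cubeT cU.
apply: le_trans (element_div O0 oO bO sol C1 bumpC (c := c) (r := r)
  (E := E) r0 cO E0 qP _) _.
  by move=> i; apply: filterS ae => z h /cT /h [].
apply: ler_wpM2l => //; apply: ler_wpM2l => //; apply: ler_wpM2l => //.
(* The term [E / r] is at most [r * w], because [E / r ^+ 2] is one of the summands below [w]. *)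
rewrite ler_pdivrMr// mulrAC -expr2 -ler_pdivrMl ?exprn_gt0// mulrC.
apply: le_trans wE; rewrite -addrA lerDl addr_ge0// divr_ge0//.
exact: ltW.
Qed.

End element.

Section side.
Variables (T T' : simplex) (mu1 mu2 : 'rV[R]_d -> 'rV[R]_d -> R) (a a' nu : 'rV[R]_d).
Variables (k k' r : R).
Local Notation S := (T `&` T')%fset.
Hypotheses (sT : is_simplex T) (sT' : is_simplex T').
Hypotheses (bT : barycentric T mu1) (bT' : barycentric T' mu2).
Hypotheses (Sa : side_of T S a) (Sa' : side_of T' S a') (cS : #|` S| = d).
Hypotheses (nu1 : enorm nu = 1) (k0 : 0 < k) (k'0 : 0 < k').
Hypothesis muE : forall x z, mu1 a (x + z) = mu1 a x + k * dotp nu z.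
Hypothesis muE' : forall x z, mu2 a' (x + z) = mu2 a' x + k' * dotp (- nu) z.
Hypotheses (TO : conv_hull T `<=` closure Omega) (TO' : conv_hull T' `<=` closure Omega).
Hypotheses (r0 : 0 < r) (i0 : 0 < inball_diam (conv_hull T)) (i0' : 0 < inball_diam (conv_hull T')).
Hypothesis rT : d%:R * (2 * (N * r)) <= (2 * N)^-1 * inball_diam (conv_hull T).
Hypothesis rT' : d%:R * (2 * (N * r)) <= (2 * N)^-1 * inball_diam (conv_hull T').
Variables (P P' : 'I_d -> 'rV[R]_d -> R) (Q Q' : 'rV[R]_d -> R) (F F' : 'I_d -> 'rV[R]_d -> R).
Variables (E eps o w B : R).
Hypotheses (E0 : 0 <= E) (eps0 : 0 <= eps) (o0 : 0 <= o) (B0 : 0 <= B).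
Hypothesis wE : E / r ^+ 2 + eps / r + o <= w.
Hypotheses (aT : approximates T P Q F E eps o) (aT' : approximates T' P' Q' F' E eps o).
Hypothesis PP' : forall i x, conv_hull S x -> P i x = P' i x.
Hypothesis QQ' : forall x, conv_hull S x -> Q x = Q' x.
Hypothesis resT : forall i x, conv_hull T x ->
  `|F i x + laplacian (P i) x - pderiv i Q x| <= B.
Hypothesis resT' : forall i x, conv_hull T' x ->
  `|F' i x + laplacian (P' i) x - pderiv i Q' x| <= B.

Let S0 : S != fset0. Proof. by rewrite -cardfs_eq0 cS -lt0n. Qed.

Let lt2N : (2 * N)^-1 <= (2 * #|` S|%:R)^-1 :> R.
Proof. by rewrite cS lef_pV2 ?posrE ?mulr_gt0 ?ltr0n// ler_pM2l// ler_nat. Qed.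

(** The coordinates of the vertices of the side stay nonnegative by the choice of the radius, and
    that of [a] has the sign of the distance to the hyperplane. *)
Let cube_half c x : c \in test_points S -> cube c (2 * (N * r)) x -> 0 <= dotp nu (x - c) ->
  conv_hull T x.
Proof.
move=> cU cx l0; apply/(conv_hullP _ bT) => v vT; have [ST _ _ TS] := Sa.
have [->|va] := eqVneq v a.
  have := muE c (x - c); rewrite (addrC c) subrK => ->.
  rewrite (frame_side0 bT Sa) ?add0r; last exact: test_points_conv_hull.
  by rewrite mulr_ge0// ltW.
apply: (cube_barycentric bT vT i0 _ rT cx); apply: le_trans lt2N _.
by apply: (test_points_barycentric bT) => //; exact: TS.
Qed.

Let cube_half' c x : c \in test_points S -> cube c (2 * (N * r)) x -> dotp nu (x - c) <= 0 ->
  conv_hull T' x.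
Proof.
move=> cU cx l0; apply/(conv_hullP _ bT') => v vT'; have [ST' _ _ TS'] := Sa'.
have [->|va] := eqVneq v a'.
  have := muE' c (x - c); rewrite (addrC c) subrK => ->.
  rewrite (frame_side0 bT' Sa') ?add0r; last exact: test_points_conv_hull.
  by rewrite dotpNl mulrN oppr_ge0 mulr_ge0_le0// ltW.
apply: (cube_barycentric bT' vT' i0' _ rT' cx); apply: le_trans lt2N _.
by apply: (test_points_barycentric bT') => //; exact: TS'.
Qed.

(** The Laplacian of [V] and the derivative of [W] are constant, so they may be evaluated at [c]
    although the residual is known at [z]. *)
Let source_bound i G (V W : 'rV[R]_d -> R) c z : quadratic V -> affine W ->
  `|f i z - G z| <= o -> `|G z + laplacian V z - pderiv i W z| <= B ->
  `|f i z + (laplacian V c - pderiv i W c)| <= B + o.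
Proof.
move=> qV [b [s WE]] h1 h2; have [L VL] := laplacian_quadratic qV.
rewrite !(pderiv_affine i _ WE) !VL in h2 *.
have -> : f i z + (L - s ord0 i) = (G z + L - s ord0 i) + (f i z - G z) by ring.
by apply: le_trans (ler_normD _ _) _; exact: lerD.
Qed.

Lemma jump_bound i x : conv_hull S x ->
  `|dotp (\row_j pderiv j (P i) x - \row_j pderiv j (P' i) x) nu| <=
    3 * (Kj * (r * (C * w + C * (B + w)))).
Proof.
have [qP aQ aF ae] := aT; have [qP' aQ' aF' ae'] := aT'.
apply: (@test_points_bound _ _
  (fun x => dotp (\row_j pderiv j (P i) x - \row_j pderiv j (P' i) x) nu) S) => //.
  have -> : (fun x => dotp (\row_j pderiv j (P i) x - \row_j pderiv j (P' i) x) nu) =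
      (fun x => dotp (\row_j pderiv j (P i) x) nu + -1 * dotp (\row_j pderiv j (P' i) x) nu).
    by apply/funext => z; rewrite dotpDl dotpNl mulN1r.
  apply: affineD; first exact: (affine_dotp_gradient 0 nu (qP i)).
  by apply: affineZ; exact: (affine_dotp_gradient 0 nu (qP' i)).
move=> c cU; have Sc := test_points_conv_hull S0 cU.
have rho0 : 0 < N * r by rewrite mulr_gt0// ltr0n.
have big z : cube c (N * r) z -> cube c (2 * (N * r)) z.
  by move=> cz j; apply: le_trans (cz j) _; lra.
have cO : cube c (N * r) `<=` Omega.
  apply: (@cube_in_domain c (2 * (N * r))); first by lra.
  move=> z cz; have [l|/ltW l] := leP 0 (dotp nu (z - c)).
    by apply: TO; exact: cube_half cz l.
  by apply: TO'; exact: cube_half' cz l.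
have ow : E / r ^+ 2 + eps / r <= w /\ o <= w.
  have e1 : 0 <= E / r ^+ 2 by rewrite divr_ge0// exprn_ge0// ltW.
  have e2 : 0 <= eps / r by rewrite divr_ge0// ltW.
  by split; move: wE o0 e1 e2; lra.
have [ow1 ow2] := ow.
apply: le_trans (jump_residual d0 oO bO Lf sol C1 bumpC nu1 (i := i) (c := c) (r := r)
  (E := E) (eps := eps) (Rs := B + o) r0 cO E0 eps0 (addr_ge0 B0 o0) (qP i) (qP' i) aQ aQ'
  (PP' i Sc) (QQ' Sc) _ _ _) _.
- move=> z; rewrite -dotpNl -dotpDl; apply: (frame_tangential bT Sa nu1 muE (c := c)) => v vS.
  by apply: (gradient_side (qP i) (qP' i) (PP' i) Sc); exact: vertex_conv_hull.
- apply: filterS ae => z h cz l.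
  have Tz : conv_hull T z by apply: (cube_half cU (big _ cz)); exact: ltW.
  have [h1 h2 h3] := h Tz; split; [exact: h1|exact: h2|].
  exact: (@source_bound i (F i) (P i) Q c z (qP i) aQ (h3 i) (resT i Tz)).
- apply: filterS ae' => z h cz l.
  have Tz : conv_hull T' z by apply: (cube_half' cU (big _ cz)); exact: ltW.
  have [h1 h2 h3] := h Tz; split; [exact: h1|exact: h2|].
  exact: (@source_bound i (F' i) (P' i) Q' c z (qP' i) aQ' (h3 i) (resT' i Tz)).
apply: ler_wpM2l => //; apply: ler_wpM2l; first exact: ltW.
by apply: lerD; apply: ler_wpM2l => //; rewrite lerD2l.
Qed.

End side.

End mesh_estimates.

Section assembly.
Context {R : realType} {d : nat}.
Local Notation mu := (leb_rV d).
Local Notation simplex := {fset 'rV[R]_d}.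
Local Notation mesh := {fset {fset 'rV[R]_d}}.
Implicit Types (T S : simplex) (M : mesh) (x : 'rV[R]_d).

Lemma enorm_le_card (g : 'I_d -> R) (B : R) : (forall i, `|g i| <= B) ->
  enorm (\row_i g i) <= d%:R * B.
Proof.
move=> gB; apply: le_trans (enorm_le_sum _) _.
have -> : d%:R * B = \sum_(i < d) B by rewrite sumr_const card_ord mulr_natl.
by apply: ler_sum => i _; rewrite mxE.
Qed.

Lemma enorm_row_ge (g : 'I_d -> R) (B : R) i : `|enorm (\row_i g i)| <= B -> `|g i| <= B.
Proof.
rewrite ger0_norm ?enorm_ge0//; apply: le_trans.
by have := coord_le_enorm (\row_i g i) i; rewrite mxE.
Qed.

Lemma exists_fields (Omega : set 'rV[R]_d) M (f y yM : 'I_d -> 'rV[R]_d -> R)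
    (p pM : 'rV[R]_d -> R) T mu1 (E eps o : R) : (0 < d)%N ->
  T \in M -> is_simplex T -> barycentric T mu1 ->
  taylor_hood_V Omega M yM -> taylor_hood_Q Omega M pM ->
  {ae mu, forall x, conv_hull T x -> `|enorm (\row_i (y i x - yM i x))| <= E} ->
  {ae mu, forall x, conv_hull T x -> `|p x - pM x| <= eps} ->
  {ae mu, forall x, conv_hull T x ->
    `|enorm (\row_i (f i x - L2_proj Omega M (f i) x))| <= o} ->
  exists P Q F, [/\ approximates f y p T P Q F E eps o,
    forall i x, conv_hull T x -> yM i x = P i x &
    forall x, conv_hull T x -> pM x = Q x].
Proof.
move=> d0 TM sT bT [_ /(_ T TM) hV _] [_ /(_ T TM) hQ _] hy hp hf.
(* The [exists2] is repacked as a conjunction, the form that [choice] accepts. *)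
have [P hP] := choice (fun i => let: ex_intro2 P a b := polynomial_on_quadratic (hV i) in
  ex_intro (fun P => quadratic P /\ forall x, conv_hull T x -> yM i x = P x) P (conj a b)).
have [Q aQ pQ] := polynomial_on_affine hQ.
have [F hF] := choice (fun i => let: ex_intro2 F a b := L2_proj_affine Omega (f i) TM in
  ex_intro (fun F => affine F /\ forall x, interior (conv_hull T) x ->
    L2_proj Omega M (f i) x = F x) F (conj a b)).
exists P, Q, F; split.
- split; [by move=> i; case: (hP i)|exact: aQ|by move=> i; case: (hF i)|].
  apply: filterS3 hy hp (filterI hf (ae_open_hull d0 sT bT)) => x h1 h2 [h3 h4] Tx.
  have ix : interior (conv_hull T) x by apply: (open_hull_interior bT); exact: h4.
  split.
  + move=> i; have [_ <-] := hP i; last exact: Tx.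
    by have := enorm_row_ge i (h1 Tx).
  + by rewrite -pQ//; exact: h2.
  + move=> i; have [_ <-] := hF i; last exact: ix.
    by have := enorm_row_ge i (h3 Tx).
- by move=> i; case: (hP i).
- exact: pQ.
Qed.

Lemma ae_patch M T T' g (B : R) : T' \in elem_patch M T ->
  (Linf_norm (patch_dom M T) g <= B%:E)%E ->
  {ae mu, forall x, conv_hull T' x -> `|g x| <= B}.
Proof.
move=> TT' /Linf_norm_ae; apply: filterS => x h T'x; apply: h; by exists T'.
Qed.

Lemma osc_ge Omega M (f : 'I_d -> 'rV[R]_d -> R) (M' : mesh) T : T \in M' ->
  ((mesh_size T ^+ 2)%:E *
    Linf_normv (conv_hull T) (fun i x => f i x - L2_proj Omega M (f i) x)%R <=
  osc Omega M f M')%E.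
Proof.
move=> TM'; rewrite /osc; have : T \in enum_fset M' by [].
elim: (enum_fset M') => // U s ih; rewrite inE big_cons le_max => /orP[/eqP <-|/ih ->].
  by rewrite lexx.
by rewrite orbT.
Qed.

Lemma jump_norm_le M T (g : 'I_d -> 'rV[R]_d -> R) (B : R) : 0 <= B ->
  (forall T', T' \in M -> share_side T T' ->
    (Linf_norm_side (T `&` T')%fset (fun x =>
      enorm (\row_i normal_jump T T' (fun j => pderiv j (g i)) x)) <= B%:E)%E) ->
  (jump_norm M T g <= B%:E)%E.
Proof.
move=> B0 h; rewrite /jump_norm big_seq_cond; elim/big_ind: _.
- by rewrite lee_fin.
- by move=> a b ha hb; rewrite ge_max ha hb.
- by move=> T' /andP[/h].
Qed.

Lemma Linf_norm_side_le S (g : 'rV[R]_d -> R) (B : R) : 0 <= B ->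
  (forall t, ref_simplex t -> `|g (side_param S t)| <= B) -> (Linf_norm_side S g <= B%:E)%E.
Proof.
move=> B0 h; apply: (@Linf_norm_le _ _ (@ref_simplex R d.-1) (g \o side_param S)) => //.
by apply: nearW => t; exact: h.
Qed.

Lemma Linf_norm_ge0 (D : set 'rV[R]_d) g : (0 <= Linf_norm D g)%E.
Proof. exact: Lnorm_ge0. Qed.

Lemma osc_ge0 Omega M (f : 'I_d -> 'rV[R]_d -> R) (M' : mesh) : (0 <= osc Omega M f M')%E.
Proof.
rewrite /osc; elim: (enum_fset M') => [|U s ih]; first by rewrite big_nil.
by rewrite big_cons le_max ih orbT.
Qed.

End assembly.

(** * Choice of the scale and of the final constant *)

Section efficiency.
Context {R : realType} {d : nat}.
Variable Omega : set 'rV[R]_d.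
Hypotheses (d1 : (1 < d)%N) (O0 : Omega !=set0) (oO : open Omega) (bO : bounded_set Omega).
Hypothesis cvO : convex_set (Omega : set (convex_lmodType 'rV[R]_d)).
Variables (f y yM : 'I_d -> 'rV[R]_d -> R) (p pM : 'rV[R]_d -> R).
Hypothesis Lf : forall i, Linf Omega (f i).
Hypothesis sol : stokes_solution Omega (H10v Omega) (L2_0 Omega) f y p.
Variables (C sigma : R).
Hypothesis C1 : 1 <= C.
Hypothesis bumpC : @bump2_bound R d C.
Hypothesis s1 : 1 <= sigma.
Variable M : {fset {fset 'rV[R]_d}}.
Hypothesis cM : conforming_mesh Omega M.
Hypothesis shM : forall T, T \in M -> mesh_size T <= sigma * inball_diam (conv_hull T).
Hypothesis VM : taylor_hood_V Omega M yM.
Hypothesis QM : taylor_hood_Q Omega M pM.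
Variable T : {fset 'rV[R]_d}.
Hypothesis TM : T \in M.
Local Notation mu := (leb_rV d).
Local Notation N := (d.+1%:R : R).
Local Notation Ke := ((2 * 1 / (expR (- 2) ^+ 2)) ^+ d : R).
Local Notation Kj := (4 * d%:R * (2 * d.+1%:R / (expR (- 2) ^+ 2)) ^+ d : R).
Local Notation h := (mesh_size T).
Implicit Types (x : 'rV[R]_d).

Let C0 : 0 <= C. Proof. exact: le_trans ler01 C1. Qed.

Let Ke0 : 0 <= Ke. Proof. by rewrite exprn_ge0// divr_ge0// exprn_ge0// expR_ge0. Qed.

Let Kj0 : 0 <= Kj.
Proof. by rewrite mulr_ge0 ?exprn_ge0 ?mulr_ge0// divr_ge0 ?mulr_ge0// exprn_ge0// expR_ge0. Qed.

Let d0 : (0 < d)%N. Proof. exact: ltn_trans d1. Qed.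

Let s0 : 0 < sigma. Proof. exact: lt_le_trans s1. Qed.

Let simplexM T' : T' \in M -> is_simplex T'. Proof. by case: cM => + _ _; exact. Qed.

Let h_gt0 T' : T' \in M -> 0 < mesh_size T'.
Proof. by move=> /simplexM[cT' _]; exact: mesh_size_gt0. Qed.

Let conv_sub T' : T' \in M -> conv_hull T' `<=` closure Omega.
Proof. by move=> T'M; have [_ <- _] := cM => x T'x; exists T'. Qed.

Let i_gt0 T' : T' \in M -> 0 < inball_diam (conv_hull T').
Proof.
by move=> T'M; apply: (inball_diam_gt0 d0 _ (shM T'M)); case: (simplexM T'M).
Qed.

Let patchM T' : T' \in elem_patch M T -> T' \in M.
Proof. by rewrite !inE => /andP[]. Qed.

Let T_patch : T \in elem_patch M T. Proof. by rewrite !inE TM eqxx. Qed.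

Let size_patch T' : T' \in elem_patch M T -> h <= sigma * mesh_size T'.
Proof.
rewrite !inE => /andP[T'M /orP[/eqP ->|/eqP cS]].
  by rewrite ler_peMl// ltW// h_gt0.
by apply: neighbour_mesh_size (shM TM) => //; [exact: ltW|exact: simplexM|rewrite cS].
Qed.

(** One factor [sigma] compares the sizes of neighbours, the other is the shape regularity of
    [T']. *)
Let inball_patch T' : T' \in elem_patch M T -> h <= sigma ^+ 2 * inball_diam (conv_hull T').
Proof.
move=> TT'; apply: le_trans (size_patch TT') _; rewrite expr2 -mulrA ler_pM2l//.
by apply: shM; exact: patchM.
Qed.

(* Small enough for the cubes supporting the bumps to lie in the patch. *)
Definition bubble_scale : R := (4 * N ^+ 3 * sigma ^+ 2)^-1.

Local Notation theta := bubble_scale.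

Let den_ge1 : 1 <= 4 * N ^+ 3 * sigma ^+ 2.
Proof.
have N1 : 1 <= N by rewrite ler1n.
have := exprn_ege1 3 N1; have := exprn_ege1 2 s1.
by move: (N ^+ 3) (sigma ^+ 2) => a b *; nra.
Qed.

Let theta0 : 0 < theta. Proof. by rewrite invr_gt0; exact: lt_le_trans den_ge1. Qed.

Let theta1 : theta <= 1.
Proof. by rewrite invf_le1; [exact: den_ge1|exact: lt_le_trans den_ge1]. Qed.

Let r := theta * h.

Let r0 : 0 < r. Proof. by rewrite mulr_gt0// h_gt0. Qed.

Let rh : r <= h. Proof. by apply: ler_piMl; [exact: ltW (h_gt0 TM)|exact: theta1]. Qed.

(** Here the value of [theta] is accounted for: the 4 from the doubled cube and the bound
    [(2 * N)^-1] on coordinates, the three [N] from this bound, from the shifted bump and from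
    [d <= N], and [sigma ^+ 2] from [inball_patch]. *)
Let side_scale T' : T' \in elem_patch M T ->
  d%:R * (2 * (N * r)) <= (2 * N)^-1 * inball_diam (conv_hull T').
Proof.
move=> TT'; have hi := inball_patch TT'.
have N0 : 0 < N by rewrite ltr0n.
have -> : d%:R * (2 * (N * r)) = (2 * N)^-1 * ((d%:R / N) * ((sigma ^+ 2)^-1 * h)).
  rewrite /r /bubble_scale; field; by rewrite !gt_eqF.
rewrite ler_pM2l ?invr_gt0 ?mulr_gt0//.
apply: (@le_trans _ _ (1 * ((sigma ^+ 2)^-1 * h))).
  apply: ler_wpM2r; first by rewrite mulr_ge0 ?invr_ge0 ?exprn_ge0 ?ltW// h_gt0.
  by rewrite ler_pdivrMr// mul1r ler_nat.
by rewrite mul1r ler_pdivrMl ?exprn_gt0.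
Qed.

Let element_scale T' : T' \in elem_patch M T ->
  d%:R * (2 * r) <= (2 * N)^-1 * inball_diam (conv_hull T').
Proof.
move=> TT'; apply: le_trans (side_scale TT'); apply: ler_wpM2l => //.
by rewrite ler_pM2l// ler_peMl ?ltW// (ltr_nat R 1) ltnS.
Qed.

Section bounds.
Variables (E eps O : R).
Hypotheses (E0 : 0 <= E) (eps0 : 0 <= eps) (osc0 : 0 <= O).
Hypothesis hE : (Linf_normv (patch_dom M T) (fun i x => y i x - yM i x)%R <= E%:E)%E.
Hypothesis heps : (Linf_norm (patch_dom M T) (fun x => p x - pM x)%R <= eps%:E)%E.
Hypothesis hO : (osc Omega M f (elem_patch M T) <= O%:E)%E.

(** The oscillation carries the squared sizes of the elements of the patch, which [sigma] compares
    with [h]: hence [o]. [W] puts all errors in the scale of the velocity, and [r <= h] gives the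
    bound by [w]. *)
Let o : R := sigma ^+ 2 * O / h ^+ 2.
Let W : R := E + h * eps + sigma ^+ 2 * O.
Let w : R := W / r ^+ 2.

Let o0 : 0 <= o. Proof. by rewrite divr_ge0 ?mulr_ge0 ?exprn_ge0// ltW// h_gt0. Qed.

Let W0 : 0 <= W.
Proof.
by rewrite !addr_ge0// mulr_ge0 ?exprn_ge0//; apply: ltW => //; exact: h_gt0.
Qed.

Let w0 : 0 <= w. Proof. by rewrite divr_ge0// exprn_ge0// ltW. Qed.

Let wE : E / r ^+ 2 + eps / r + o <= w.
Proof.
rewrite /w /W !mulrDl; apply: lerD; first apply: lerD => //.
  rewrite ler_pdivlMr ?exprn_gt0// expr2 mulrA divfK ?gt_eqF// mulrC.
  by apply: ler_wpM2r.
rewrite /o; apply: ler_wpM2l; first by rewrite mulr_ge0 ?exprn_ge0// ltW.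
by rewrite lef_pV2 ?posrE ?exprn_gt0 ?h_gt0// ler_pXn2r// nnegrE ltW// h_gt0.
Qed.

Let ow : o <= w.
Proof.
apply: le_trans wE; rewrite lerDr addr_ge0// divr_ge0//.
  by rewrite exprn_ge0// ltW.
exact: ltW.
Qed.

Let fields T' mu1 : T' \in elem_patch M T -> barycentric T' mu1 ->
  exists P Q F, [/\ approximates f y p T' P Q F E eps o,
    forall i x, conv_hull T' x -> yM i x = P i x &
    forall x, conv_hull T' x -> pM x = Q x].
Proof.
move=> TT' bT'; have T'M := patchM TT'.
apply: (exists_fields d0 T'M (simplexM T'M) bT' VM QM).
- exact: (ae_patch TT' hE).
- exact: (ae_patch TT' heps).
- apply: Linf_norm_ae.
  have h0' := h_gt0 T'M.
  have := le_trans (osc_ge Omega M f TT') hO.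
  rewrite -lee_pdivlMl ?exprn_gt0// => /le_trans; apply.
  rewrite -EFinM lee_fin /o ler_pdivrMl ?exprn_gt0// mulrA ler_pdivlMr ?exprn_gt0 ?h_gt0//.
  have -> : mesh_size T' ^+ 2 * (sigma ^+ 2 * O) = O * (sigma * mesh_size T') ^+ 2 by ring.
  apply: ler_wpM2l => //; rewrite ler_pXn2r ?nnegrE//.
  - exact: size_patch.
  - exact: ltW (h_gt0 TM).
  - by rewrite mulr_ge0// ltW.
Qed.

Let B : R := 3 * (Ke * (C * w)).

Let B0 : 0 <= B.
Proof.
exact: mulr_ge0 (ler0n R 3) (mulr_ge0 Ke0 (mulr_ge0 C0 w0)).
Qed.

(** [B] bounds the residual with the projected source and [w] the difference of [f] from it; [d]
    passes from components to Euclidean length. *)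
Lemma residual_le :
  (Linf_normv (conv_hull T) (fun i x => f i x + laplacian (yM i) x - pderiv i pM x)%R <=
   (d%:R * (B + w))%:E)%E.
Proof.
have [mu1 bT] := exists_barycentric (simplexM TM).
have [P [Q [F [aT yP pQ]]]] := fields T_patch bT.
apply: Linf_norm_le; first exact: mulr_ge0 (ler0n R d) (addr_ge0 B0 w0).
have [qP aQ aF ae] := aT.
apply: filterS2 ae (ae_open_hull d0 (simplexM TM) bT) => x h1 h2 Tx.
have ix : interior (conv_hull T) x by apply: (open_hull_interior bT); exact: h2.
rewrite ger0_norm ?enorm_ge0//; apply: enorm_le_card => i.
have [_ _ h3] := h1 Tx.
rewrite (laplacian_eq_interior (yP i) ix) (pderiv_eq_interior i pQ ix).
have -> : f i x + laplacian (P i) x - pderiv i Q x =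
  (F i x + laplacian (P i) x - pderiv i Q x) + (f i x - F i x) by ring.
apply: le_trans (ler_normD _ _) _; apply: lerD; last exact: le_trans (h3 i) ow.
exact: (element_bound O0 oO bO cvO Lf sol C1 bumpC (simplexM TM) bT (conv_sub TM) r0
  (i_gt0 TM) (element_scale T_patch) E0 eps0 o0 wE aT).
Qed.

Lemma divergence_le :
  (Linf_norm (conv_hull T) (fun x => \sum_(i < d) pderiv i (yM i) x)%R <=
   (3 * (Ke * (d%:R * (C * (r * w)))))%:E)%E.
Proof.
have [mu1 bT] := exists_barycentric (simplexM TM).
have [P [Q [F [aT yP pQ]]]] := fields T_patch bT.
apply: Linf_norm_le.
  exact: mulr_ge0 (ler0n R 3) (mulr_ge0 Ke0 (mulr_ge0 (ler0n R d) (mulr_ge0 C0 (mulr_ge0 (ltW r0) w0)))).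
apply: filterS (ae_open_hull d0 (simplexM TM) bT) => x h2 Tx.
have ix : interior (conv_hull T) x by apply: (open_hull_interior bT); exact: h2.
rewrite (eq_bigr (fun i => pderiv i (P i) x)) => [|i _]; last first.
  exact: (pderiv_eq_interior i (yP i) ix).
exact: (div_bound O0 oO bO cvO sol C1 bumpC (simplexM TM) bT (conv_sub TM) r0
  (i_gt0 TM) (element_scale T_patch) E0 eps0 o0 wE aT).
Qed.

Lemma jump_le :
  (jump_norm M T yM <= (d%:R * (3 * (Kj * (r * (C * w + C * (B + w))))))%:E)%E.
Proof.
have Z0 : 0 <= d%:R * (3 * (Kj * (r * (C * w + C * (B + w))))).
  apply: mulr_ge0 (ler0n R d) (mulr_ge0 (ler0n R 3) (mulr_ge0 Kj0 (mulr_ge0 (ltW r0) _))).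
  exact: addr_ge0 (mulr_ge0 C0 w0) (mulr_ge0 C0 (addr_ge0 B0 w0)).
apply: jump_norm_le => // T' T'M shTT'.
have TT' : T' \in elem_patch M T by rewrite !inE T'M shTT' orbT.
have cS : #|` (T `&` T')%fset| = d by apply/eqP.
have [cT _] := simplexM TM; have [cT' _] := simplexM T'M.
have [a Sa _] := exists_side_of cT cS.
have [a' Sa' _] : exists2 a', side_of T' (T `&` T')%fset a' & a' \notin T.
  by rewrite fsetIC; apply: exists_side_of; rewrite // fsetIC.
have S0 : (T `&` T')%fset != fset0 by rewrite -cardfs_eq0 cS -lt0n.
have [mu1 bT] := exists_barycentric (simplexM TM).
have [mu2 bT'] := exists_barycentric (simplexM T'M).
have [P [Q [F [aT yP pQ]]]] := fields T_patch bT.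
have [P' [Q' [F' [aT' yP' pQ']]]] := fields TT' bT'.
have conf : conv_hull T `&` conv_hull T' = conv_hull (T `&` T')%fset.
  by case: cM => _ _; exact.
have [nu [k [k' [nu1 k0 k'0 muE muE']]]] := exists_side_frame d0 bT bT' Sa Sa' cS conf.
have inT x : conv_hull (T `&` T')%fset x -> conv_hull T x by rewrite -conf => -[].
have inT' x : conv_hull (T `&` T')%fset x -> conv_hull T' x by rewrite -conf => -[].
apply: Linf_norm_side_le => // t reft.
have St : conv_hull (T `&` T')%fset (side_param (T `&` T')%fset t).
  rewrite -conf; split.
    by apply: (side_param_conv_hull bT d0 _ cS reft); exact: fsubsetIl.
  by apply: (side_param_conv_hull bT' d0 _ cS reft); exact: fsubsetIr.
rewrite ger0_norm ?enorm_ge0//; apply: enorm_le_card => i.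
have [qP aQ _ _] := aT; have [qP' aQ' _ _] := aT'.
rewrite (normal_jumpE cT cT' S0 bT bT' Sa Sa' nu1 k0 k'0 muE muE' (qP i) (qP' i) (yP i) (yP' i) St).
apply: (jump_bound d0 O0 oO bO cvO Lf sol C1 bumpC bT bT' Sa Sa' cS nu1 k0 k'0 muE muE'
  (conv_sub TM) (conv_sub T'M) r0 (i_gt0 TM) (i_gt0 T'M) (side_scale T_patch) (side_scale TT')
  E0 eps0 o0 B0 wE aT aT') => //.
- by move=> j x Sx; rewrite -(yP j x (inT x Sx)) -(yP' j x (inT' x Sx)).
- by move=> x Sx; rewrite -(pQ x (inT x Sx)) -(pQ' x (inT' x Sx)).
- by move=> j x; exact: (element_bound O0 oO bO cvO Lf sol C1 bumpC (simplexM TM) bT (conv_sub TM) r0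
    (i_gt0 TM) (element_scale T_patch) E0 eps0 o0 wE aT).
- by move=> j x; exact: (element_bound O0 oO bO cvO Lf sol C1 bumpC (simplexM T'M) bT' (conv_sub T'M) r0
    (i_gt0 T'M) (element_scale TT') E0 eps0 o0 wE aT').
Qed.

(** The three summands come from the residual, the jump and the divergence. Since [w = W / r ^+ 2]
    and [r = theta * h], the powers of [h] cancel and only powers of [theta] remain; [sigma ^+ 2] is
    lost in bounding [W]. *)
Definition efficiency_constant : R :=
  (d%:R * (3 * Ke * C + 1) / theta ^+ 2 +
   2^-1 * (d%:R * (3 * Kj * C * (3 * Ke * C + 2))) / theta +
   3 * Ke * d%:R * C / theta) * sigma ^+ 2.

Lemma efficiency_constant_ge0 : 0 <= efficiency_constant.
Proof.
have t0 := ltW theta0.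
have K0 : 0 <= 3 * Ke * C := mulr_ge0 (mulr_ge0 (ler0n R 3) Ke0) C0.
have K1 : 0 <= 3 * Kj * C := mulr_ge0 (mulr_ge0 (ler0n R 3) Kj0) C0.
apply: mulr_ge0; last by rewrite exprn_ge0// ltW.
apply: addr_ge0; first apply: addr_ge0.
- by rewrite divr_ge0 ?exprn_ge0// mulr_ge0// addr_ge0.
- by rewrite divr_ge0// mulr_ge0 ?invr_ge0// mulr_ge0// mulr_ge0// addr_ge0.
- rewrite divr_ge0//; apply: mulr_ge0 C0; apply: mulr_ge0 (ler0n R d).
  exact: mulr_ge0 (ler0n R 3) Ke0.
Qed.

Lemma error_indicator_le :
  (error_indicator M f yM pM T <= (efficiency_constant * (E + h * eps + O))%:E)%E.
Proof.
have h0 := h_gt0 TM.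
have WO : W <= sigma ^+ 2 * (E + h * eps + O).
  rewrite /W mulrDr lerD2r ler_peMl ?exprn_ege1// addr_ge0// mulr_ge0// ltW//.
apply: (@le_trans _ _ (h ^+ 2 * (d%:R * (B + w)) +
   h / 2 * (d%:R * (3 * (Kj * (r * (C * w + C * (B + w)))))) +
   h * (3 * (Ke * (d%:R * (C * (r * w))))))%:E).
  rewrite !EFinD !(EFinM (_ : R) (_ * _)); apply: leeD; first apply: leeD.
  - by apply: lee_wpmul2l; [rewrite lee_fin exprn_ge0// ltW|exact: residual_le].
  - by apply: lee_wpmul2l; [rewrite lee_fin divr_ge0// ltW|exact: jump_le].
  - by apply: lee_wpmul2l; [rewrite lee_fin ltW|exact: divergence_le].
rewrite lee_fin /efficiency_constant -[leRHS]mulrA.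
have -> : h ^+ 2 * (d%:R * (B + w)) +
   h / 2 * (d%:R * (3 * (Kj * (r * (C * w + C * (B + w)))))) +
   h * (3 * (Ke * (d%:R * (C * (r * w))))) =
  (d%:R * (3 * Ke * C + 1) / theta ^+ 2 +
   2^-1 * (d%:R * (3 * Kj * C * (3 * Ke * C + 2))) / theta +
   3 * Ke * d%:R * C / theta) * W.
  rewrite /B /w /r; move: (gt_eqF theta0) (gt_eqF h0); move: Ke Kj (W) theta h => ke kj W' th hh th0 hh0; field.
  by rewrite th0 hh0.
apply: ler_wpM2l => //.
have := efficiency_constant_ge0; rewrite /efficiency_constant pmulr_lge0//.
by rewrite exprn_gt0.
Qed.

End bounds.

End efficiency.

Theorem theorem3p4 (R : realType) (d : nat) (hd : d = 2%N \/ d = 3%N)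
    (Omega : set 'rV[R]_d)
    (Omega_nonempty : Omega !=set0)
    (Omega_open : open Omega)
    (Omega_bounded : bounded_set Omega)
    (Omega_convex : convex_set (Omega : set (convex_lmodType 'rV[R]_d)))
    (Omega_polytopal : exists A : {fset 'rV[R]_d}, closure Omega = conv_hull A)
    (M0 : {fset {fset 'rV[R]_d}})
    (M0_mesh : conforming_mesh Omega M0)
    (TT : set {fset {fset 'rV[R]_d}})
    (TT_conforming : forall M, TT M -> conforming_mesh Omega M)
    (TT_refines : forall M, TT M -> refines M M0)
    (TT_shape_regular : shape_regular TT) :
  exists2 C : R, 0 < C &
    forall (f : 'I_d -> 'rV[R]_d -> R) (y : 'I_d -> 'rV[R]_d -> R)
      (p : 'rV[R]_d -> R),
    (forall i, Linf Omega (f i)) ->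
    stokes_solution Omega (H10v Omega) (L2_0 Omega) f y p ->
    forall (M : {fset {fset 'rV[R]_d}}) (yM : 'I_d -> 'rV[R]_d -> R)
      (pM : 'rV[R]_d -> R),
    TT M ->
    stokes_solution Omega (taylor_hood_V Omega M) (taylor_hood_Q Omega M)
      f yM pM ->
    forall T, T \in M ->
    (error_indicator M f yM pM T <=
      C%:E * (Linf_normv (patch_dom M T) (fun i x => y i x - yM i x)%R
              + (mesh_size T)%:E *
                Linf_norm (patch_dom M T) (fun x => p x - pM x)%R
              + osc Omega M f (elem_patch M T)))%E.
Proof.
have d1 : (1 < d)%N by case: hd => ->.
have d0 : (0 < d)%N by exact: ltn_trans d1.
have [C C1 bumpC] := @exists_bump2_bound R d.
have [sigma0 hsigma] := TT_shape_regular.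
(* With [sigma >= 1], the comparison of sizes also covers [T] itself, and [sigma ^+ 2] may multiply
   all the error terms. *)
pose sigma := Num.max sigma0 1.
have s1 : 1 <= sigma by rewrite le_max lexx orbT.
have K0 := @efficiency_constant_ge0 R d C sigma C1 s1.
set K := efficiency_constant _ _ in K0 *.
(* [K] is only known to be nonnegative, and a positive constant is also what makes the case of an
   infinite right-hand side trivial. *)
exists (K + 1); first by rewrite ltr_wpDl.
move=> f y p Lf sol M yM pM TTM [VM QM _ _] T TM.
have shM T' : T' \in M -> mesh_size T' <= sigma * inball_diam (conv_hull T').
  move=> T'M; apply: le_trans (hsigma M T' TTM T'M) _.
  by apply: ler_wpM2r; [exact: inball_diam_ge0|rewrite le_max lexx].
have cM := TT_conforming M TTM.
have h0 : 0 < mesh_size T.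
  by apply: mesh_size_gt0 => //; have [/(_ T TM)[]] := cM.
set A := Linf_normv _ _; set Bq := Linf_norm _ _; set O := osc _ _ _ _.
have A0 : (0 <= A)%E by exact: Linf_norm_ge0.
have B0 : (0 <= Bq)%E by exact: Linf_norm_ge0.
have O0 : (0 <= O)%E by exact: osc_ge0.
have hB0 : (0 <= (mesh_size T)%:E * Bq)%E by rewrite mule_ge0// lee_fin ltW.
have [fin|] := ltP (A + (mesh_size T)%:E * Bq + O)%E +oo%E; last first.
  by rewrite leye_eq => /eqP ->; rewrite gt0_muley ?leey// lte_fin ltr_wpDl.
have Afin : A \is a fin_num.
  rewrite ge0_fin_numE//; apply: le_lt_trans fin.
  by rewrite -addeA leeDl// adde_ge0.
have Ofin : O \is a fin_num.
  by rewrite ge0_fin_numE//; apply: le_lt_trans fin; rewrite leeDr// adde_ge0.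
(* The mesh size is positive, so an infinite norm would make the product infinite. *)
have Bfin : Bq \is a fin_num.
  have hfin : ((mesh_size T)%:E * Bq < +oo)%E.
    by apply: le_lt_trans fin; apply: (@le_trans _ _ (A + (mesh_size T)%:E * Bq)%E); rewrite ?leeDr ?leeDl.
  rewrite ge0_fin_numE// ltey; apply/negP => /eqP Boo; move: hfin.
  by rewrite Boo gt0_muley ?lte_fin.
have hA : (A <= (fine A)%:E)%E by rewrite fineK.
have hB : (Bq <= (fine Bq)%:E)%E by rewrite fineK.
have hO : (O <= (fine O)%:E)%E by rewrite fineK.
have fA : 0 <= fine A by exact: fine_ge0.
have fB : 0 <= fine Bq by exact: fine_ge0.
have fO : 0 <= fine O by exact: fine_ge0.
apply: le_trans (error_indicator_le d1 Omega_nonempty Omega_open Omega_bounded Omega_convex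
  Lf sol C1 bumpC s1 cM shM VM QM TM fA fB fO hA hB hO) _.
have -> : (A + (mesh_size T)%:E * Bq + O)%E =
    (fine A + mesh_size T * fine Bq + fine O)%:E by rewrite !EFinD EFinM !fineK.
rewrite -EFinM lee_fin; apply: ler_wpM2r; last by rewrite lerDl.
by rewrite !addr_ge0// mulr_ge0// ltW.
Qed.
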